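(* Let $\alpha>0$ be a real number that is not an integer, and let $B\subset\mathbb Z$ with $d^*(B)>0$. Then $$\{\lfloor n^{\alpha}\rfloor+b: n\in\mathbb N,\ b\in B\}$$ is thick. Furthermore, if $C\subset\mathbb N$ satisfies $\bar d(C)>0$, then $$\{\lfloor c^{\alpha}\rfloor+b: c\in C,\ b\in B\}$$ is piecewise Bohr.
   Context: $\mathbb N$ is the set of positive integers and $\lfloor x\rfloor$ is the greatest integer less than or equal to $x$. The upper Banach density of $B\subset\mathbb Z$ is $d^*(B):=\lim_{M\to\infty}\sup_{N\in\mathbb Z}\frac{|B\cap[N,N+M-1]|}{M}$, and the upper density of $C$ is $\bar d(C):=\limsup_{N\to\infty}\frac{|C\cap[1,N]|}{N}$. A set $S\subset\mathbb Z$ is thick if for every $L\in\mathbb N$ it contains an interval of integers of length $L$. A set $S\subset\mathbb Z$ is Bohr if there is a trigonometric polynomial $P(n)=\sum_{j=1}^k c_je^{i\lambda_jn}$ ($c_j\in\mathbb C$, $\lambda_j\in\mathbb R$) such that $\{n\in\mathbb Z:\operatorname{Re}P(n)>0\}$ is nonempty and contained in $S$. A set is piecewise Bohr if it contains the intersection of a Bohr set and a thick set (equivalently, is such an intersection). *)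

(* Defs.v *)
From HB Require Import structures.
From mathcomp Require Import all_boot all_order all_algebra.
From mathcomp Require Import finmap complex.
From mathcomp Require Import all_classical all_reals all_analysis.

Set Implicit Arguments.
Unset Strict Implicit.
Unset Printing Implicit Defensive.

Import Order.TTheory GRing.Theory Num.Theory.
Import numFieldNormedType.Exports.

Local Open Scope classical_set_scope.
Local Open Scope ring_scope.

(* The value at M = 0 is the irrelevant 0 / 0 = 0. For M > 0 the supremum is
   that of a nonempty set of reals in [0, 1], and the limit always exists. *)
Definition upper_banach_density (R : realType) (B : set int) : R :=
  lim ((fun M : nat =>
    sup [set (#|` fset_set (B `&` `[N, N + M%:Z - 1])|%fset%:R / M%:R : R)
        | N in [set: int]]) @ \oo).

Definition upper_density (R : realType) (C : set nat) : R :=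
  limn_sup (fun N : nat =>
    #|` fset_set (C `&` `[1%N, N])|%fset%:R / N%:R : R).

Definition thick (S : set int) : Prop :=
  forall L : nat, (0 < L)%N ->
    exists N : int, `[N, N + L%:Z - 1] `<=` S.

(* exp (i theta), by Euler's formula *)
Definition cis (R : realType) (theta : R) : R[i] := (cos theta +i* sin theta)%C.

Definition trig_poly (R : realType) (k : nat)
    (c : 'I_k -> R[i]) (lambda : 'I_k -> R) (n : int) : R[i] :=
  \sum_(j < k) c j * cis (lambda j * n%:~R).

Definition bohr (R : realType) (S : set int) : Prop :=
  exists (k : nat) (c : 'I_k -> R[i]) (lambda : 'I_k -> R),
    let U := [set n : int | 0 < complex.Re (trig_poly c lambda n)] in
    U !=set0 /\ U `<=` S.

Definition piecewise_bohr (R : realType) (S : set int) : Prop :=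
  exists A T : set int, [/\ bohr R A, thick T & A `&` T `<=` S].

(* Main.v *)
(* Fix a dense set B and write a(n) = [n^alpha]. For t <> 0 the averages of
   exp (i t n^alpha) tend to 0: van der Corput differencing reduces this to a
   phase whose increments decrease slowly to 0, where the Kusmin-Landau bound
   applies. Fejer interpolation handles the integer part, so the averages of
   exp (i theta a(n)) tend to 0, uniformly for theta in [c, pi].

   B gives rise to an invariant mean on the bounded functions on Z that is
   positive on 1_B, and this mean L can be taken to be an extreme point of the
   set of invariant means, that is, ergodic. Approximate 1_B in the L2
   seminorm of L by a trigonometric polynomial g, so well that r = 1_B - g
   correlates with no character. Then, by ergodicity and a Wiener-type argument,
   the squared correlations of r are small on average along {h - h'}, and the
   decay of the exponential sums transfers this to {a(n) - a(m)}. Hence for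
   most t the average of w(n) 1_B(t - a(n)) is that of w(n) g(t - a(n)), for all
   bounded weights w. The latter is a trigonometric polynomial in t, nearly equal
   to the constant L(1_B) if w = 1, and in general with coefficients that
   converge along an ultrafilter as the length of the average grows. So t lies
   in the sumset whenever the limit polynomial exceeds a positive constant,
   outside a set of L-mean 0, whose complement is thick. *)

Require Import Defs.
From mathcomp Require Import all_boot all_order all_algebra.
From mathcomp Require Import finmap complex.
From mathcomp Require Import all_classical all_reals all_analysis.
From mathcomp Require Import ring lra zify.

Set Implicit Arguments.
Unset Strict Implicit.
Unset Printing Implicit Defensive.

Import Order.TTheory GRing.Theory Num.Theory.
Import numFieldNormedType.Exports.

Local Open Scope classical_set_scope.
Local Open Scope ring_scope.

(** * Exponential sums along powers *)

(** No spectral measure is constructed. A correlation function of a mean enters only through a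
    duality: an inequality between trigonometric polynomials that holds at every frequency survives
    when cos (th k) is replaced by the correlation at k. This is why the exponential sums must be
    bounded uniformly in the frequency. Near frequency 0 they do not decay, and there the Fejer
    kernel of an interval serves as the majorant.

    The weights w are arbitrary, so positivity cannot be used on the weighted second moments
    directly. Cauchy-Schwarz removes the weights at the price of squaring the correlations, and the
    square of a positive definite function is again positive definite.

    The exceptional set must have arbitrarily small mean while g stays fixed, for otherwise the
    limit polynomial would change with the precision. A coarse g, whose quality depends only on the
    densities, is therefore compared with a finer polynomial. The square of their difference is
    itself a trigonometric polynomial, so its averages along t - a(n) are small for every t, without
    exceptions. *)

Lemma sum_const_ord (R : pzSemiRingType) (K : nat) (a : R) :
  \sum_(j < K) a = K%:R * a.
Proof. by rewrite sumr_const card_ord mulr_natl. Qed.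

Lemma sin_lipschitz (R : realType) (a b : R) : `|sin a - sin b| <= `|a - b|.
Proof.
wlog ab : a b / b <= a => [hw|].
  have /orP[/hw//|/hw] := le_total b a.
  by rewrite (distrC (sin b)) (distrC b).
have [c _ ->] := MVT_segment ab (fun x _ => is_derive_sin x)
  (continuous_subspaceT (@continuous_sin R)).
- by rewrite normrM ler_piMl// cos_max.
Qed.

Lemma cos_lipschitz (R : realType) (a b : R) : `|cos a - cos b| <= `|a - b|.
Proof.
rewrite -!sinDpihalf (le_trans (sin_lipschitz _ _))//.
by rewrite opprD addrACA subrr addr0.
Qed.

Lemma cos_ge (R : realType) (x : R) : 1 - x ^+ 2 / 2 <= cos x.
Proof.
have -> : cos x = 1 - 2 * sin (x / 2) ^+ 2.
  by have := cos2Dsin2 (x / 2); rewrite {3}(splitr x) cosD -!expr2; lra.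
have := sin_lipschitz (x / 2) 0; rewrite sin0 !subr0 => h.
have : sin (x / 2) ^+ 2 <= (x / 2) ^+ 2.
  by rewrite -(real_normK (num_real (sin _))) -(real_normK (num_real (x / 2))) lerXn2r// nnegrE.
lra.
Qed.

Lemma cos_ge_half (R : realType) (x : R) : `|x| <= 1 -> 1 / 2 <= cos x.
Proof.
move=> x1; apply: le_trans (cos_ge x).
have : x ^+ 2 <= 1 by rewrite -(real_normK (num_real x)) exprn_ile1.
lra.
Qed.

Lemma sin_ge_half (R : realType) (y : R) : 0 <= y <= 1 -> y / 2 <= sin y.
Proof.
move=> /andP[y0 y1].
have [c] := MVT_segment y0 (fun x _ => is_derive_sin x)
  (continuous_subspaceT (@continuous_sin R)).
rewrite in_itv/= sin0 !subr0 => /andP[c0 cy] ->.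
have : 1 / 2 <= cos c by apply: cos_ge_half; rewrite ger0_norm//; lra.
nra.
Qed.

Lemma cosD_cot (R : realType) (x d : R) : sin (d / 2) != 0 ->
  cos x + cos (x + d) = cos (d / 2) / sin (d / 2) * (sin (x + d) - sin x).
Proof.
move=> s0.
have -> : x + d = (x + d / 2) + d / 2 by lra.
have {1 4}-> : x = (x + d / 2) - d / 2 by lra.
move: (x + d / 2) => m; rewrite cosB sinB cosD sinD; field; exact: s0.
Qed.

Lemma sum_succ (V : zmodType) (f : nat -> V) (N : nat) :
  f 0%N + \sum_(n < N) f n.+1 = \sum_(n < N) f n + f N.
Proof. by rewrite -(big_ord_recl N (fun n : 'I_N.+1 => f n)) big_ord_recr. Qed.

(** Summation by parts: as [c] is nonnegative and nondecreasing, the first term and the variation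
    add up to c 0 + (c N - c 0) = c N. The boundary term at N is kept exact. *)
Lemma abel_bound (R : realType) (c s : nat -> R) (N : nat) :
  0 <= c 0%N -> (forall n, (n < N)%N -> c n <= c n.+1) ->
  (forall n, `|s n| <= 1) ->
  `|\sum_(n < N.+1) c n * (s n.+1 - s n) - c N * s N.+1| <= c N.
Proof.
move=> c0 cS s1; elim: N cS => [|N IH] cS.
  rewrite big_ord1 mulrBr addrAC subrr add0r normrN normrM ger0_norm//.
  by rewrite ler_piMr.
have {}IH := IH (fun n nN => cS n (ltnW nN)).
have cN := cS _ (ltnSn N).
rewrite big_ord_recr/=.
have -> : \sum_(i < N.+1) c i * (s i.+1 - s i) + c N.+1 * (s N.+2 - s N.+1) -
    c N.+1 * s N.+2 =
  (\sum_(i < N.+1) c i * (s i.+1 - s i) - c N * s N.+1) -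
    (c N.+1 - c N) * s N.+1 by ring.
apply: (le_trans (ler_normB _ _)).
rewrite normrM (ger0_norm (_ : 0 <= c N.+1 - c N)) ?subr_ge0//.
have : (c N.+1 - c N) * `|s N.+1| <= c N.+1 - c N.
  by rewrite ler_piMr// subr_ge0.
lra.
Qed.

(* Kusmin-Landau: by [cosD_cot], cos x_n + cos x_(n+1) is a cotangent times a
   difference of consecutive sines, and the cotangents are monotone. *)
Lemma kusmin_landau (R : realType) (x : nat -> R) (N : nat) :
  (forall n, (n <= N)%N -> 0 < x n.+1 - x n <= 1) ->
  (forall n, (n < N)%N -> x n.+2 - x n.+1 <= x n.+1 - x n) ->
  `|\sum_(n < N.+1) cos (x n)| <= 4 / (x N.+1 - x N) + 1.
Proof.
move=> d01 dS.
pose y n := (x n.+1 - x n) / 2.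
pose c n := cos (y n) / sin (y n).
have y01 n : (n <= N)%N -> 0 < y n <= 1 by move=> /d01; rewrite /y; lra.
have sy n : (n <= N)%N -> 0 < sin (y n).
  move=> /y01 h; apply: (@lt_le_trans _ _ (y n / 2)); first by lra.
  by apply: sin_ge_half; lra.
have cy n : (n <= N)%N -> 0 <= cos (y n).
  move=> /y01 h; apply: (@le_trans _ _ (1 / 2)); first by lra.
  by apply: cos_ge_half; rewrite gtr0_norm; lra.
have cS n : (n < N)%N -> c n <= c n.+1.
  move=> nN; rewrite /c ler_pdivrMr ?sy//; last exact: ltnW.
  rewrite mulrAC ler_pdivlMr ?sy// -subr_ge0 mulrC.
  have -> : sin (y n) * cos (y n.+1) = cos (y n.+1) * sin (y n) by ring.
  rewrite [X in X - _]mulrC.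
  have := @sin_ge0_pi R (y n - y n.+1).
  rewrite sinB => H; have /H : 0 <= y n - y n.+1 <= pi.
    have := y01 _ (ltnW nN); have := y01 _ nN; have := dS _ nN.
    have := pi_ge2 R; rewrite /y; lra.
  lra.
have sumE : \sum_(n < N.+1) (cos (x n) + cos (x n.+1)) =
    \sum_(n < N.+1) c n * (sin (x n.+1) - sin (x n)).
  apply: eq_bigr => -[n /= nN] _; have := @cosD_cot R (x n) (x n.+1 - x n).
  by rewrite subrKC; apply; rewrite gt_eqF// sy.
have telE : \sum_(n < N.+1) (cos (x n) + cos (x n.+1)) =
    2 * (\sum_(n < N.+1) cos (x n)) + cos (x N.+1) - cos (x 0%N).
  have h : cos (x 0%N) + \sum_(n < N.+1) cos (x n.+1) =
      \sum_(n < N.+1) cos (x n) + cos (x N.+1).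
    exact: (sum_succ (fun n => cos (x n))).
  rewrite big_split/=; lra.
have cN0 : 0 <= c N by rewrite divr_ge0 ?cy// ltW// sy.
have cN : c N <= 4 / (x N.+1 - x N).
  have := y01 _ (leqnn N); rewrite /c /y; set d := x N.+1 - x N => h.
  have h2 : d / 2 / 2 <= sin (d / 2) by apply: sin_ge_half; lra.
  rewrite ler_pdivrMr; last lra.
  apply: (le_trans (cos_le1 _)); rewrite mulrAC ler_pdivlMr; lra.
have := @abel_bound R c (fun n => sin (x n)) N.
rewrite -sumE telE => /(_ (divr_ge0 (cy 0%N _) (ltW (sy 0%N _))) cS (fun n => sin_max _)).
move=> /(_ isT isT).
have := cos_max (x 0%N); have := cos_max (x N.+1); have := sin_max (x N.+1).
rewrite !ler_norml => /andP[a1 a2] /andP[a3 a4] /andP[a5 a6] /andP[a7 a8].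
have a9 : c N * sin (x N.+1) <= c N by rewrite ler_piMr.
have a10 : - c N <= c N * sin (x N.+1) by rewrite -mulrN1 ler_wpM2l.
lra.
Qed.

Definition fdiff (V : zmodType) (x : nat -> V) (n : nat) : V := x n.+1 - x n.

(** What Kusmin-Landau asks of the increments: they eventually decrease and fall below any bound, so
    that they stay at most 1 after multiplication by t, and n d(n) tends to infinity, so that the
    bound 4 / (t d(N)) is o(N). *)
Definition slow (R : realType) (d : nat -> R) :=
  [/\ \forall n \near \oo, 0 < d n /\ d n.+1 <= d n,
      forall e : R, 0 < e -> \forall n \near \oo, d n <= e
    & forall K : R, \forall n \near \oo, K <= n%:R * d n].

(* As phi is arbitrary, this bounds the sums of exp (i t x n). *)
Definition weyl (R : realType) (x : nat -> R) :=
  forall c T e : R, 0 < c -> 0 < e -> \forall N \near \oo,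
    forall t phi : R, c <= t <= T ->
      `|\sum_(n < N) cos (t * x n + phi)| <= e * N%:R.

Lemma norm_sum_cos (R : realType) (N : nat) (f : nat -> R) :
  `|\sum_(n < N) cos (f n)| <= N%:R.
Proof.
apply: (le_trans (ler_norm_sum _ _ _)).
by apply: (le_trans (ler_sum _ (fun i _ => cos_max _))); rewrite sumr_const card_ord.
Qed.

Lemma weyl_slow (R : realType) (x : nat -> R) : slow (fdiff x) -> weyl x.
Proof.
case=> [[n0 _ dec]] small big c T e c0 e0.
(* Keeps the phase increments t (x (n+1) - x n) at most 1 for all t <= T. *)
pose e1 := (`|T| + 1)^-1.
have T0 : 0 < `|T| + 1 by rewrite ltr_wpDl.
have [n1 _ sm] : \forall n \near \oo, fdiff x n <= e1 by apply: small; rewrite invr_gt0.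
(* Makes the Kusmin-Landau bound 4 / (t d) at most (e / 2) N for all t >= c. *)
have [n2 _ bg] := big (8 / (c * e)).
pose m := maxn n0 (maxn n1 n2).
near=> N => t phi /andP[ct tT].
have mN : (m < N)%N by near: N; exact: nbhs_infty_gt.
have [M NE] : exists M, N = (m + M.+1)%N by exists (N - m.+1)%N; lia.
have mMN : (m + M <= N)%N by rewrite NE addnS.
have N0 : (0 < N)%N := leq_ltn_trans (leq0n m) mN.
have m0 n : (n0 <= m + n)%N by apply: leq_trans (leq_addr _ _); exact: leq_maxl.
have m1 n : (n1 <= m + n)%N.
  by apply: leq_trans (leq_addr _ _); rewrite !leq_max leqnn orbT.
have m2 n : (n2 <= m + n)%N.
  by apply: leq_trans (leq_addr _ _); rewrite !leq_max leqnn !orbT.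
have Nbig : 2 * (m%:R + 1) / e <= N%:R by near: N; exact: nbhs_infty_ger.
have -> : \sum_(n < N) cos (t * x n + phi) = \sum_(n < m) cos (t * x n + phi) +
    \sum_(n < M.+1) cos (t * x (m + n)%N + phi) by rewrite NE big_split_ord.
have h1 := norm_sum_cos m (fun n => t * x n + phi).
pose y n := t * x (m + n)%N + phi.
have yd n : y n.+1 - y n = t * fdiff x (m + n)%N by rewrite /y /fdiff addnS; ring.
have t0 : 0 < t by apply: lt_le_trans ct.
have := @kusmin_landau R y M; rewrite yd.
have dpos n : 0 < fdiff x (m + n)%N by have [] := dec _ (m0 n).
move=> H; have {}H : `|\sum_(n < M.+1) cos (y n)| <= 4 / (t * fdiff x (m + M)%N) + 1.
  apply: H => n nM; rewrite !yd.
    rewrite mulr_gt0//=.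
    have : fdiff x (m + n)%N <= e1 by apply: sm => /=.
    rewrite /e1 => h; apply: (@le_trans _ _ (t * (`|T| + 1)^-1)); first by rewrite ler_pM2l.
    rewrite ler_pdivrMr// mul1r (le_trans tT)// (le_trans (ler_norm _))//; lra.
  by rewrite ler_pM2l// addnS; have [] := dec _ (m0 n).
have h2 : 4 / (t * fdiff x (m + M)%N) <= e / 2 * N%:R.
  have := bg _ (m2 M).
  have := dpos M.
  set d := fdiff x _ => d0 hd.
  rewrite ler_pdivrMr ?mulr_gt0//.
  have : 8 / (c * e) <= N%:R * d.
    by apply: (le_trans hd); rewrite ler_pM2r// ler_nat.
  rewrite ler_pdivrMr ?mulr_gt0// => hd2.
  have : c * (e * N%:R * d) <= t * (e * N%:R * d).
    by rewrite ler_pM2r// !mulr_gt0// ltr0n.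
  lra.
move: Nbig; rewrite ler_pdivrMr// => Nbig.
apply: (le_trans (ler_normD _ _)).
rewrite /y in H *. lra.
Unshelve. all: by end_near.
Qed.

Lemma near_addn (P : nat -> Prop) (h : nat) :
  (\forall n \near \oo, P n) -> \forall n \near \oo, P (n + h)%N.
Proof. by move=> [n0 _ H]; exists n0 => // n /= nn; apply: H => /=; lia. Qed.

Lemma slowD (R : realType) (d d' : nat -> R) :
  slow d -> slow d' -> slow (fun n => d n + d' n).
Proof.
move=> [d1 d2 d3] [e1 e2 e3]; split.
- by near=> n; have [|? ?] := near d1 n => //; have [|? ?] := near e1 n => //; split; lra.
- move=> e e0; near=> n; rewrite (splitr e) lerD//; near: n; [apply: d2|apply: e2]; lra.
- move=> K; near=> n; rewrite mulrDr (splitr K) lerD//; near: n; [exact: d3|exact: e3].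
Unshelve. all: by end_near.
Qed.

Lemma slow_shift (R : realType) (d : nat -> R) h : slow d -> slow (fun n => d (n + h)%N).
Proof.
move=> [d1 d2 d3]; split.
- exact: near_addn d1.
- by move=> e e0; exact: (near_addn _ (d2 e e0)).
- move=> K; near=> n.
  have dn : 0 < d (n + h)%N /\ d (n + h).+1 <= d (n + h)%N.
    by near: n; exact: near_addn d1.
  have K' : `|2 * K| <= (n + h)%:R * d (n + h)%N by near: n; exact: (near_addn h (d3 `|2 * K|)).
  have nh : (h <= n)%N by near: n; exact: nbhs_infty_ge.
  have : (n + h)%:R * d (n + h)%N <= 2 * n%:R * d (n + h)%N.
    by rewrite ler_pM2r ?dn.1// -natrM ler_nat; lia.
  move: (le_trans (ler_norm _) K'); lra.
Unshelve. all: by end_near.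
Qed.

Lemma iter_fdiffD (V : zmodType) k (x y : nat -> V) n :
  iter k (@fdiff V) (fun n => x n + y n) n = iter k (@fdiff V) x n + iter k (@fdiff V) y n.
Proof. by elim: k n => //= k IH n; rewrite /fdiff !IH opprD addrACA. Qed.

Lemma iter_fdiff_shift (V : zmodType) k (x : nat -> V) h n :
  iter k (@fdiff V) (fun n => x (n + h)%N) n = iter k (@fdiff V) x (n + h)%N.
Proof. by elim: k n => //= k IH n; rewrite /fdiff !IH addSn. Qed.

(** The difference with gap h+1 is a sum of h+1 shifts of the difference with gap 1, and [slow] is
    stable under shifts and sums. *)
Lemma slow_diff (R : realType) k (x : nat -> R) h :
  slow (iter k.+1 (@fdiff R) x) ->
  slow (iter k (@fdiff R) (fun n => x (n + h.+1)%N - x n)).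
Proof.
move=> sx; elim: h => [|h IH].
  suff -> : (fun n => x (n + 1)%N - x n) = fdiff x by rewrite -iterSr.
  by apply/funext => n; rewrite /fdiff addn1.
have -> : (fun n => x (n + h.+2)%N - x n) =
    (fun n => fdiff x (n + h.+1)%N + (x (n + h.+1)%N - x n)).
  by apply/funext => n; rewrite /fdiff addrA subrK addnS.
have -> : iter k (@fdiff R) (fun n => fdiff x (n + h.+1)%N + (x (n + h.+1)%N - x n)) =
    (fun n => iter k (@fdiff R) (fdiff x) (n + h.+1)%N +
      iter k (@fdiff R) (fun n => x (n + h.+1)%N - x n) n).
  by apply/funext => n; rewrite iter_fdiffD iter_fdiff_shift.
by apply: slowD IH; apply: slow_shift; rewrite -iterSr.
Qed.

Lemma sum_shift_le (R : realType) (f : nat -> R) (C : R) (N h : nat) :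
  (forall n, `|f n| <= C) ->
  `|\sum_(n < N) f (n + h)%N - \sum_(n < N) f n| <= 2 * h%:R * C.
Proof.
move=> fC; elim: h => [|h IH].
  by under eq_bigr do rewrite addn0; rewrite subrr normr0 mulr0 mul0r.
have := sum_succ (fun n => f (n + h)%N) N; rewrite add0n => e.
have -> : \sum_(n < N) f (n + h.+1)%N = \sum_(n < N) f (n.+1 + h)%N.
  by apply: eq_bigr => i _; rewrite addnS.
have := fC h; have := fC (N + h)%N.
move: IH; rewrite !ler_norml -natr1; lra.
Qed.

Lemma sum_shift (R : realType) (f : nat -> R) (N h : nat) :
  (forall n, `|f n| <= 1) ->
  `|\sum_(n < N) f (n + h)%N - \sum_(n < N) f n| <= 2 * h%:R.
Proof. by move=> /(sum_shift_le N h); rewrite mulr1. Qed.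

(** Cauchy-Schwarz against the constant 1, as nonnegativity of the variance about the mean [m]. *)
Lemma sqr_sum_le (R : realFieldType) (N : nat) (a : 'I_N -> R) :
  (\sum_i a i) ^+ 2 <= N%:R * \sum_i a i ^+ 2.
Proof.
case: N a => [|N] a; first by rewrite !big_ord0 expr0n mul0r.
set S := \sum_i a i; set Q := \sum_i _.
pose m := S / N.+1%:R.
have : 0 <= \sum_i (a i - m) ^+ 2 by apply: sumr_ge0 => i _; exact: sqr_ge0.
have -> : \sum_i (a i - m) ^+ 2 = Q - 2 * m * S + N.+1%:R * m ^+ 2.
  have -> : \sum_i (a i - m) ^+ 2 =
      \sum_i (a i ^+ 2 + (- (2 * m)) * a i + m ^+ 2).
    by apply: eq_bigr => i _; ring.
  rewrite !big_split/= -mulr_sumr sumr_const card_ord mulNr.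
  by rewrite -[_ *+ N.+1]mulr_natl.
have N0 : 0 < N.+1%:R :> R by rewrite ltr0n.
have -> : Q - 2 * m * S + N.+1%:R * m ^+ 2 = Q - S ^+ 2 / N.+1%:R.
  by rewrite /m; field; rewrite gt_eqF.
by rewrite subr_ge0 ler_pdivrMr// mulrC.
Qed.

(** The real form of |sum w e^(iz)|^2; it takes the place of complex exponentials throughout. *)
Lemma sqr_sum_cos_sin (R : realType) (I : finType) (w z : I -> R) :
  (\sum_i w i * cos (z i)) ^+ 2 + (\sum_i w i * sin (z i)) ^+ 2 =
  \sum_i \sum_j w i * w j * cos (z i - z j).
Proof.
rewrite !expr2 !big_distrlr/= -big_split/=; apply: eq_bigr => i _.
rewrite -big_split/=; apply: eq_bigr => j _; rewrite cosB; ring.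
Qed.

(** The sum is averaged over H shifts, Cauchy-Schwarz is applied over n, and the square is expanded.
    The diagonal gives H N; a pair (h, k) gives a differenced sum with gap |h - k|, up to an error 2
    H for moving its starting point. *)
Lemma van_der_corput (R : realType) (y : nat -> R) (N H : nat) (e : R) :
  (forall d, (d < H)%N ->
    `|\sum_(n < N) cos (y (n + d.+1)%N - y n)| <= e * N%:R) ->
  (H%:R * \sum_(n < N) cos (y n)) ^+ 2 <=
  8 * H%:R ^+ 4 +
  2 * N%:R * (H%:R * N%:R + H%:R ^+ 2 * (e * N%:R + 2 * H%:R)).
Proof.
move=> small.
have e0 : (0 < H)%N -> 0 <= e * N%:R by move=> /small; exact: le_trans.
set A := \sum_(n < N) cos (y n).
pose A' := \sum_(n < N) \sum_(h < H) cos (y (n + h)%N).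
have AA' : `|H%:R * A - A'| <= 2 * H%:R ^+ 2.
  rewrite /A' exchange_big/= -normrN opprB.
  have -> : \sum_(h < H) \sum_(n < N) cos (y (n + h)%N) - H%:R * A =
     \sum_(h < H) (\sum_(n < N) cos (y (n + h)%N) - A).
    by rewrite sumrB sumr_const card_ord mulr_natl.
  apply: (le_trans (ler_norm_sum _ _ _)).
  have -> : 2 * H%:R ^+ 2 = \sum_(h < H) (2 * H%:R : R).
    by rewrite sumr_const card_ord -mulr_natl; ring.
  apply: ler_sum => h _.
  apply: (le_trans (sum_shift _ _ (fun n => cos_max (y n)))).
  by rewrite ler_pM2l// ler_nat ltnW.
have pair (h k : nat) : (k < h < H)%N ->
    `|\sum_(n < N) cos (y (n + h)%N - y (n + k)%N)| <= e * N%:R + 2 * H%:R.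
  move=> /andP[kh hH].
  have := @sum_shift R (fun n => cos (y (n + (h - k.+1).+1)%N - y n)) N k
    (fun n => cos_max _).
  have -> : \sum_(n < N) cos (y (n + k + (h - k.+1).+1)%N - y (n + k)%N) =
      \sum_(n < N) cos (y (n + h)%N - y (n + k)%N).
    by apply: eq_bigr => n _; congr (cos (y _ - _)); lia.
  have kH : k%:R <= H%:R :> R by rewrite ler_nat; lia.
  have := small (h - k.+1)%N ltac:(lia).
  rewrite !ler_norml; lra.
have A'le : A' ^+ 2 <= N%:R * (H%:R * N%:R + H%:R ^+ 2 * (e * N%:R + 2 * H%:R)).
  apply: (le_trans (sqr_sum_le _)); rewrite ler_wpM2l//.
  apply: (@le_trans _ _ (\sum_(n < N) \sum_(h < H) \sum_(k < H)
      cos (y (n + h)%N - y (n + k)%N))).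
    apply: ler_sum => n _.
    have := @sqr_sum_cos_sin R 'I_H (fun=> 1) (fun h => y (n + h)%N).
    under eq_bigr do rewrite mul1r.
    under [in X in _ + X = _]eq_bigr do rewrite mul1r.
    under [in X in _ = X]eq_bigr do under eq_bigr do rewrite !mul1r.
    by move=> <-; rewrite lerDl sqr_ge0.
  rewrite exchange_big/=; under eq_bigr do rewrite exchange_big/=.
  apply: (@le_trans _ _ (\sum_(h < H) (N%:R + \sum_(k < H) (e * N%:R + 2 * H%:R)))).
    apply: ler_sum => h _; rewrite (bigD1 h)//=; apply: lerD.
      apply: le_trans (ler_norm _) _.
      exact: (norm_sum_cos _ (fun n => y (n + h)%N - y (n + h)%N)).
    rewrite [leRHS](bigD1 h)//= -[leLHS]add0r lerD//.
      apply: addr_ge0; last exact: mulr_ge0.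
      by apply: e0; apply: leq_ltn_trans (ltn_ord h).
    apply: ler_sum => k kh; apply: le_trans (ler_norm _) _.
    have [hk|hk|/val_inj hk] := ltngtP h k; last by rewrite hk eqxx in kh.
      under eq_bigr do rewrite -cosN opprB.
      by apply: pair; rewrite hk/=.
    by apply: pair; rewrite hk/=.
  rewrite !sumr_const !card_ord -!(mulr_natl (_ + _)).
  by rewrite mulrDr mulrA expr2.
have sq : (H%:R * A - A') ^+ 2 <= 4 * H%:R ^+ 4.
  rewrite -(real_normK (num_real _)).
  have -> : 4 * H%:R ^+ 4 = (2 * H%:R ^+ 2) ^+ 2 :> R by ring.
  by rewrite lerXn2r// nnegrE mulr_ge0// exprn_ge0.
have : (H%:R * A) ^+ 2 <= 2 * (H%:R * A - A') ^+ 2 + 2 * A' ^+ 2.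
  rewrite -subr_ge0.
  have -> : 2 * (H%:R * A - A') ^+ 2 + 2 * A' ^+ 2 - (H%:R * A) ^+ 2 =
    (H%:R * A - 2 * A') ^+ 2 by ring.
  exact: sqr_ge0.
lra.
Qed.

Lemma weyl_diff (R : realType) (x : nat -> R) :
  (forall h, weyl (fun n => x (n + h.+1)%N - x n)) -> weyl x.
Proof.
move=> wx c T e c0 e0.
have e20 : 0 < e ^+ 2 / 8 by rewrite divr_gt0// exprn_gt0.
(* The van der Corput bound has four terms, each to be at most a quarter of (H e N)^2. [H] is chosen
   for the diagonal term, e^2 / 8 for the differenced sums, and N, large against H^2 / e^2, for the
   two shift errors. *)
have [H0 _ /(_ H0 (leqnn _)) /= HH0] := nbhs_infty_ger (8 / e ^+ 2).
pose H := H0.+1.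
have HH : 8 <= e ^+ 2 * H%:R.
  rewrite mulrC -ler_pdivrMr ?exprn_gt0// (le_trans HH0)// ler_nat; exact: leqnSn.
near=> N => t phi ctT.
have small d : (d < H)%N ->
    `|\sum_(n < N) cos ((t * x (n + d.+1)%N + phi) - (t * x n + phi))| <=
    e ^+ 2 / 8 * N%:R.
  move=> dH.
  suff : forall d : 'I_H, forall t phi, c <= t <= T ->
      `|\sum_(n < N) cos (t * (x (n + d.+1)%N - x n) + phi)| <= e ^+ 2 / 8 * N%:R.
    move=> /(_ (Ordinal dH) t 0 ctT)/=.
    under eq_bigr do rewrite addr0.
    rewrite (_ : \sum_(n < N) _ =
        \sum_(n < N) cos ((t * x (n + d.+1)%N + phi) - (t * x n + phi)))//.
    by apply: eq_bigr => n _; congr cos; ring.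
  near: N; apply: filter_forall => {}d; exact: wx.
have Nbig : 32 * H%:R ^+ 2 / e ^+ 2 <= N%:R by near: N; exact: nbhs_infty_ger.
have N1 : 1 <= N%:R :> R by near: N; exact: nbhs_infty_ger.
have := @van_der_corput R (fun n => t * x n + phi) N H _ small.
rewrite ler_pdivrMr ?exprn_gt0// in Nbig.
set A := \sum_(n < N) _ => hA.
have H1 : 1 <= H%:R :> R by rewrite ler1n.
clear small.
move: HH hA Nbig H1; set h := H%:R; set M := N%:R in N1 * => HH hA Nbig H1.
have M0 : 0 <= e * M by apply: mulr_ge0; lra.
rewrite -(ger0_norm M0) -ler_sqr ?nnegrE//.
rewrite (real_normK (num_real A)) (real_normK (num_real (e * M))).
have h20 : 0 < h ^+ 2 by rewrite exprn_gt0//; lra.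
rewrite -(ler_pM2l h20) -exprMn; apply: le_trans hA _.
have a1 : 8 * h ^+ 4 <= h ^+ 2 * (e * M) ^+ 2 / 4.
  have -> : 8 * h ^+ 4 = h ^+ 2 * (8 * h ^+ 2) by ring.
  rewrite -mulrA ler_pM2l//.
  have : M * e ^+ 2 <= M * (M * e ^+ 2).
    by rewrite ler_peMl// mulr_ge0 ?sqr_ge0//; lra.
  rewrite exprMn; lra.
have a2 : 2 * M * (h * M) <= h ^+ 2 * (e * M) ^+ 2 / 4.
  have : 8 * (h * M ^+ 2) <= (e ^+ 2 * h) * (h * M ^+ 2).
    by rewrite ler_wpM2r// mulr_ge0 ?sqr_ge0//; lra.
  rewrite !expr2; lra.
have a3 : 2 * M * (h ^+ 2 * (2 * h)) <= h ^+ 2 * (e * M) ^+ 2 / 4.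
  have -> : 2 * M * (h ^+ 2 * (2 * h)) = h ^+ 2 * (M * (4 * h)) by ring.
  have -> : h ^+ 2 * (e * M) ^+ 2 / 4 = h ^+ 2 * (M * (M * e ^+ 2 / 4)) by ring.
  rewrite ler_pM2l// ler_wpM2l//.
  have : h <= h ^+ 2 by rewrite expr2 ler_peMr//; lra.
  lra.
have a4 : 2 * M * (h ^+ 2 * (e ^+ 2 / 8 * M)) = h ^+ 2 * (e * M) ^+ 2 / 4 by field.
lra.
Unshelve. all: by end_near.
Qed.

Lemma weyl_iter_slow (R : realType) k (x : nat -> R) :
  slow (iter k.+1 (@fdiff R) x) -> weyl x.
Proof.
elim: k x => [|k IH] x sx; first exact: weyl_slow.
by apply: weyl_diff => h; apply: IH; exact: slow_diff.
Qed.

(** * Finite differences of powers *)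

Definition rdiff (R : realType) (f : R -> R) (x : R) : R := f (x + 1) - f x.

Lemma is_derive_iter_rdiff_powR (R : realType) k (b x : R) : 0 < x ->
  is_derive x 1 (iter k (@rdiff R) ((@powR R)^~ b))
    (b * iter k (@rdiff R) ((@powR R)^~ (b - 1)) x).
Proof.
elim: k b x => [|k IH] b x x0 /=; first exact: is_derive1_powR.
rewrite /rdiff mulrBr; apply: is_deriveB; last exact: IH.
have h : is_derive x 1 (+%R^~ (1 : R)) 1.
  rewrite -[X in is_derive _ _ _ X]addr0; exact: is_deriveD.
have x1 : 0 < x + 1 by rewrite addr_gt0.
have := @is_derive1_comp R (iter k (@rdiff R) ((@powR R)^~ b)) (+%R^~ (1 : R)) x _ _ (IH b _ x1) h.
by rewrite mulr1.
Qed.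

(** Differences commute with the derivative, so each use of the mean value theorem trades one
    difference for a factor of the k-th derivative of the power. *)
Lemma iter_rdiff_powR (R : realType) k (b x : R) : 0 < x ->
  exists2 xi : R, x <= xi <= x + k%:R &
    iter k (@rdiff R) ((@powR R)^~ b) x =
    \prod_(i < k) (b - i%:R) * xi `^ (b - k%:R).
Proof.
elim: k b x => [|k IH] b x x0 /=.
  by exists x; rewrite ?addr0 ?lexx// big_ord0 mul1r subr0.
have [|||xi1] := @MVT_segment R (iter k (@rdiff R) ((@powR R)^~ b))
   (fun x => b * iter k (@rdiff R) ((@powR R)^~ (b - 1)) x) x (x + 1).
- by rewrite lerDl.
- move=> y; rewrite in_itv/= => /andP[xy _].
  by apply: is_derive_iter_rdiff_powR; exact: lt_trans xy.
- apply: derivable_within_continuous => y; rewrite in_itv/= => /andP[xy _].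
  by have [] := is_derive_iter_rdiff_powR k b (lt_le_trans x0 xy).
rewrite in_itv/= => /andP[h1 h2]; rewrite addrAC subrr add0r mulr1 => e1.
have [xi /andP[h3 h4] e2] := IH (b - 1) xi1 (lt_le_trans x0 h1).
exists xi; first by rewrite (le_trans h1 h3)/= -natr1; lra.
rewrite [LHS]e1 e2 big_ord_recl/= subr0 -mulrA; congr (_ * (_ * _)).
  by apply: eq_bigr => i _; rewrite /bump/= add1n -natr1; ring.
by congr (_ `^ _); rewrite -natr1; ring.
Qed.

Lemma iter_fdiff_rdiff (R : realType) k (f : R -> R) (n : nat) :
  iter k (@fdiff R) (fun n => f n.+1%:R) n = iter k (@rdiff R) f n.+1%:R.
Proof.
by elim: k n => //= k IH n; rewrite /fdiff !IH /rdiff natr1.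
Qed.

Lemma near_powR_ge (R : realType) (g K : R) : 0 < g ->
  \forall n \near \oo, K <= n%:R `^ g.
Proof.
move=> g0; near=> n.
have h : `|K| `^ g^-1 <= n%:R by near: n; exact: nbhs_infty_ger.
have := @ge0_ler_powR R g (ltW g0) (`|K| `^ g^-1) n%:R.
rewrite !nnegrE powR_ge0 ler0n => /(_ isT isT h).
rewrite -powRrM mulVf ?gt_eqF// powRr1//.
exact: le_trans (ler_norm _).
Unshelve. all: by end_near.
Qed.

(** With k < a < k+1 the difference of order k+1 is P / xi^g, where P > 0, 0 < g < 1 and xi lies
    between n+1 and n+k+2: it tends to 0, but more slowly than 1/n. It decreases because one further
    difference brings in the negative factor a - (k+1). *)
Lemma slow_powR (R : realType) (a : R) (k : nat) : k%:R < a < k.+1%:R ->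
  slow (iter k.+1 (@fdiff R) (fun n => n.+1%:R `^ a)).
Proof.
move=> /andP[ka ak].
pose P : R := \prod_(i < k.+1) (a - i%:R).
have P0 : 0 < P.
  apply: prodr_gt0 => -[i /= ik] _; rewrite subr_gt0 (le_lt_trans _ ka)//.
  by rewrite ler_nat -ltnS.
pose g := k.+1%:R - a.
have g0 : 0 < g by rewrite subr_gt0.
have g1 : g < 1 by rewrite /g -natr1; lra.
have dE n : exists2 xi : R, n.+1%:R <= xi <= n.+1%:R + k.+1%:R &
    iter k.+1 (@fdiff R) (fun n => n.+1%:R `^ a) n = P / xi `^ g.
  have [xi hxi e] := @iter_rdiff_powR R k.+1 a n.+1%:R ltac:(by rewrite ltr0n).
  exists xi => //; rewrite (iter_fdiff_rdiff _ ((@powR R)^~ a)) e.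
  by rewrite -powRN /g opprB.
have pos n : 0 < iter k.+1 (@fdiff R) (fun n => n.+1%:R `^ a) n.
  have [xi /andP[h _] ->] := dE n.
  by rewrite divr_gt0// powR_gt0// (lt_le_trans _ h)// ltr0n.
split.
- apply: nearW => n; split; first exact: pos.
  rewrite -subr_le0 -[X in X <= 0]/(iter k.+2 (@fdiff R) (fun n => n.+1%:R `^ a) n).
  have [xi /andP[h _]] := @iter_rdiff_powR R k.+2 a n.+1%:R ltac:(by rewrite ltr0n).
  rewrite (iter_fdiff_rdiff _ ((@powR R)^~ a)) => ->.
  rewrite mulr_le0_ge0 ?powR_ge0// big_ord_recr/= pmulr_rle0// subr_le0 ltW//.
- move=> e e0; near=> n.
  have [xi /andP[h _] ->] := dE n.
  have xi0 : 0 < xi by rewrite (lt_le_trans _ h)// ltr0n.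
  rewrite ler_pdivrMr ?powR_gt0// mulrC -ler_pdivrMr//.
  apply: (@le_trans _ _ (n%:R `^ g)); first by near: n; exact: near_powR_ge.
  by rewrite ge0_ler_powR ?nnegrE ?(ltW g0) ?(ltW xi0)// (le_trans _ h)// ler_nat.
- move=> K.
  have g1' : 0 < 1 - g by rewrite subr_gt0.
  have nearg := near_powR_ge (`|K| * 2 / P) g1'.
  near=> n.
  have [xi /andP[h1 h2] ->] := dE n.
  have nk : (k.+2 <= n)%N by near: n; exact: nbhs_infty_ge.
  have n0 : 0 < n%:R :> R by rewrite ltr0n; apply: leq_trans nk.
  have xi0 : 0 < xi by rewrite (lt_le_trans _ h1)// ltr0n.
  have xin : xi <= 2 * n%:R.
    by apply: (le_trans h2); rewrite -natrD -natrM ler_nat; clear -nk; lia.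
  rewrite mulrA ler_pdivlMr ?powR_gt0//.
  have big : `|K| * 2 / P <= n%:R `^ (1 - g).
    by near: n.
  have nE : n%:R = n%:R `^ (1 - g) * n%:R `^ g :> R.
    rewrite -powRD ?subrK ?powRr1 ?ler0n//.
    by apply/implyP => _; rewrite gt_eqF.
  apply: (@le_trans _ _ (`|K| * (2 * n%:R `^ g))).
    apply: (@le_trans _ _ (`|K| * xi `^ g)).
      by rewrite ler_wpM2r ?powR_ge0// ler_norm.
    rewrite ler_wpM2l//.
    apply: (@le_trans _ _ ((2 * n%:R) `^ g)).
      by rewrite ge0_ler_powR ?nnegrE ?mulr_ge0 ?(ltW g0) ?(ltW xi0).
    rewrite powRM// ler_wpM2r ?powR_ge0//.
    rewrite -[leRHS]powRr1// ler_powR ?ler1n// ltW//.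
  rewrite [X in _ <= X * _]nE mulrA [leRHS]mulrAC ler_wpM2r ?powR_ge0//.
  by rewrite -ler_pdivrMr.
Unshelve. all: by end_near.
Qed.

Lemma weyl_powR (R : realType) (a : R) : 0 < a -> a \isn't a Num.int ->
  weyl (fun n : nat => n.+1%:R `^ a).
Proof.
move=> a0 aZ; apply: (@weyl_iter_slow _ (Num.truncn a)); apply: slow_powR.
have /andP[h1 h2] := truncn_itv (ltW a0); rewrite h2 andbT lt_neqAle h1 andbT.
by apply: contra aZ => /eqP <-; rewrite intr_nat.
Qed.

(** * Integer parts *)

Lemma sum_cos_arith (R : realType) (K : nat) (phi u : R) :
  2 * sin (u / 2) * \sum_(j < K) cos (phi + j%:R * u) =
  sin (phi + K%:R * u - u / 2) - sin (phi - u / 2).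
Proof.
elim: K => [|K IH]; first by rewrite big_ord0 mul0r addr0 subrr mulr0.
rewrite big_ord_recr/= mulrDr IH -[K.+1%:R]natr1.
have -> : phi + (K%:R + 1) * u - u / 2 = (phi + K%:R * u) + u / 2 by lra.
by move: (phi + K%:R * u) => z; rewrite (sinB z) (sinD z); ring.
Qed.

Lemma cosD2npi (R : realType) (x : R) (k : int) : cos (x + 2 * pi * k%:~R) = cos x.
Proof.
have nat_case (n : nat) (y : R) : cos (y + 2 * pi * n%:R) = cos y.
  elim: n y => [|n IH] y; first by rewrite mulr0 addr0.
  have -> : y + 2 * pi * n.+1%:R = (y + 2 * pi * n%:R) + pi *+ 2.
    by rewrite -[n.+1%:R]natr1 -mulr_natl; ring.
  by rewrite cosD cos2pi sin2pi mulr1 mulr0 subr0 IH.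
case: k => n; first exact: nat_case.
by rewrite NegzE -(nat_case n.+1) mulrNz; congr cos; rewrite mulrN subrK.
Qed.

Lemma sum_cos_root_unity (R : realType) (K m : nat) (phi : R) : (0 < m < K)%N ->
  \sum_(j < K) cos (phi + j%:R * (2 * pi * m%:R / K%:R)) = 0.
Proof.
move=> /andP[m0 mK]; have := sum_cos_arith K phi (2 * pi * m%:R / K%:R).
set S := \sum_(j < K) _; set u := 2 * pi * m%:R / K%:R.
have K0 : 0 < K%:R :> R by rewrite ltr0n (leq_trans _ mK).
have su : 0 < sin (u / 2).
  have -> : u / 2 = pi * (m%:R / K%:R) by rewrite /u; field; rewrite gt_eqF.
  apply: sin_gt0_pi; rewrite mulr_gt0 ?pi_gt0 ?divr_gt0 ?(ltr0n R m)//=.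
  by rewrite gtr_pMr ?pi_gt0// ltr_pdivrMr// mul1r ltr_nat.
have -> : phi + K%:R * u - u / 2 = (phi - u / 2 - pi / 2) + 2 * pi * m%:~R + pi / 2.
  by rewrite /u pmulrn; field; rewrite gt_eqF.
rewrite sinDpihalf cosD2npi cosBpihalf subrr => /eqP.
by rewrite mulf_eq0 mulf_eq0 (gt_eqF su) pnatr_eq0/= => /eqP.
Qed.

Definition fejer (R : realType) (K : nat) (u : R) : R :=
  K%:R^-1 * \sum_(k < K) \sum_(l < K) cos ((k%:R - l%:R) * u).

Lemma fejer_sqr (R : realType) (K : nat) (u : R) :
  fejer K u = K%:R^-1 *
    ((\sum_(k < K) cos (k%:R * u)) ^+ 2 + (\sum_(k < K) sin (k%:R * u)) ^+ 2).
Proof.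
have := @sqr_sum_cos_sin R 'I_K (fun=> 1) (fun k => k%:R * u).
under eq_bigr do rewrite mul1r.
under [in X in _ + X = _]eq_bigr do rewrite mul1r.
move=> ->; congr (_ * _); apply: eq_bigr => k _; apply: eq_bigr => l _.
by rewrite !mul1r mulrBl.
Qed.

Lemma fejer_ge0 (R : realType) (K : nat) (u : R) : 0 <= fejer K u.
Proof. by rewrite fejer_sqr mulr_ge0 ?invr_ge0// addr_ge0// sqr_ge0. Qed.

(** From the closed form sin^2 (K u / 2) / (K sin^2 (u / 2)) of the kernel, kept free of a division
    by the sine. *)
Lemma fejer_sin (R : realType) (K : nat) (u : R) :
  fejer K u * sin (u / 2) ^+ 2 <= K%:R^-1.
Proof.
rewrite fejer_sqr -mulrA ler_piMr ?invr_ge0//.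
have hc := sum_cos_arith K 0 u; have hs := sum_cos_arith K (- (pi / 2)) u.
have -> : \sum_(k < K) sin (k%:R * u) = \sum_(k < K) cos (- (pi / 2) + k%:R * u).
  by apply: eq_bigr => k _; rewrite addrC cosBpihalf.
have -> : \sum_(k < K) cos (k%:R * u) = \sum_(k < K) cos (0 + k%:R * u).
  by apply: eq_bigr => k _; rewrite add0r.
move: hc hs; set C := \sum_(k < K) _; set S := \sum_(k < K) _.
have -> : - (pi / 2) + K%:R * u - u / 2 = (K%:R * u - u / 2) - pi / 2 by lra.
have -> : - (pi / 2) - u / 2 = (- (u / 2)) - pi / 2 by lra.
rewrite !sinBpihalf add0r sub0r sinN cosN !opprK => hc hs.
have := cos2Dsin2 (u / 2); have := cos2Dsin2 (K%:R * u - u / 2).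
have := cos_geN1 ((K%:R * u - u / 2) + u / 2); rewrite cosD.
move: (cos (u / 2)) (sin (u / 2)) (cos (_ - _)) (sin (_ - _)) hc hs.
move=> c s c' s' hc hs h1 h2 h3.
have : (2 * s * C) ^+ 2 + (2 * s * S) ^+ 2 = 2 + 2 * (s * s' - c * c').
  rewrite hc hs.
  transitivity ((c' ^+ 2 + s' ^+ 2) + (c ^+ 2 + s ^+ 2) + 2 * (s * s' - c * c')); first by ring.
  by rewrite h2 h3.
rewrite !exprMn => h4.
have : (C ^+ 2 + S ^+ 2) * s ^+ 2 = ((2 ^+ 2 * s ^+ 2) * C ^+ 2 + (2 ^+ 2 * s ^+ 2) * S ^+ 2) / 4.
  by field.
move=> ->; rewrite h4; lra.
Qed.

Lemma fejer_ge_half (R : realType) (K : nat) (u : R) :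
  `|u| <= K%:R^-1 -> K%:R / 2 <= fejer K u.
Proof.
case: K => [|K]; first by rewrite mul0r /fejer big_ord0 mulr0.
move=> uK; rewrite /fejer.
have K0 : 0 < K.+1%:R :> R by rewrite ltr0n.
rewrite [leRHS]mulrC ler_pdivlMr//.
have -> : K.+1%:R / 2 * K.+1%:R = \sum_(k < K.+1) \sum_(l < K.+1) (1 / 2 : R).
  by rewrite !sumr_const card_ord -[_ *+ K.+1]mulr_natl -[(1 / 2) *+ K.+1]mulr_natl; field.
apply: ler_sum => k _; apply: ler_sum => l _; apply: cos_ge_half.
rewrite normrM; have : `|u| * K.+1%:R <= 1 by rewrite -ler_pdivlMr// mul1r.
apply: le_trans; rewrite mulrC ler_wpM2l//.
rewrite ler_norml; have : k%:R <= K.+1%:R :> R by rewrite ler_nat ltnW.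
have : l%:R <= K.+1%:R :> R by rewrite ler_nat ltnW.
have := ler0n R k; have := ler0n R l; lra.
Qed.

(** Orthogonality of roots of unity: only the K diagonal terms survive the sum over the nodes. *)
Lemma fejer_average (R : realType) (K : nat) (u : R) : (0 < K)%N ->
  \sum_(j < K) fejer K (u - 2 * pi * (j%:R / K%:R)) = K%:R.
Proof.
move=> K0; rewrite -mulr_sumr exchange_big/=.
under eq_bigr do rewrite exchange_big/=.
have K0' : K%:R != 0 :> R by rewrite pnatr_eq0 -lt0n.
rewrite (_ : \sum_(k < K) _ = \sum_(k < K) K%:R).
  by rewrite sumr_const card_ord -[K%:R *+ K]mulr_natl mulKf.
apply: eq_bigr => k _; rewrite (bigD1 k)//= [X in _ + X]big1 ?addr0.
  under eq_bigr do rewrite subrr mul0r cos0.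
  by rewrite sumr_const card_ord.
move=> l lk; have [h|h|/val_inj h] := ltngtP k l; last by rewrite h eqxx in lk.
  have := @sum_cos_root_unity R K (l - k) ((k%:R - l%:R) * u).
  rewrite subn_gt0 h (leq_ltn_trans (leq_subr _ _) (ltn_ord l)) => /(_ isT) H.
  by rewrite -[RHS]H; apply: eq_bigr => j _; congr cos; rewrite natrB ?(ltnW h)//; field.
have := @sum_cos_root_unity R K (k - l) (- ((k%:R - l%:R) * u)).
rewrite subn_gt0 h (leq_ltn_trans (leq_subr _ _) (ltn_ord k)) => /(_ isT) H.
rewrite -[RHS]H; apply: eq_bigr => j _.
by rewrite -cosN; congr cos; rewrite natrB ?(ltnW h)//; field.
Qed.

Lemma fejer_cos (R : realType) (K : nat) (A u : R) :
  cos A * fejer K u =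
  K%:R^-1 * \sum_(k < K) \sum_(l < K) cos (A + (k%:R - l%:R) * u).
Proof.
have odd0 : \sum_(k < K) \sum_(l < K) sin ((k%:R - l%:R) * u) = 0.
  set S := (X in X = _).
  suff : S = - S by lra.
  rewrite {1}/S exchange_big/= -sumrN; apply: eq_bigr => k _.
  by rewrite -sumrN; apply: eq_bigr => l _; rewrite -sinN -mulNr opprB.
rewrite mulrCA; congr (_ * _).
transitivity (cos A * (\sum_(k < K) \sum_(l < K) cos ((k%:R - l%:R) * u)) -
    sin A * (\sum_(k < K) \sum_(l < K) sin ((k%:R - l%:R) * u))).
  by rewrite odd0 mulr0 subr0.
rewrite !mulr_sumr -sumrB.
apply: eq_bigr => k _; rewrite !mulr_sumr -sumrB.
by apply: eq_bigr => l _; rewrite cosD.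
Qed.

Lemma weyl_norm (R : realType) (x : nat -> R) (c T e : R) : weyl x -> 0 < c -> 0 < e ->
  \forall N \near \oo, forall t phi : R, c <= `|t| <= T ->
      `|\sum_(n < N) cos (t * x n + phi)| <= e * N%:R.
Proof.
move=> wx c0 e0; near=> N => t phi.
have H : forall t phi : R, c <= t <= T ->
      `|\sum_(n < N) cos (t * x n + phi)| <= e * N%:R.
  by near: N; exact: wx.
have [t0|t0] := leP 0 t; first by rewrite ger0_norm//; exact: H.
rewrite ltr0_norm//.
move=> /(H _ (- phi)).
by under eq_bigr do rewrite mulNr -opprD cosN.
Unshelve. all: by end_near.
Qed.

(** Controls how often [x n] is close to an integer, where [psi] approximates badly. The diagonal of
    the kernel gives 1 for each n, and the other frequencies are nonzero multiples of 2 pi. *)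
Lemma sum_fejer_le (R : realType) (x : nat -> R) (K N : nat) (e : R) : (0 < K)%N -> 0 <= e ->
  (forall t phi : R, 2 * pi <= `|t| <= 2 * pi * K%:R ->
    `|\sum_(n < N) cos (t * x n + phi)| <= e * N%:R) ->
  \sum_(n < N) fejer K (2 * pi * x n) <= (1 + e * K%:R) * N%:R.
Proof.
move=> K0 e0 H; rewrite -mulr_sumr exchange_big/=.
under eq_bigr do rewrite exchange_big/=.
have K0' : 0 < K%:R :> R by rewrite ltr0n.
rewrite mulrC ler_pdivrMr//.
apply: (@le_trans _ _ (\sum_(k < K) (N%:R + \sum_(l < K) e * N%:R))).
  apply: ler_sum => k _; rewrite (bigD1 k)//=; apply: lerD.
    by apply: le_trans (ler_norm _) (norm_sum_cos _ (fun n => (k%:R - k%:R) * (2 * pi * x n))).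
  rewrite [leRHS](bigD1 k)//= -[leLHS]add0r lerD ?mulr_ge0//.
  apply: ler_sum => l lk; apply: le_trans (ler_norm _) _.
  under eq_bigr do rewrite mulrA -[_ * _]addr0.
  have pi2 : 0 <= 2 * pi :> R by rewrite mulr_ge0 ?pi_ge0.
  apply: H; rewrite normrM (ger0_norm pi2) [ `|k%:R - l%:R| * _]mulrC.
  suff /andP[d1 d2] : 1 <= `|k%:R - l%:R : R| <= K%:R.
    by rewrite ler_peMr// ler_wpM2l.
  have kK : k%:R <= K%:R :> R by rewrite ler_nat ltnW.
  have lK : l%:R <= K%:R :> R by rewrite ler_nat ltnW.
  have := ler0n R k; have := ler0n R l.
  have [h|h|/val_inj h] := ltngtP k l; last by rewrite h eqxx in lk.
    have : k%:R + 1 <= l%:R :> R by rewrite natr1 ler_nat.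
    by move=> *; rewrite ler0_norm; lra.
  have : l%:R + 1 <= k%:R :> R by rewrite natr1 ler_nat.
  by move=> *; rewrite ger0_norm; lra.
rewrite !sumr_const !card_ord -[(_ + _) *+ K]mulr_natl -[(e * _) *+ K]mulr_natl; lra.
Qed.

(* Fejer interpolation, at the points j / K, of the function x |-> cos (theta
   [x] + phi), written so that the frequencies lie in theta + 2 pi Z. *)
Definition psi (R : realType) (theta phi : R) (K : nat) (x : R) : R :=
  K%:R^-1 * \sum_(j < K) cos (theta * (x - j%:R / K%:R) + phi) *
    fejer K (2 * pi * (x - j%:R / K%:R)).

(** The frequencies theta + 2 pi (k - l) stay away from 0: for k >= l they are at least theta >= c,
    and for k < l at most theta - 2 pi <= - pi <= - c. This is where theta <= pi matters. *)
Lemma sum_psi_le (R : realType) (x : nat -> R) (K N : nat) (c e theta phi : R) :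
  (0 < K)%N -> 0 <= e -> 0 <= c -> c <= theta <= pi ->
  (forall t phi : R, c <= `|t| <= 2 * pi * K%:R + pi ->
    `|\sum_(n < N) cos (t * x n + phi)| <= e * N%:R) ->
  `|\sum_(n < N) psi theta phi K (x n)| <= e * K%:R * N%:R.
Proof.
move=> K0 e0 c0 /andP[ct tpi] H.
have K0' : 0 < K%:R :> R by rewrite ltr0n.
have p0 := pi_gt0 R.
pose F (j k l : nat) (n : nat) := cos ((theta + 2 * pi * (k%:R - l%:R)) * x n +
    (phi - (theta + 2 * pi * (k%:R - l%:R)) * (j%:R / K%:R))).
have -> : \sum_(n < N) psi theta phi K (x n) = K%:R^-1 * (K%:R^-1 *
    \sum_(j < K) \sum_(k < K) \sum_(l < K) \sum_(n < N) F j k l n).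
  rewrite -mulr_sumr; congr (_ * _); rewrite exchange_big/= mulr_sumr.
  apply: eq_bigr => j _; under eq_bigr do rewrite fejer_cos.
  rewrite -mulr_sumr; congr (_ * _); rewrite exchange_big/=.
  apply: eq_bigr => k _; rewrite exchange_big/=; apply: eq_bigr => l _.
  by apply: eq_bigr => n _; rewrite /F; congr cos; ring.
rewrite !normrM ger0_norm ?invr_ge0// ![_^-1 * _]mulrC !ler_pdivrMr//.
have -> : e * K%:R * N%:R * K%:R * K%:R =
    \sum_(j < K) \sum_(k < K) \sum_(l < K) e * N%:R.
  by rewrite !sum_const_ord; ring.
apply: (le_trans (ler_norm_sum _ _ _)); apply: ler_sum => j _.
apply: (le_trans (ler_norm_sum _ _ _)); apply: ler_sum => k _.
apply: (le_trans (ler_norm_sum _ _ _)); apply: ler_sum => l _.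
apply: H.
have kK : k%:R <= K%:R :> R by rewrite ler_nat ltnW.
have lK : l%:R <= K%:R :> R by rewrite ler_nat ltnW.
have hk := ler0n R k; have hl := ler0n R l.
have [h|h] := ltnP k l.
  have d1 : k%:R - l%:R <= -1 :> R.
    have : k%:R + 1 <= l%:R :> R by rewrite natr1 ler_nat.
    lra.
  have h1 : 2 * pi * (k%:R - l%:R) <= 2 * pi * (-1) :> R.
    by rewrite ler_pM2l// mulr_gt0.
  have h2 : - (2 * pi * K%:R) <= 2 * pi * (k%:R - l%:R) :> R.
    by rewrite -mulrN ler_pM2l ?mulr_gt0//; lra.
  move: h1 h2; move: (2 * pi * (k%:R - l%:R)) (2 * pi * K%:R) => X Y h1 h2.
  by rewrite ler0_norm; lra.
have d1 : 0 <= k%:R - l%:R :> R by rewrite subr_ge0 ler_nat.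
have h1 : 0 <= 2 * pi * (k%:R - l%:R) :> R by rewrite !mulr_ge0// ltW.
have h2 : 2 * pi * (k%:R - l%:R) <= 2 * pi * K%:R :> R.
  by rewrite ler_pM2l ?mulr_gt0//; lra.
have [h3|h3] := leP 0 (theta + 2 * pi * (k%:R - l%:R)).
  by rewrite ger0_norm//; lra.
rewrite ltr0_norm//; lra.
Qed.

Lemma sin_le_mid (R : realType) (d w : R) : 0 <= d -> d <= w -> w <= pi - d ->
  sin d <= sin w.
Proof.
move=> d0 dw wpi; rewrite -subr_ge0.
have -> : sin w - sin d = 2 * cos ((w + d) / 2) * sin ((w - d) / 2).
  rewrite (_ : sin w = sin ((w + d) / 2 + (w - d) / 2)); last by congr sin; lra.
  rewrite (_ : sin d = sin ((w + d) / 2 - (w - d) / 2)); last by congr sin; lra.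
  by move: ((w + d) / 2) ((w - d) / 2) => p q; rewrite sinD sinB; ring.
rewrite mulr_ge0 ?mulr_ge0//.
  apply: cos_ge0_pihalf; lra.
by apply: sin_ge0_pi; lra.
Qed.

Lemma sqr_sin_ge (R : realType) (d w : R) : 0 <= d -> d <= `|w| -> `|w| <= pi - d ->
  sin d ^+ 2 <= sin w ^+ 2.
Proof.
move=> d0 dw wpi.
have -> : sin w ^+ 2 = sin `|w| ^+ 2.
  by have [w0|w0] := leP 0 w; [rewrite ger0_norm|rewrite ltr0_norm// sinN sqrrN].
have sd : 0 <= sin d by apply: sin_ge0_pi; lra.
have := sin_le_mid d0 dw wpi => h.
by rewrite ler_sqr// nnegrE// (le_trans sd).
Qed.

(** Put d = 1 / (2 K'). If x is within d / pi of an integer, the difference is at most 2 and the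
    last term is at least 2. Otherwise the nodes j / K within d / pi of the fractional part of x
    cost at most d, since the cosine is 1-Lipschitz and theta <= pi; at the other nodes the kernel
    is at most 1 / (K sin^2 d). *)
Lemma psi_floor (R : realType) (theta phi : R) (K K' : nat) (x : R) :
  (0 < K)%N -> (0 < K')%N -> 0 <= theta <= pi ->
  `|cos (theta * (Num.floor x)%:~R + phi) - psi theta phi K x| <=
  (2 * K'%:R)^-1 + 2 / (K%:R * sin ((2 * K'%:R)^-1) ^+ 2) +
  4 / K'%:R * fejer K' (2 * pi * x).
Proof.
move=> K0 K'0 /andP[t0 tpi].
have k0 : 0 < K%:R :> R by rewrite ltr0n.
have k'0 : 0 < K'%:R :> R by rewrite ltr0n.
have k'1 : 1 <= K'%:R :> R by rewrite ler1n.
set d := (2 * K'%:R)^-1; have dE : 2 * d * K'%:R = 1 by rewrite /d; field; rewrite gt_eqF.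
have d0 : 0 < d by rewrite invr_gt0 mulr_gt0.
have d12 : d <= 1 / 2 by rewrite /d invfM ler_pdivrMr//; lra.
have p2 := pi_ge2 R.
have s0 : 0 < sin d by apply: sin_gt0_pi; lra.
set m := Num.floor x; pose y := x - m%:~R.
have /andP[y0 y1] : 0 <= y < 1.
  by have := floor_itv x; rewrite intrD /y -/m; lra.
pose u (j : nat) := 2 * pi * (x - j%:R / K%:R).
have avg1 : K%:R^-1 * \sum_(j < K) fejer K (u j) = 1.
  have := fejer_average (2 * pi * x) K0.
  under eq_bigr do rewrite -mulrBr.
  by move=> ->; rewrite mulVf// gt_eqF.
have errE : cos (theta * m%:~R + phi) - psi theta phi K x =
    K%:R^-1 * \sum_(j < K) (cos (theta * m%:~R + phi) -
      cos (theta * (x - j%:R / K%:R) + phi)) * fejer K (u j).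
  transitivity (cos (theta * m%:~R + phi) * (K%:R^-1 * \sum_(j < K) fejer K (u j)) -
      psi theta phi K x); first by rewrite avg1 mulr1.
  rewrite mulrCA -mulrBr mulr_sumr -sumrB.
  by congr (_ * _); apply: eq_bigr => j _; rewrite mulrBl.
have bnd (b : 'I_K -> R) : (forall j : 'I_K, `|(cos (theta * m%:~R + phi) -
      cos (theta * (x - j%:R / K%:R) + phi)) * fejer K (u j)| <= b j) ->
    `|cos (theta * m%:~R + phi) - psi theta phi K x| <= K%:R^-1 * \sum_j b j.
  move=> hb; rewrite errE normrM ger0_norm ?invr_ge0// ler_wpM2l ?invr_ge0//.
  by apply: (le_trans (ler_norm_sum _ _ _)); apply: ler_sum => j _.
have f0 : 0 <= 4 / K'%:R * fejer K' (2 * pi * x).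
  by rewrite mulr_ge0 ?fejer_ge0// divr_ge0.
have s20 : 0 < sin d ^+ 2 by rewrite exprn_gt0.
have q0 : 0 <= 2 / (K%:R * sin d ^+ 2) by rewrite divr_ge0// mulr_ge0 ?ltW.
have bad (z : int) : `|2 * pi * (x - z%:~R)| <= K'%:R^-1 ->
    2 <= 4 / K'%:R * fejer K' (2 * pi * x).
  move=> hz; have : K'%:R / 2 <= fejer K' (2 * pi * x).
    have -> : fejer K' (2 * pi * x) = fejer K' (2 * pi * (x - z%:~R)).
      congr (_ * _); apply: eq_bigr => k _; apply: eq_bigr => l _.
      rewrite -[LHS](@cosD2npi _ _ (- z * (k%:Z - l%:Z))); congr cos.
      by rewrite intrM intrB mulrNz -!pmulrn; ring.
    exact: fejer_ge_half.
  rewrite -(@ler_pM2l _ (4 / K'%:R)) ?divr_gt0//; apply: le_trans.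
  by rewrite (_ : 4 / K'%:R * (K'%:R / 2) = 2)//; field; rewrite gt_eqF.
have KV : K'%:R^-1 = 2 * d by rewrite /d; field; rewrite gt_eqF.
have psum (b : R) : K%:R^-1 * \sum_(j < K) (b * fejer K (u j)) = b.
  by rewrite -mulr_sumr mulrCA avg1 mulr1.
have [yb|yb] := boolP ((y * pi <= d) || ((1 - y) * pi <= d)).
  suff B2 : `|cos (theta * m%:~R + phi) - psi theta phi K x| <= 2.
    suff : 2 <= 4 / K'%:R * fejer K' (2 * pi * x) by lra.
    have yE : y * pi = x * pi - m%:~R * pi by rewrite -mulrBl.
    have pm0 : 0 <= y * pi by rewrite mulr_ge0// pi_ge0.
    have pm1 : 0 <= (1 - y) * pi by rewrite mulr_ge0 ?pi_ge0// subr_ge0 ltW.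
    case/orP: yb => hy; [apply: (bad m)|apply: (bad (m + 1))]; rewrite KV.
      by rewrite mulrBr ger0_norm; lra.
    by rewrite intrD mulrBr ler0_norm; lra.
  rewrite -[leRHS]psum; apply: bnd => j; rewrite normrM (ger0_norm (fejer_ge0 _ _)).
  rewrite ler_wpM2r ?fejer_ge0//.
  apply: (le_trans (ler_normB _ _)).
  by have := cos_max (theta * m%:~R + phi);
     have := cos_max (theta * (x - j%:R / K%:R) + phi); lra.
move: yb; rewrite negb_or -!ltNge => /andP[yd1 yd2].
set q := 2 / (K%:R * sin d ^+ 2) in q0 *.
suff : `|cos (theta * m%:~R + phi) - psi theta phi K x| <= d + q by lra.
have -> : d + q = K%:R^-1 * \sum_(j < K) (d * fejer K (u j) + q).
  rewrite big_split/= mulrDr psum sum_const_ord mulKf ?gt_eqF//.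
apply: bnd => j; rewrite normrM (ger0_norm (fejer_ge0 _ _)).
have j1 : j%:R / K%:R < 1 :> R by rewrite ltr_pdivrMr// mul1r ltr_nat.
have j0 : 0 <= j%:R / K%:R :> R by rewrite divr_ge0.
have [near|far] := leP `|(y - j%:R / K%:R) * pi| d.
  suff : `|cos (theta * m%:~R + phi) - cos (theta * (x - j%:R / K%:R) + phi)| *
      fejer K (u j) <= d * fejer K (u j) by lra.
  rewrite ler_wpM2r ?fejer_ge0//; apply: (le_trans (cos_lipschitz _ _)).
  rewrite (_ : _ - _ = - (theta * (y - j%:R / K%:R))); last by rewrite /y; ring.
  rewrite normrN normrM ger0_norm//; apply: le_trans near.
  by rewrite normrM (ger0_norm (ltW (pi_gt0 R))) mulrC ler_wpM2l.
suff : `|cos (theta * m%:~R + phi) - cos (theta * (x - j%:R / K%:R) + phi)| *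
      fejer K (u j) <= q.
  by have := mulr_ge0 (ltW d0) (fejer_ge0 K (u j)); lra.
have sw : sin d ^+ 2 <= sin (u j / 2) ^+ 2.
  have -> : sin (u j / 2) ^+ 2 = sin ((y - j%:R / K%:R) * pi) ^+ 2.
    have h (z : R) : sin z ^+ 2 = (1 - cos (2 * z)) / 2.
      have -> : 2 * z = z + z by ring.
      by have := cos2Dsin2 z; rewrite cosD -!expr2; lra.
    rewrite !h -(@cosD2npi _ (2 * ((y - j%:R / K%:R) * pi)) m); congr ((1 - cos _) / 2).
    by rewrite /u /y; field; rewrite gt_eqF.
  (* As x keeps away from the integers on both sides, the angle is also at least d away from pi and
     - pi, where the sine would vanish again. *)
  apply: sqr_sin_ge; [exact: ltW|exact: ltW|].
  have ypi : y * pi < pi - d by lra.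
  have jpi : 0 <= j%:R / K%:R * pi :> R by rewrite mulr_ge0//; lra.
  have jpi1 : j%:R / K%:R * pi <= pi :> R by rewrite ler_piMl//; lra.
  by rewrite mulrBl ler_norml; lra.
have fq : fejer K (u j) <= q / 2.
  rewrite /q (_ : _ / _ / 2 = (K%:R)^-1 / sin d ^+ 2); last by field; rewrite !gt_eqF.
  rewrite ler_pdivlMr//; apply: le_trans (fejer_sin K (u j)).
  by rewrite ler_wpM2l ?fejer_ge0.
have c2 : `|cos (theta * m%:~R + phi) - cos (theta * (x - j%:R / K%:R) + phi)| <= 2.
  apply: (le_trans (ler_normB _ _)).
  by have := cos_max (theta * m%:~R + phi);
     have := cos_max (theta * (x - j%:R / K%:R) + phi); lra.
have := ler_pM (normr_ge0 _) (fejer_ge0 K (u j)) c2 fq; lra.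
Qed.

Lemma weyl_floor (R : realType) (x : nat -> R) (c e : R) : weyl x -> 0 < c -> 0 < e ->
  \forall N \near \oo, forall theta phi : R, c <= theta <= pi ->
    `|\sum_(n < N) cos (theta * (Num.floor (x n))%:~R + phi)| <= e * N%:R.
Proof.
move=> wx c0 e0.
(* [K'] comes before [K], which must be large against the squared sine of 1 / (2 K'); the precision
   [e1] of the exponential sums comes last, as it is multiplied by [K]. *)
have [K' K'0 hK'] : exists2 K' : nat, (0 < K')%N & 32 <= e * K'%:R.
  have [n _ /(_ n (leqnn _))/= h] := nbhs_infty_ger (32 / e).
  exists n.+1 => //; rewrite mulrC -ler_pdivrMr// (le_trans h)// ler_nat.
  exact: leqnSn.
pose s : R := sin ((2 * K'%:R)^-1) ^+ 2.
have k'1 : 1 <= K'%:R :> R by rewrite ler1n.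
have s0 : 0 < s.
  rewrite exprn_gt0// sin_gt0_pi// invr_gt0 mulr_gt0 ?ltr0n//=.
  have := pi_ge2 R; apply: lt_le_trans.
  by rewrite invf_plt ?posrE//; lra.
have [K K0 hK] : exists2 K : nat, (0 < K)%N & 16 <= e * (K%:R * s).
  have [n _ /(_ n (leqnn _))/= h] := nbhs_infty_ger (16 / e / s).
  exists n.+1 => //; rewrite mulrC -ler_pdivrMr// -ler_pdivrMr// (le_trans h)// ler_nat.
  exact: leqnSn.
have k1 : 1 <= K%:R :> R by rewrite ler1n.
pose e1 := e / (32 + 8 * K%:R).
have e10 : 0 < e1 by rewrite divr_gt0//; lra.
have e1E : e1 * (32 + 8 * K%:R) = e by rewrite /e1 divfK// gt_eqF//; lra.
pose T := 2 * pi * K%:R + pi : R; pose T' := 2 * pi * K'%:R : R.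
near=> N => theta phi /andP[ct tpi].
have H1 : forall t phi : R, c <= `|t| <= T ->
    `|\sum_(n < N) cos (t * x n + phi)| <= e1 * N%:R.
  by near: N; exact: weyl_norm.
have H2 : forall t phi : R, 2 * pi <= `|t| <= T' ->
    `|\sum_(n < N) cos (t * x n + phi)| <= e1 * N%:R.
  by near: N; apply: weyl_norm => //; rewrite mulr_gt0// pi_gt0.
have N0 : 0 <= N%:R :> R by [].
have ctp : c <= theta <= pi by rewrite ct.
have h1 := sum_psi_le phi K0 (ltW e10) (ltW c0) ctp H1.
have h2 := sum_fejer_le K'0 (ltW e10) H2.
pose d : R := (2 * K'%:R)^-1; pose q : R := 2 / (K%:R * s).
have h3 : `|\sum_(n < N) (cos (theta * (Num.floor (x n))%:~R + phi) -
      psi theta phi K (x n))| <= N%:R * (d + q) + 4 / K'%:R * ((1 + e1 * K'%:R) * N%:R).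
  apply: (@le_trans _ _ (\sum_(n < N) ((d + q) + 4 / K'%:R * fejer K' (2 * pi * x n)))).
    apply: (le_trans (ler_norm_sum _ _ _)); apply: ler_sum => n _.
    by apply: psi_floor => //; rewrite tpi andbT (le_trans (ltW c0)).
  by rewrite big_split/= sum_const_ord lerD2l -mulr_sumr ler_wpM2l.
have dle : d <= e / 16.
  by rewrite /d invf_ple ?posrE ?divr_gt0//; [rewrite invf_div ler_pdivrMr//; lra|lra].
have qle : q <= e / 8.
  have Ks0 : 0 < K%:R * s by rewrite mulr_gt0// ltr0n.
  move: hK Ks0; rewrite /q; move: (K%:R * s) => w hK w0.
  by rewrite ler_pdivrMr//; lra.
have h4 : 4 / K'%:R * ((1 + e1 * K'%:R) * N%:R) <= (e / 8 + 4 * e1) * N%:R.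
  rewrite mulrA ler_wpM2r// mulrDr mulr1 lerD//; last first.
    by rewrite le_eqVlt; apply/orP; left; apply/eqP; field; rewrite gt_eqF//; lra.
  by rewrite ler_pdivrMr//; lra.
have h5 : N%:R * (d + q) <= N%:R * (e / 16 + e / 8) by rewrite ler_wpM2l// lerD.
have -> : \sum_(n < N) cos (theta * (Num.floor (x n))%:~R + phi) =
    \sum_(n < N) (cos (theta * (Num.floor (x n))%:~R + phi) - psi theta phi K (x n)) +
    \sum_(n < N) psi theta phi K (x n) by rewrite sumrB subrK.
apply: (le_trans (ler_normD _ _)).
have : (e1 * (32 + 8 * K%:R)) * N%:R = e * N%:R by rewrite e1E.
have : 0 <= e1 * N%:R by rewrite mulr_ge0// ltW.
have : 0 <= e1 * K%:R * N%:R by rewrite !mulr_ge0// ltW.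
have : 0 <= e * N%:R by rewrite mulr_ge0// ltW.
lra.
Unshelve. all: by end_near.
Qed.

(** * Invariant means *)

Definition bdd (R : realType) (f : int -> R) := exists M : R, forall x, `|f x| <= M.

Lemma bdd_cst (R : realType) (c : R) : bdd (fun=> c).
Proof. by exists `|c|. Qed.

Lemma bddD (R : realType) (f g : int -> R) : bdd f -> bdd g -> bdd (fun x => f x + g x).
Proof.
by move=> [M hM] [N hN]; exists (M + N) => x; rewrite (le_trans (ler_normD _ _))// lerD.
Qed.

Lemma bddM (R : realType) (f g : int -> R) : bdd f -> bdd g -> bdd (fun x => f x * g x).
Proof. by move=> [M hM] [N hN]; exists (M * N) => x; rewrite normrM ler_pM. Qed.

Lemma bddN (R : realType) (f : int -> R) : bdd f -> bdd (fun x => - f x).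
Proof. by move=> [M hM]; exists M => x; rewrite normrN. Qed.

Lemma bddB (R : realType) (f g : int -> R) : bdd f -> bdd g -> bdd (fun x => f x - g x).
Proof. by move=> bf bg; exact: bddD bf (bddN bg). Qed.

Lemma bddX (R : realType) (f : int -> R) n : bdd f -> bdd (fun x => f x ^+ n).
Proof.
move=> [M hM]; exists (M ^+ n) => x; rewrite normrX lerXn2r// nnegrE//.
exact: le_trans (hM 0).
Qed.

Lemma bdd_comp (R : realType) (f : int -> R) (g : int -> int) : bdd f -> bdd (fun x => f (g x)).
Proof. by move=> [M hM]; exists M => x. Qed.

Lemma bdd_cos (R : realType) (g : int -> R) : bdd (fun x => cos (g x)).
Proof. by exists 1 => x; exact: cos_max. Qed.

Lemma bdd_sin (R : realType) (g : int -> R) : bdd (fun x => sin (g x)).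
Proof. by exists 1 => x; exact: sin_max. Qed.

Lemma bdd_sum (R : realType) (I : Type) (s : seq I) (P : pred I) (f : I -> int -> R) :
  (forall i, bdd (f i)) -> bdd (fun x => \sum_(i <- s | P i) f i x).
Proof.
move=> bf; elim: s => [|i s IH].
  by rewrite (_ : (fun=> _) = fun=> 0); [exact: bdd_cst|apply/funext => x; rewrite big_nil].
rewrite (_ : (fun=> _) = fun x => (if P i then f i x else 0) + \sum_(i <- s | P i) f i x).
  by apply: bddD IH; case: (P i); [exact: bf|exact: bdd_cst].
by apply/funext => x; rewrite big_cons; case: (P i) => //; rewrite add0r.
Qed.

Ltac bdd_tac := repeat first
  [ assumption | exact: bdd_cst | apply: bdd_cos | apply: bdd_sin
  | apply: bddB | apply: bddD | apply: bddN | apply: bddM | apply: bddX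
  | (apply: bdd_sum => ?) | apply: bdd_comp ].

(** Normalisation is left out because [ergodic] speaks of invariant functionals of any mass below a
    given mean. *)
Record inv_pos (R : realType) (L : (int -> R) -> R) : Prop := InvPos {
  meanD : forall f g, bdd f -> bdd g -> L (fun x => f x + g x) = L f + L g ;
  meanZ : forall c f, bdd f -> L (fun x => c * f x) = c * L f ;
  mean_ge0 : forall f, bdd f -> (forall x, 0 <= f x) -> 0 <= L f ;
  mean_shift : forall f k, bdd f -> L (fun x => f (x + k)) = L f }.

Lemma mean0 (R : realType) (L : (int -> R) -> R) : inv_pos L -> L (fun=> 0) = 0.
Proof.
move=> mL; rewrite -[RHS](mul0r (L (fun=> 0))) -(meanZ mL); last exact: bdd_cst.
by congr L; apply/funext => x; rewrite mul0r.
Qed.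

Lemma mean_cst (R : realType) (L : (int -> R) -> R) c : inv_pos L ->
  L (fun=> c) = c * L (fun=> 1).
Proof.
by move=> mL; rewrite -(meanZ mL)//; [congr L; apply/funext => x; rewrite mulr1|exact: bdd_cst].
Qed.

Lemma meanN (R : realType) (L : (int -> R) -> R) f : inv_pos L -> bdd f ->
  L (fun x => - f x) = - L f.
Proof.
move=> mL bf; rewrite -mulN1r -(meanZ mL)//.
by congr L; apply/funext => x; rewrite mulN1r.
Qed.

Lemma meanB (R : realType) (L : (int -> R) -> R) f g : inv_pos L -> bdd f -> bdd g ->
  L (fun x => f x - g x) = L f - L g.
Proof. by move=> mL bf bg; rewrite (meanD mL)// ?meanN//; exact: bddN. Qed.

Lemma mean_le (R : realType) (L : (int -> R) -> R) f g : inv_pos L -> bdd f -> bdd g ->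
  (forall x, f x <= g x) -> L f <= L g.
Proof.
move=> mL bf bg fg; rewrite -subr_ge0 -meanB//; apply: (mean_ge0 mL).
  exact: bddB.
by move=> x; rewrite subr_ge0.
Qed.

Lemma mean_sum (R : realType) (L : (int -> R) -> R) (I : Type) (s : seq I) (P : pred I)
    (f : I -> int -> R) : inv_pos L -> (forall i, bdd (f i)) ->
  L (fun x => \sum_(i <- s | P i) f i x) = \sum_(i <- s | P i) L (f i).
Proof.
move=> mL bf; elim: s => [|i s IH].
  by rewrite big_nil -[RHS](mean0 mL); congr L; apply/funext => x; rewrite big_nil.
rewrite big_cons; case: ifP => Pi.
  rewrite -IH -(meanD mL)//; last exact: bdd_sum.
  by congr L; apply/funext => x; rewrite big_cons Pi.
by rewrite -IH; congr L; apply/funext => x; rewrite big_cons Pi.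
Qed.

Lemma mean_norm_le (R : realType) (L : (int -> R) -> R) f M : inv_pos L ->
  (forall x, `|f x| <= M) -> `|L f| <= M * L (fun=> 1).
Proof.
move=> mL fM; have bf : bdd f by exists M.
rewrite ler_norml -mulNr -!mean_cst//; apply/andP; split; apply: mean_le => //;
  try exact: bdd_cst.
- by move=> x; have := fM x; rewrite ler_norml => /andP[].
- by move=> x; have := fM x; rewrite ler_norml => /andP[].
Qed.

Lemma mean_le_cst (R : realType) (L : (int -> R) -> R) f c : inv_pos L ->
  L (fun=> 1) = 1 -> bdd f -> (forall x, f x <= c) -> L f <= c.
Proof.
move=> mL L1 bf fc; have -> : c = L (fun=> c) by rewrite mean_cst// L1 mulr1.
by apply: mean_le => //; exact: bdd_cst.
Qed.

Definition corr (R : realType) (L : (int -> R) -> R) (r : int -> R) (k : int) : R :=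
  L (fun x => r x * r (x + k)).

Lemma delta_root_unity (R : realType) (M : nat) (z : int) : (`|z| < M)%N ->
  (z == 0)%:R = M%:R^-1 * \sum_(j < M) cos (2 * pi * j%:R / M%:R * z%:~R) :> R.
Proof.
move=> zM; have M0 : (0 < M)%N by case: M zM.
have M0' : M%:R != 0 :> R by rewrite pnatr_eq0 -lt0n.
have [->|z0] := eqVneq z 0.
  under eq_bigr do rewrite mulr0 cos0.
  by rewrite sum_const_ord mulr1 mulVf.
have zz : (0 < `|z| < M)%N by rewrite absz_gt0 z0.
have := @sum_cos_root_unity R M `|z|%N 0 zz.
rewrite (_ : \sum_(j < M) _ = \sum_(j < M) cos (2 * pi * j%:R / M%:R * z%:~R)).
  by move=> ->; rewrite mulr0.
apply: eq_bigr => j _; rewrite add0r -[RHS]cos_norm -[LHS]cos_norm; congr cos.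
rewrite !normrM -intr_norm -abszE -pmulrn.
by rewrite (normr_nat _ `|z|%N); ring.
Qed.

(** Each equality y - x = k i is written as an average of cosines over the M-th roots of unity. For
    each frequency t the sum then factors into |sum c(x) e^(itx)|^2 and the nonnegative combination
    at t; the sine part cancels on swapping x and y. *)
Lemma psd_finite (R : realType) (I : finType) (b : I -> R) (k : I -> int)
    (c : nat -> R) (Q : nat) :
  (forall th : R, 0 <= \sum_i b i * cos (th * (k i)%:~R)) ->
  0 <= \sum_i b i * \sum_(x < Q) \sum_(y < Q) (y%:Z - x%:Z == k i)%:R * (c x * c y).
Proof.
move=> pos.
(* Exceeds every |y - x - k i|, so that equality modulo [M] is equality. *)
pose M := (Q + (\max_i `|k i|%N)).+1.
have kM (x y : 'I_Q) i : (absz (y%:Z - x%:Z - k i)%R < M)%N.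
  have := @leq_bigmax _ (fun i => `|k i|%N) i; have := ltn_ord x; have := ltn_ord y.
  rewrite /M; lia.
pose th (j : nat) : R := 2 * pi * j%:R / M%:R.
have -> : \sum_i b i * (\sum_(x < Q) \sum_(y < Q) (y%:Z - x%:Z == k i)%:R * (c x * c y)) =
    M%:R^-1 * \sum_(j < M) \sum_i \sum_(x < Q) \sum_(y < Q)
      b i * (cos (th j * (y%:Z - x%:Z - k i)%:~R) * (c x * c y)).
  rewrite exchange_big/= mulr_sumr; apply: eq_bigr => i _.
  rewrite mulr_sumr exchange_big/= mulr_sumr; apply: eq_bigr => x _.
  rewrite mulr_sumr exchange_big/= mulr_sumr; apply: eq_bigr => y _.
  rewrite -subr_eq0 (delta_root_unity R (kM x y i)) -mulr_sumr -mulr_suml.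
  by rewrite -mulrA mulrCA.
rewrite mulr_ge0 ?invr_ge0//; apply: sumr_ge0 => j _.
set t := th j.
pose A := \sum_(x < Q) \sum_(y < Q) c x * c y * cos (t * y%:R - t * x%:R).
have A0 : 0 <= A.
  have := @sqr_sum_cos_sin R 'I_Q c (fun x => t * x%:R).
  rewrite [X in _ = X -> _](_ : _ = A) => [<-|]; first by rewrite addr_ge0// sqr_ge0.
  rewrite /A exchange_big/=; apply: eq_bigr => x _; apply: eq_bigr => y _.
  by rewrite (mulrC (c y)).
have B0 : \sum_(x < Q) \sum_(y < Q) c x * c y * sin (t * y%:R - t * x%:R) = 0.
  set B := (X in X = _); suff : B = - B by lra.
  rewrite {1}/B exchange_big/= -sumrN; apply: eq_bigr => x _.
  rewrite -sumrN; apply: eq_bigr => y _.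
  by rewrite -[RHS]mulrN -sinN opprB (mulrC (c y)).
rewrite (_ : \sum_i _ = A * \sum_i b i * cos (t * (k i)%:~R)) ?mulr_ge0//.
rewrite mulr_sumr; apply: eq_bigr => i _.
transitivity (b i * (cos (t * (k i)%:~R) * A + sin (t * (k i)%:~R) *
    \sum_(x < Q) \sum_(y < Q) c x * c y * sin (t * y%:R - t * x%:R))).
  rewrite /A !mulr_sumr -big_split/= mulr_sumr; apply: eq_bigr => x _.
  rewrite !mulr_sumr -big_split/= mulr_sumr; apply: eq_bigr => y _.
  rewrite !intrB -!pmulrn mulrBr mulrBr (cosB (_ - _)); ring.
by rewrite B0; ring.
Qed.

Lemma count_shift_ge (R : realType) (Q : nat) (k : int) :
  Q%:R - 2 * `|k|%:~R <= \sum_(x < Q) \sum_(y < Q) (y%:Z - x%:Z == k)%:R :> R.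
Proof.
have inner (x : nat) : (x < Q)%N -> 1 - (~~ (0 <= x%:Z + k < Q%:Z))%:R <=
    \sum_(y < Q) (y%:Z - x%:Z == k)%:R :> R.
  move=> xQ; have [/andP[h1 h2]|h] /= := boolP (0 <= x%:Z + k < Q%:Z); last first.
    by rewrite subrr; apply: sumr_ge0.
  have yQ : (absz (x%:Z + k)%R < Q)%N by lia.
  rewrite subr0 (bigD1 (Ordinal yQ))//= (_ : _ == k); last by apply/eqP; lia.
  by rewrite lerDl; apply: sumr_ge0.
apply: (@le_trans _ _ (\sum_(x < Q) (1 - (~~ (0 <= x%:Z + k < Q%:Z))%:R))); last first.
  by apply: ler_sum => x _; exact: inner.
rewrite sumrB sum_const_ord mulr1 lerD2l lerN2.
case: k {inner} => m.
  have := @sum_shift R (fun n => (Q <= n)%N%:R) Q m.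
  rewrite [X in _ - X]big1; last by move=> i _; rewrite leqNgt ltn_ord.
  rewrite subr0 => H; have {}H := H (fun n => _).
  rewrite (_ : \sum_(x < Q) _ = \sum_(x < Q) (Q <= x + m)%N%:R).
    apply: (le_trans (ler_norm _)); apply: H => n; by case: leqP => _; rewrite ?normr0 ?normr1.
  by apply: eq_bigr => x _; congr (nat_of_bool _)%:R; lia.
have := @sum_shift R (fun n => (n < m.+1)%N%:R) Q m.+1.
rewrite [X in X - _]big1; last by move=> i _; rewrite ltnNge leq_addl.
rewrite sub0r normrN => H.
rewrite (_ : \sum_(x < Q) _ = \sum_(x < Q) (x < m.+1)%N%:R).
  apply: (le_trans (ler_norm _)); apply: H => n; by case: ltnP => _; rewrite ?normr0 ?normr1.
by apply: eq_bigr => x _; congr (nat_of_bool _)%:R; have := ltn_ord x; lia.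
Qed.

(** * Positive definite functions *)

Lemma count_shift_le (R : realType) (Q : nat) (k : int) :
  \sum_(x < Q) \sum_(y < Q) (y%:Z - x%:Z == k)%:R <= Q%:R :> R.
Proof.
apply: (@le_trans _ _ (\sum_(x < Q) (1 : R))); last by rewrite sum_const_ord mulr1.
apply: ler_sum => x _.
have [y yE|none] := pickP (fun y : 'I_Q => y%:Z - x%:Z == k).
  rewrite (bigD1 y)//= yE big1 ?addr0// => z zy.
  case: eqP => // zE; case/eqP: zy; apply: val_inj => /=; move/eqP: yE; lia.
by rewrite big1// => y _; rewrite none.
Qed.

(* A finitely supported combination of the functions cos (th k), as a list of
   (coefficient, k); [ev g s] evaluates it with g k in place of cos (th k). *)
Definition ev (R : realType) (g : int -> R) (s : seq (R * int)) : R :=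
  \sum_(p <- s) p.1 * g p.2.

Definition charcos (R : realType) (th : R) (k : int) : R := cos (th * k%:~R).

(** Positive definiteness in dual form: the property that [g] would inherit from being the integral
    of cos (th k) against a positive measure in th. *)
Definition posdef (R : realType) (g : int -> R) :=
  forall s, (forall th, 0 <= ev (charcos th) s) -> 0 <= ev g s.

Lemma ev_cat (R : realType) (g : int -> R) s t : ev g (s ++ t) = ev g s + ev g t.
Proof. by rewrite /ev big_cat. Qed.

Lemma ev_mul (R : realType) (g h : int -> R) s :
  ev g [seq (p.1 * h p.2, p.2) | p <- s] = ev (fun k => h k * g k) s.
Proof. by rewrite /ev big_map; apply: eq_bigr => p _; rewrite mulrA. Qed.

Lemma ev_scale (R : realType) (g : int -> R) (c : R) s :
  ev g [seq (c * p.1, p.2) | p <- s] = c * ev g s.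
Proof. by rewrite /ev big_map mulr_sumr; apply: eq_bigr => p _; rewrite mulrA. Qed.

Lemma posdef_le (R : realType) (g : int -> R) s t : posdef g ->
  (forall th, ev (charcos th) s <= ev (charcos th) t) -> ev g s <= ev g t.
Proof.
move=> pg st; have := pg (t ++ [seq (- 1 * p.1, p.2) | p <- s]).
rewrite ev_cat ev_scale mulN1r subr_ge0; apply => th.
by rewrite ev_cat ev_scale mulN1r subr_ge0.
Qed.

(** The counterpart of convolving the two measures: a product of cosines is the mean of the cosines
    at th + et and th - et, so positivity of [g] applies for each fixed th, and then that of [h]. *)
Lemma posdefM (R : realType) (g h : int -> R) : posdef g -> posdef h ->
  posdef (fun k => g k * h k).
Proof.
move=> pg ph s pos; rewrite -ev_mul; apply: ph => th.
rewrite ev_mul (_ : ev _ s = ev g [seq (p.1 * charcos th p.2, p.2) | p <- s]).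
  apply: pg => et; rewrite ev_mul.
  have -> : ev (fun k => charcos th k * charcos et k) s =
     (ev (charcos (th + et)) s + ev (charcos (th - et)) s) / 2.
    rewrite /ev -big_split/= mulr_suml; apply: eq_bigr => p _.
    by rewrite /charcos !mulrDl mulNr cosB cosD; field.
  by rewrite divr_ge0// addr_ge0.
by rewrite ev_mul; apply: eq_bigr => p _; rewrite (mulrC (g _)).
Qed.

Lemma posdef_charcos (R : realType) (th : R) : posdef (charcos th).
Proof. by move=> s; apply. Qed.

(* The combination of correlations is the limit of its Fejer-weighted means over
   windows of length Q, which are nonnegative by a finite Fourier transform. *)
Lemma posdef_corr (R : realType) (L : (int -> R) -> R) (r : int -> R) :
  inv_pos L -> bdd r -> posdef (corr L r).
Proof.
move=> mL br s pos.
pose b (i : 'I_(size s)) : R := (tnth (in_tuple s) i).1.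
pose k (i : 'I_(size s)) : int := (tnth (in_tuple s) i).2.
have evE g : ev g s = \sum_i b i * g (k i) by rewrite /ev big_tnth.
have {}pos th : 0 <= \sum_i b i * cos (th * (k i)%:~R) by have := pos th; rewrite evE.
rewrite evE; set S := \sum_i _.
pose C := \sum_i `|b i * corr L r (k i)| * (2 * `|k i|%:~R).
have main (Q : nat) : - C <= S * Q%:R.
  pose n i : R := \sum_(x < Q) \sum_(y < Q) (y%:Z - x%:Z == k i)%:R.
  have h1 : 0 <= \sum_i b i * (n i * corr L r (k i)).
    pose F (t : int) : R := \sum_i b i * \sum_(x < Q) \sum_(y < Q)
       (y%:Z - x%:Z == k i)%:R * (r (t + x%:Z) * r (t + y%:Z)).
    have bF : bdd F by rewrite /F; bdd_tac.
    have : 0 <= L F.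
      apply: (mean_ge0 mL) => // t.
      exact: (@psd_finite R _ b k (fun x => r (t + x%:Z))).
    rewrite /F mean_sum//; last by move=> i; bdd_tac.
    rewrite (_ : \sum_i _ = \sum_i b i * (n i * corr L r (k i)))//.
    apply: eq_bigr => i _; rewrite (meanZ mL); last by bdd_tac.
    rewrite mean_sum//; last by move=> x; bdd_tac.
    rewrite /n mulr_suml; congr (_ * _); apply: eq_bigr => x _.
    rewrite mean_sum//; last by move=> y; bdd_tac.
    rewrite mulr_suml; apply: eq_bigr => y _.
    rewrite (meanZ mL); last by bdd_tac.
    case: eqP => [e|_]; last by rewrite !mul0r.
    congr (_ * _); rewrite /corr -[RHS](mean_shift mL x%:Z); last by bdd_tac.
    by congr L; apply/funext => t; congr (_ * r _); rewrite -e; ring.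
  have -> : S * Q%:R = \sum_i b i * (n i * corr L r (k i)) +
      \sum_i (b i * corr L r (k i)) * (Q%:R - n i).
    rewrite -big_split/= mulr_suml; apply: eq_bigr => i _; ring.
  apply: (@le_trans _ _ (\sum_i (b i * corr L r (k i)) * (Q%:R - n i))); last by rewrite lerDr.
  rewrite /C -sumrN; apply: ler_sum => i _.
  have n1 : n i <= Q%:R := count_shift_le R Q (k i).
  have n2 : Q%:R - 2 * `|k i|%:~R <= n i := count_shift_ge R Q (k i).
  rewrite lerNl -mulNr; apply: (le_trans (ler_norm _)).
  by rewrite normrM normrN ler_wpM2l// ger0_norm; lra.
rewrite leNgt; apply/negP => S0.
have [Q _ /(_ Q (leqnn _))/= hQ] := nbhs_infty_gtr (C / - S).
move: hQ; rewrite ltr_pdivrMr ?oppr_gt0//; have := main Q; lra.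
Qed.

(** Stands for |sum e^(i th a(n))|^2. Evaluated at a correlation function it gives second moments,
    and for [a] = [Posz] it is N times the Fejer kernel. *)
Definition ker (R : realType) (a : nat -> int) (N : nat) : seq (R * int) :=
  [seq (1, a (i : 'I_N) - a (j : 'I_N)) | i <- enum 'I_N, j <- enum 'I_N].

Lemma ev_ker (R : realType) (g : int -> R) (a : nat -> int) (N : nat) :
  ev g (ker R a N) = \sum_(i < N) \sum_(j < N) g (a i - a j).
Proof.
rewrite /ev big_allpairs_dep/= !big_enum/=; apply: eq_bigr => i _.
by rewrite big_enum/=; apply: eq_bigr => j _; rewrite mul1r.
Qed.

Lemma ev_ker_charcos (R : realType) (th : R) (a : nat -> int) (N : nat) :
  ev (charcos th) (ker R a N) =
  (\sum_(i < N) cos (th * (a i)%:~R)) ^+ 2 + (\sum_(i < N) sin (th * (a i)%:~R)) ^+ 2.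
Proof.
have := @sqr_sum_cos_sin R 'I_N (fun=> 1) (fun i => th * (a i)%:~R).
under eq_bigr do rewrite mul1r.
under [in X in _ + X = _]eq_bigr do rewrite mul1r.
move=> ->; rewrite ev_ker; apply: eq_bigr => i _; apply: eq_bigr => j _.
by rewrite !mul1r /charcos intrB mulrBr.
Qed.

(** The interval [c, pi] suffices: [cos_red] moves any frequency into [0, pi] by periodicity and
    reflection. *)
Definition equi (R : realType) (a : nat -> int) :=
  forall c e : R, 0 < c -> 0 < e -> \forall N \near \oo, forall theta phi : R,
    c <= theta <= pi -> `|\sum_(n < N) cos (theta * (a n)%:~R + phi)| <= e * N%:R.

Lemma cos_red (R : realType) (th : R) : exists2 th' : R, 0 <= th' <= pi &
  exists b : bool, forall (z : int) (phi : R),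
    cos (th * z%:~R + phi) = cos (th' * z%:~R + (-1) ^+ b * phi).
Proof.
have p0 := pi_gt0 R.
pose k := Num.floor ((th + pi) / (2 * pi)).
have := floor_itv ((th + pi) / (2 * pi)); rewrite -/k intrD.
rewrite ler_pdivlMr ?ltr_pdivrMr ?mulr_gt0// => /andP[h1 h2].
have E (z : int) (phi : R) :
    cos (th * z%:~R + phi) = cos ((th - 2 * pi * k%:~R) * z%:~R + phi).
  rewrite -[RHS](cosD2npi _ (k * z)); congr cos; rewrite intrM; ring.
exists `|th - 2 * pi * k%:~R|.
  by rewrite normr_ge0/= ler_norml; lra.
have [t0|t0] := leP 0 (th - 2 * pi * k%:~R).
  by exists false => z phi; rewrite E ger0_norm// expr0 mul1r.
exists true => z phi; rewrite E ltr0_norm// expr1 mulN1r -cosN; congr cos; ring.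
Qed.

Lemma charcos_red (R : realType) (th : R) :
  exists2 th' : R, 0 <= th' <= pi & charcos th = charcos th'.
Proof.
have [th' t' [b H]] := cos_red th; exists th' => //; apply/funext => z.
by have := H z 0; rewrite mulr0 !addr0.
Qed.

Lemma ev_ker_charcos_ge0 (R : realType) (th : R) (a : nat -> int) (N : nat) :
  0 <= ev (charcos th) (ker R a N).
Proof. by rewrite ev_ker_charcos addr_ge0// sqr_ge0. Qed.

Lemma ev_ker_charcos_le (R : realType) (th : R) (a : nat -> int) (N : nat) :
  ev (charcos th) (ker R a N) <= N%:R ^+ 2.
Proof.
rewrite ev_ker; apply: (@le_trans _ _ (\sum_(i < N) \sum_(j < N) (1 : R))).
  by apply: ler_sum => i _; apply: ler_sum => j _; exact: cos_le1.
by rewrite !sum_const_ord mulr1.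
Qed.

(** For th <= 1 / H all cosines in the interval kernel are at least 1/2, so twice its normalised
    value already exceeds the trivial bound 1. For th > 1 / H equidistribution makes the left-hand
    side at most e N^2. *)
Lemma ker_dominated (R : realType) (a : nat -> int) (H : nat) (e : R) :
  equi R a -> (0 < H)%N -> 0 < e -> \forall N \near \oo, forall th : R,
    ev (charcos th) (ker R a N) <=
    N%:R ^+ 2 * (2 * ev (charcos th) (ker R Posz H) / H%:R ^+ 2 + e).
Proof.
move=> ea H0 e0.
have h0 : 0 < H%:R :> R by rewrite ltr0n.
(* The bound 1 gives e1^2 <= e1; the half is for the squares of the cosine and of the sine sum. *)
pose e1 := Num.min 1 (e / 2).
have e10 : 0 < e1 by rewrite lt_min ltr01 divr_gt0.
have e11 : e1 <= 1 by rewrite ge_min lexx.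
have e1e : e1 <= e / 2 by rewrite ge_min lexx orbT.
have hi : 0 < H%:R^-1 :> R by rewrite invr_gt0.
have ea1 := ea _ _ hi e10.
have ijH (i j : 'I_H) : `|i%:Z - j%:Z| <= H%:Z.
  by have := ltn_ord i; have := ltn_ord j; lia.
near=> N => th0.
have [th /andP[t0 tpi] ->] := charcos_red th0.
set V := ev _ (ker R Posz H).
have V0 : 0 <= V := ev_ker_charcos_ge0 th Posz H.
have N0 : 0 <= N%:R :> R by [].
have [tH|tH] := leP th H%:R^-1.
  apply: (le_trans (ev_ker_charcos_le _ _ _)).
  rewrite ler_peMr ?sqr_ge0//.
  suff : 1 <= 2 * V / H%:R ^+ 2 by lra.
  rewrite ler_pdivlMr ?exprn_gt0// mul1r.
  rewrite /V ev_ker mulr_sumr.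
  have -> : H%:R ^+ 2 = \sum_(i < H) (H%:R : R) by rewrite sum_const_ord.
  apply: ler_sum => i _; rewrite mulr_sumr.
  have -> : H%:R = \sum_(j < H) (1 : R) by rewrite sum_const_ord mulr1.
  apply: ler_sum => j _.
  suff : 1 / 2 <= charcos th (i%:Z - j%:Z) by lra.
  apply: cos_ge_half; rewrite normrM ger0_norm// -intr_norm.
  apply: (@le_trans _ _ (H%:R^-1 * H%:R)); last by rewrite mulVf// gt_eqF.
  apply: ler_pM => //; rewrite [H%:R]pmulrn ler_int; exact: ijH.
have E : forall theta phi : R, H%:R^-1 <= theta <= pi ->
    `|\sum_(n < N) cos (theta * (a n)%:~R + phi)| <= e1 * N%:R.
  by near: N.
have tt : H%:R^-1 <= th <= pi by rewrite ltW.
rewrite ev_ker_charcos.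
have h1 := E th 0 tt; have h2 := E th (- (pi / 2)) tt.
move: h1 h2.
under eq_bigr do rewrite addr0.
under [in X in _ -> X -> _]eq_bigr do rewrite cosBpihalf.
move=> h1 h2.
have sq (z : R) : `|z| <= e1 * N%:R -> z ^+ 2 <= e1 * N%:R ^+ 2.
  move=> hz; rewrite -(real_normK (num_real z)).
  apply: (@le_trans _ _ ((e1 * N%:R) ^+ 2)); first by rewrite lerXn2r// nnegrE// mulr_ge0// ltW.
  by rewrite exprMn ler_wpM2r ?sqr_ge0// expr2 ler_piMl// (ltW e10).
apply: (le_trans (lerD (sq _ h1) (sq _ h2))).
have : N%:R ^+ 2 * e1 <= N%:R ^+ 2 * (e / 2) by rewrite ler_wpM2l ?sqr_ge0.
have : 0 <= N%:R ^+ 2 * (2 * V / H%:R ^+ 2).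
  by rewrite mulr_ge0 ?sqr_ge0// divr_ge0 ?sqr_ge0// mulr_ge0.
rewrite mulrDr; lra.
Unshelve. all: by end_near.
Qed.

(** An interval of length 2 H is two translates of one of length H, so its kernel is that of H times
    |1 + e^(i th H)|^2 <= 4. Hence the normalised kernels decrease along powers of two. *)
Lemma ker_double (R : realType) (g : int -> R) (H : nat) : posdef g ->
  ev g (ker R Posz (H + H)) <= 4 * ev g (ker R Posz H).
Proof.
move=> pg; rewrite -ev_scale; apply: posdef_le => // th.
rewrite ev_scale !ev_ker_charcos !big_split_ord/=.
set C := \sum_(i < H) cos (th * i%:~R); set S := \sum_(i < H) sin (th * i%:~R).
have -> : \sum_(i < H) cos (th * (H + i)%:~R) =
    cos (th * H%:R) * C - sin (th * H%:R) * S.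
  rewrite !mulr_sumr -sumrB; apply: eq_bigr => i _.
  by rewrite PoszD intrD -pmulrn mulrDr cosD.
have -> : \sum_(i < H) sin (th * (H + i)%:~R) =
    sin (th * H%:R) * C + cos (th * H%:R) * S.
  rewrite !mulr_sumr -big_split/=; apply: eq_bigr => i _.
  by rewrite PoszD intrD -pmulrn mulrDr sinD.
have := cos2Dsin2 (th * H%:R); have := cos_le1 (th * H%:R).
move: (cos _) (sin _) => c s c1 cs.
have -> : (C + (c * C - s * S)) ^+ 2 + (S + (s * C + c * S)) ^+ 2 =
  (C ^+ 2 + S ^+ 2) * (1 + 2 * c + (c ^+ 2 + s ^+ 2)) by ring.
rewrite cs mulrC ler_wpM2r//; last lra.
by rewrite addr_ge0 ?sqr_ge0.
Qed.

Lemma ker_double_iter (R : realType) (g : int -> R) (m n : nat) : posdef g -> (m <= n)%N ->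
  ev g (ker R Posz (2 ^ n)) / (2 ^ n)%:R ^+ 2 <= ev g (ker R Posz (2 ^ m)) / (2 ^ m)%:R ^+ 2.
Proof.
move=> pg; elim: n => [|n IH]; first by rewrite leqn0 => /eqP ->.
rewrite leq_eqVlt => /orP[/eqP -> //|]; rewrite ltnS => /IH; apply: le_trans.
rewrite expnS mul2n -addnn.
have n0 : 0 < (2 ^ n)%:R :> R by rewrite ltr0n expn_gt0.
rewrite ler_pdivrMr ?exprn_gt0 ?natrD ?addr_gt0//.
apply: (le_trans (ker_double _ pg)); rewrite le_eqVlt; apply/orP; left; apply/eqP.
by field; rewrite gt_eqF.
Qed.

Lemma ev_lipschitz (R : realType) (g : int -> R) (s : seq (R * int)) :
  exists2 M : R, 0 <= M & forall th th' : R,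
    ev (fun k => charcos th k * g k) s <=
    ev (fun k => charcos th' k * g k) s + M * `|th - th'|.
Proof.
exists (\sum_(p <- s) `|p.1 * g p.2| * `|p.2%:~R|); first exact: sumr_ge0.
move=> th th'; rewrite mulr_suml -big_split/=; apply: ler_sum => p _.
rewrite -lerBlDl -mulrBr -mulrBl; apply: (le_trans (ler_norm _)); rewrite !normrM.
have h : `|charcos th p.2 - charcos th' p.2| <= `|th - th'| * `|p.2%:~R|.
  by apply: (le_trans (cos_lipschitz _ _)); rewrite -mulrBl normrM.
rewrite [leRHS](_ : _ = `|p.1| * ((`|th - th'| * `|p.2%:~R|) * `|g p.2|)); last by ring.
by rewrite ler_wpM2l// ler_wpM2r.
Qed.

(* Dini's argument: the Fejer averages decrease along powers of two, so the
   pointwise bound is uniform on the compact circle. *)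
Lemma ker_uniform (R : realType) (g : int -> R) (eta : R) : posdef g ->
  (forall phi, exists m,
    ev (fun k => charcos phi k * g k) (ker R Posz (2 ^ m)) < eta * (2 ^ m)%:R ^+ 2) ->
  exists m, forall phi,
    ev (fun k => charcos phi k * g k) (ker R Posz (2 ^ m)) <= eta * (2 ^ m)%:R ^+ 2.
Proof.
move=> pg pw.
pose P (m : nat) (phi : R) :=
  ev (fun k => charcos phi k * g k) (ker R Posz (2 ^ m)) <= eta * (2 ^ m)%:R ^+ 2.
have [m _ Hm] : \forall m \near \oo, `[0, pi] `<=` P m.
  apply: (iffLR (compact_near_coveringP _)); first exact: segment_compact.
  move=> phi _; have [m hm] := pw phi.
  have [M M0 hM] := ev_lipschitz g (ker R Posz (2 ^ m)).
  have n0 j : 0 < (2 ^ j)%:R ^+ 2 :> R by rewrite exprn_gt0// ltr0n expn_gt0.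
  pose gap := eta * (2 ^ m)%:R ^+ 2 - ev (fun k => charcos phi k * g k) (ker R Posz (2 ^ m)).
  have M1 : 0 < M + 1 by rewrite ltr_wpDl.
  have gap0 : 0 < gap / (M + 1) by rewrite divr_gt0 ?subr_gt0.
  have arith (z E T : R) : 0 <= z -> z * (M + 1) < T - E -> E + M * z <= T by lra.
  near=> phi' n.
  have mn : (m <= n)%N by near: n; exact: nbhs_infty_ge.
  rewrite /P -ler_pdivrMr//.
  have pg' := posdefM (posdef_charcos phi') pg.
  apply: (le_trans (ker_double_iter pg' mn)).
  rewrite ler_pdivrMr//; apply: (le_trans (hM phi' phi)).
  have : `|phi' - phi| < gap / (M + 1).
    rewrite distrC; near: phi'; exact: (nbhsx_ballx phi (gap / (M + 1))).
  by rewrite ltr_pdivlMr// => h; exact: (arith _ _ _ (normr_ge0 _) h).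
exists m => phi; have [phi' phi'pi ->] := charcos_red phi.
by apply: (Hm m (leqnn _)) => /=; rewrite in_itv.
Unshelve. all: by end_near.
Qed.

(** Wiener's argument by duality: one factor [g] is tested against the bound on the other factor
    twisted by cos (phi k), which holds for every phi, so on an interval the average of g^2 is at
    most eta times the total mass g 0. Since g^2 is positive definite, [ker_dominated] carries this
    over to [a]. *)
Lemma ker_sqr_le (R : realType) (g : int -> R) (eta e : R) (a : nat -> int) :
  posdef g -> equi R a -> 0 < e ->
  (forall phi, exists m,
    ev (fun k => charcos phi k * g k) (ker R Posz (2 ^ m)) < eta * (2 ^ m)%:R ^+ 2) ->
  \forall N \near \oo,
    ev (fun k => g k * g k) (ker R a N) <= N%:R ^+ 2 * (2 * eta * g 0 + e * g 0 ^+ 2).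
Proof.
move=> pg ea e0 pw; have [m hm] := ker_uniform pg pw.
set H := (2 ^ m)%N in hm.
have H0 : (0 < H)%N by rewrite expn_gt0.
have h0 : 0 < H%:R ^+ 2 :> R by rewrite exprn_gt0// ltr0n.
have wiener : ev (fun k => g k * g k) (ker R Posz H) <= eta * H%:R ^+ 2 * g 0.
  rewrite -ev_mul.
  have -> : eta * H%:R ^+ 2 * g 0 = ev g [:: (eta * H%:R ^+ 2, 0)].
    by rewrite /ev big_seq1.
  apply: posdef_le => // th; rewrite ev_mul [leRHS]/ev big_seq1/= /charcos mulr0 cos0 mulr1.
  apply: le_trans (hm th); rewrite le_eqVlt; apply/orP; left; apply/eqP.
  by apply: eq_bigr => p _; rewrite (mulrC (g _)).
near=> N.
have dom : forall th : R, ev (charcos th) (ker R a N) <=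
    N%:R ^+ 2 * (2 * ev (charcos th) (ker R Posz H) / H%:R ^+ 2 + e).
  by near: N; exact: ker_dominated.
have pgg := posdefM pg pg.
have N20 : 0 <= N%:R ^+ 2 :> R by rewrite sqr_ge0.
apply: (@le_trans _ _ (ev (fun k => g k * g k)
    ([seq (N%:R ^+ 2 * 2 / H%:R ^+ 2 * p.1, p.2) | p <- ker R Posz H] ++
     [:: (N%:R ^+ 2 * e, 0)]))).
  apply: posdef_le => // th; rewrite ev_cat ev_scale.
  rewrite [X in _ <= _ + X]/ev big_seq1/= /charcos mulr0 cos0 mulr1.
  by apply: (le_trans (dom th)); rewrite le_eqVlt; apply/orP; left; apply/eqP; ring.
rewrite ev_cat ev_scale [X in _ + X <= _]/ev big_seq1/=.
have -> : N%:R ^+ 2 * (2 * eta * g 0 + e * g 0 ^+ 2) =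
  N%:R ^+ 2 * (2 * eta * g 0) + N%:R ^+ 2 * e * (g 0 * g 0) by ring.
rewrite lerD2r.
apply: (@le_trans _ _ (N%:R ^+ 2 * 2 / H%:R ^+ 2 * (eta * H%:R ^+ 2 * g 0))).
  by rewrite ler_wpM2l// divr_ge0// ?(ltW h0)// mulr_ge0.
by rewrite le_eqVlt; apply/orP; left; apply/eqP; field; rewrite gt_eqF// ltr0n.
Unshelve. all: by end_near.
Qed.

(** The second moment is a double sum of w i * w j times correlations, and two uses of
    Cauchy-Schwarz leave the squared correlations alone. With correlation at 0 at most 2, the
    constant e^2 / 8 gives 2 (e^2 / 8) 2 + (e^2 / 8) 4 = e^2. *)
Lemma mean_conv_sqr_le (R : realType) (L : (int -> R) -> R) (r : int -> R) (e : R)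
    (a : nat -> int) :
  inv_pos L -> bdd r -> equi R a -> 0 < e -> corr L r 0 <= 2 ->
  (forall phi, exists m,
    ev (fun k => charcos phi k * corr L r k) (ker R Posz (2 ^ m)) <
    e ^+ 2 / 8 * (2 ^ m)%:R ^+ 2) ->
  \forall N \near \oo, forall w : nat -> R, (forall n, `|w n| <= 1) ->
    L (fun t => (\sum_(n < N) w n * r (t - a n)) ^+ 2) <= e * N%:R ^+ 2.
Proof.
move=> mL br ea e0 c1 pw.
have e20 : 0 < e ^+ 2 / 8 by rewrite divr_gt0// exprn_gt0.
have c0 : 0 <= corr L r 0.
  by apply: (mean_ge0 mL) => [|x]; [bdd_tac|rewrite addr0 -expr2 sqr_ge0].
near=> N => w w1.
have : ev (fun k => corr L r k * corr L r k) (ker R a N) <=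
    N%:R ^+ 2 * (2 * (e ^+ 2 / 8) * corr L r 0 + e ^+ 2 / 8 * corr L r 0 ^+ 2).
  by near: N; exact: (ker_sqr_le (posdef_corr mL br)).
rewrite ev_ker => sq.
have -> : L (fun t => (\sum_(n < N) w n * r (t - a n)) ^+ 2) =
    \sum_(i < N) \sum_(j < N) w i * w j * corr L r (a i - a j).
  rewrite (_ : (fun=> _) = fun t => \sum_(i < N) \sum_(j < N)
      (w i * w j) * (r (t - a i) * r (t - a j))); last first.
    apply/funext => t; rewrite expr2 big_distrlr/=; apply: eq_bigr => i _.
    by apply: eq_bigr => j _; ring.
  rewrite mean_sum//; last by move=> i; bdd_tac.
  apply: eq_bigr => i _; rewrite mean_sum//; last by move=> j; bdd_tac.
  apply: eq_bigr => j _; rewrite (meanZ mL); last by bdd_tac.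
  congr (_ * _); rewrite -(mean_shift mL (a i)); last by bdd_tac.
  by rewrite /corr; congr L; apply/funext => t; congr (r _ * r _); ring.
set X := \sum_(i < N) _.
have X2 : X ^+ 2 <= (e * N%:R ^+ 2) ^+ 2.
  apply: (@le_trans _ _ (N%:R * \sum_(i < N) N%:R *
      \sum_(j < N) corr L r (a i - a j) * corr L r (a i - a j))).
    apply: (le_trans (sqr_sum_le _)); rewrite ler_wpM2l//; apply: ler_sum => i _.
    apply: (le_trans (sqr_sum_le _)); rewrite ler_wpM2l//; apply: ler_sum => j _.
    rewrite exprMn -expr2 ler_piMl ?sqr_ge0// -(real_normK (num_real _)).
    by rewrite exprn_ile1// normrM mulr_ile1.
  rewrite -mulr_sumr mulrA -expr2.
  apply: (@le_trans _ _ (N%:R ^+ 2 * (N%:R ^+ 2 * e ^+ 2))).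
    rewrite ler_wpM2l ?sqr_ge0//; apply: (le_trans sq); rewrite ler_wpM2l ?sqr_ge0//.
    have c2 : corr L r 0 ^+ 2 <= 2 ^+ 2 by rewrite lerXn2r ?nnegrE.
    have h1 : e ^+ 2 / 8 * corr L r 0 ^+ 2 <= e ^+ 2 / 8 * 2 ^+ 2 by rewrite ler_wpM2l// ltW.
    have h2 : e ^+ 2 / 8 * corr L r 0 <= e ^+ 2 / 8 * 2 by rewrite ler_wpM2l// ltW.
    lra.
  by rewrite le_eqVlt; apply/orP; left; apply/eqP; ring.
have E0 : 0 <= e * N%:R ^+ 2 by rewrite mulr_ge0 ?sqr_ge0// ltW.
apply: (le_trans (ler_norm _)); rewrite -(ger0_norm E0) -ler_sqr ?nnegrE//.
by rewrite !real_normK ?num_real.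
Unshelve. all: by end_near.
Qed.

(** * Ergodic means *)

Lemma ultra_ex2 (J : Type) (U : set_system J) (A B : set J) : UltraFilter U ->
  U A -> U B -> exists j, A j /\ B j.
Proof. by move=> UU UA UB; exact: (filter_ex (filterI UA UB)). Qed.

(** The limit along [U], written as a supremum so that it is defined for every [u]; [ulimP]
    justifies it when [u] is bounded on a set of [U]. *)
Definition ulim (R : realType) (J : Type) (U : set_system J) (u : J -> R) : R :=
  sup [set x | U [set j | x <= u j]].

Definition ubdd (R : realType) (J : Type) (U : set_system J) (u : J -> R) :=
  exists M : R, U [set j | `|u j| <= M].

Lemma ulimP (R : realType) (J : Type) (U : set_system J) (u : J -> R) (e : R) :
  UltraFilter U -> ubdd U u -> 0 < e -> U [set j | `|u j - ulim U u| <= e].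
Proof.
move=> UU [M UM] e0; set S := [set x | U [set j | x <= u j]].
have S0 : S !=set0.
  by exists (- M); apply: filterS UM => j /=; rewrite ler_norml => /andP[].
have Sub : ubound S M.
  move=> x Sx; have [j /= []] := ultra_ex2 UU Sx UM.
  by move=> xu; rewrite ler_norml => /andP[_]; exact: le_trans.
have hS : has_sup S by split => //; exists M.
have [x Sx ex] := sup_adherent e0 hS.
have nS : ~ S (ulim U u + e).
  move=> /(ub_le_sup (proj2 hS)); rewrite -/(ulim U u); lra.
have [//|Un] := in_ultra_setVsetC [set j | ulim U u + e <= u j] UU.
apply: filterS (filterI Sx Un) => j /= [h1 /negP]; rewrite -ltNge => h2.
rewrite ler_norml; move: ex; rewrite -/(ulim U u); lra.
Qed.

Lemma ulim_close (R : realType) (J : Type) (U : set_system J) (u : J -> R) (l : R) :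
  UltraFilter U -> (forall e, 0 < e -> U [set j | `|u j - l| <= e]) -> ulim U u = l.
Proof.
move=> UU H.
have bu : ubdd U u.
  exists (`|l| + 1); apply: filterS (H 1 ltr01) => j /= h.
  rewrite -(subrK l (u j)) addrC (le_trans (ler_normD _ _))// lerD2l//.
apply/eqP/negPn/negP => ne; pose e := `|ulim U u - l| / 3.
have e0 : 0 < e by rewrite divr_gt0// normr_gt0 subr_eq0.
have [j /= [h1 h2]] := ultra_ex2 UU (ulimP UU bu e0) (H e e0).
have : `|ulim U u - l| <= e + e.
  have -> : ulim U u - l = (u j - l) - (u j - ulim U u) by ring.
  by apply: (le_trans (ler_normB _ _)); rewrite lerD.
rewrite /e in e0 *; lra.
Qed.

Lemma ulim_near (R : realType) (J : Type) (U : set_system J) (u v : J -> R) :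
  UltraFilter U -> ubdd U v ->
  (forall e, 0 < e -> U [set j | `|u j - v j| <= e]) -> ulim U u = ulim U v.
Proof.
move=> UU bv H; apply: ulim_close => e e0.
have e20 : 0 < e / 2 by rewrite divr_gt0.
apply: filterS (filterI (H _ e20) (ulimP UU bv e20)) => j /= [h1 h2].
have -> : u j - ulim U v = (u j - v j) + (v j - ulim U v) by ring.
by apply: (le_trans (ler_normD _ _)); rewrite (splitr e) lerD.
Qed.

Lemma ulim_cst (R : realType) (J : Type) (U : set_system J) (u : J -> R) (c : R) :
  UltraFilter U -> U [set j | u j = c] -> ulim U u = c.
Proof.
move=> UU H; apply: ulim_close => e e0; apply: filterS H => j /= ->.
by rewrite subrr normr0 ltW.
Qed.

Lemma ulimD (R : realType) (J : Type) (U : set_system J) (u v : J -> R) :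
  UltraFilter U -> ubdd U u -> ubdd U v ->
  ulim U (fun j => u j + v j) = ulim U u + ulim U v.
Proof.
move=> UU bu bv; apply: ulim_close => e e0.
have e20 : 0 < e / 2 by rewrite divr_gt0.
apply: filterS (filterI (ulimP UU bu e20) (ulimP UU bv e20)) => j /= [h1 h2].
rewrite opprD addrACA.
by apply: (le_trans (ler_normD _ _)); rewrite (splitr e) lerD.
Qed.

Lemma ulimZ (R : realType) (J : Type) (U : set_system J) (c : R) (u : J -> R) :
  UltraFilter U -> ubdd U u -> ulim U (fun j => c * u j) = c * ulim U u.
Proof.
move=> UU bu; apply: ulim_close => e e0.
have c0 : 0 < `|c| + 1 by rewrite ltr_wpDl.
have ec0 : 0 < e / (`|c| + 1) by rewrite divr_gt0.
apply: filterS (ulimP UU bu ec0) => j /= h.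
rewrite -mulrBr normrM; apply: (@le_trans _ _ ((`|c| + 1) * (e / (`|c| + 1)))).
  by rewrite ler_pM// lerDl.
by rewrite mulrCA divff ?mulr1// gt_eqF.
Qed.

Lemma ulim_ge (R : realType) (J : Type) (U : set_system J) (u : J -> R) (c : R) :
  UltraFilter U -> ubdd U u -> U [set j | c <= u j] -> c <= ulim U u.
Proof.
move=> UU bu H; rewrite leNgt; apply/negP => lc.
pose e := (c - ulim U u) / 2.
have e0 : 0 < e by rewrite divr_gt0// subr_gt0.
have [j /= [h1]] := ultra_ex2 UU H (ulimP UU bu e0).
rewrite ler_norml /e; lra.
Qed.

Lemma ulim_le (R : realType) (J : Type) (U : set_system J) (u : J -> R) (c : R) :
  UltraFilter U -> ubdd U u -> U [set j | u j <= c] -> ulim U u <= c.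
Proof.
move=> UU bu H; rewrite leNgt; apply/negP => lc.
pose e := (ulim U u - c) / 2.
have e0 : 0 < e by rewrite divr_gt0// subr_gt0.
have [j /= [h1]] := ultra_ex2 UU H (ulimP UU bu e0).
rewrite ler_norml /e; lra.
Qed.

Lemma ubdd_all (R : realType) (J : Type) (U : set_system J) (u : J -> R) (M : R) :
  Filter U -> (forall j, `|u j| <= M) -> ubdd U u.
Proof. by move=> FU H; exists M; exact: filterE. Qed.

(* The values on unbounded functions are set to 0, to make a mean determined
   by its values on bounded functions. *)
Definition means (R : realType) : set ((int -> R) -> R) :=
  [set L | [/\ inv_pos L, L (fun=> 1) = 1 & forall f, ~ bdd f -> L f = 0]].

Definition midpoint (R : realType) (L1 L2 : (int -> R) -> R) f := (L1 f + L2 f) / 2.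

(** An extreme closed set of means. Closedness is stated by ultralimits, which supply compactness
    with no topology on functionals; extremality is tested on midpoints, as in [ergodic_extreme]. *)
Definition face (R : realType) (F : set ((int -> R) -> R)) :=
  [/\ F `<=` @means R, F !=set0,
      (forall U : set_system ((int -> R) -> R), UltraFilter U -> U F ->
        F (fun f => ulim U (fun L => L f))) &
      forall L1 L2, means L1 -> means L2 -> F (midpoint L1 L2) -> F L1 /\ F L2].

Lemma ubdd_mean (R : realType) (U : set_system ((int -> R) -> R)) f : UltraFilter U ->
  U (@means R) -> bdd f -> ubdd U (fun L => L f).
Proof.
move=> UU UM [M hM]; exists M; apply: filterS UM => L [mL L1 _].
by have := mean_norm_le mL hM; rewrite L1 mulr1.
Qed.

Lemma means_ulim (R : realType) (U : set_system ((int -> R) -> R)) : UltraFilter U ->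
  U (@means R) -> means (fun f => ulim U (fun L => L f)).
Proof.
move=> UU UM; have bU := ubdd_mean UU UM.
split; first split.
- move=> f g bf bg; rewrite -(ulimD UU (bU _ bf) (bU _ bg)).
  apply: (ulim_near UU).
    have [M hM] := bU _ bf; have [N hN] := bU _ bg.
    exists (M + N); apply: filterS (filterI hM hN) => L /= [h1 h2].
    by apply: (le_trans (ler_normD _ _)); rewrite lerD.
  move=> e e0; apply: filterS UM => L [mL _ _] /=.
  by rewrite (meanD mL)// subrr normr0 ltW.
- move=> c f bf; rewrite -(ulimZ c UU (bU _ bf)).
  apply: (ulim_near UU).
    have [M hM] := bU _ bf; exists (`|c| * M).
    by apply: filterS hM => L /= h; rewrite normrM ler_wpM2l.
  move=> e e0; apply: filterS UM => L [mL _ _] /=.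
  by rewrite (meanZ mL)// subrr normr0 ltW.
- move=> f bf f0; apply: (ulim_ge UU); first exact: bU.
  by apply: filterS UM => L [mL _ _] /=; exact: mean_ge0.
- move=> f k bf; apply: (ulim_near UU); first exact: bU.
  move=> e e0; apply: filterS UM => L [mL _ _] /=.
  by rewrite (mean_shift mL)// subrr normr0 ltW.
- by apply: ulim_cst; apply: filterS UM => L [].
- by move=> f nbf; apply: ulim_cst; apply: filterS UM => L [_ _]; exact.
Qed.

Lemma face_means (R : realType) : @means R !=set0 -> face (@means R).
Proof. by move=> K0; split => // U UU; exact: means_ulim. Qed.

Lemma face_max (R : realType) (F : set ((int -> R) -> R)) (g : int -> R) :
  face F -> bdd g -> exists s : R, (forall L, F L -> L g <= s) /\
    face [set L | F L /\ L g = s].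
Proof.
move=> [FK [L0 FL0] Fcl Fext] [M hM].
have bg : bdd g by exists M.
have FM L : F L -> `|L g| <= M.
  by move=> /FK[mL L1 _]; have := mean_norm_le mL hM; rewrite L1 mulr1.
pose V := [set L g | L in F].
have hV : has_sup V.
  split; first by exists (L0 g), L0.
  by exists M => _ [L FL <-]; apply: le_trans (FM _ FL); exact: ler_norm.
pose s := sup V.
have Fs L : F L -> L g <= s by move=> FL; apply: (ub_le_sup (proj2 hV)); exists L.
exists s; split => //; split.
- by move=> L [/FK].
(* The supremum is attained at an ultralimit along the sets of near-maximisers. *)
- pose base (e : R) := [set L | F L /\ s - e < L g].
  have pf : ProperFilter (filter_from [set e : R | 0 < e] base).
    apply: filter_from_proper; last first.
      move=> e /= e0; have [_ [L FL <-] h] := sup_adherent e0 hV.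
      by exists L.
    apply: filter_from_filter; first by exists 1 => /=.
    move=> e e' /= e0 e'0; exists (Num.min e e') => /=; first by rewrite lt_min e0.
    move=> L [FL h]; have h1 : Num.min e e' <= e by rewrite ge_min lexx.
    have h2 : Num.min e e' <= e' by rewrite ge_min lexx orbT.
    split; split => //; move: h; lra.
  have [U [UU sU]] := ultraFilterLemma pf.
  have UF : U F by apply: sU; exists 1 => //= L [].
  exists (fun f => ulim U (fun L => L f)); split; first exact: Fcl.
  apply: ulim_close => e e0; have : U (base e) by apply: sU; exists e.
  by apply: filterS => L [FL h] /=; rewrite ler_norml; have := Fs _ FL; lra.
- move=> U UU UF; split.
    by apply: Fcl; apply: filterS UF => L [].
  by apply: ulim_cst; apply: filterS UF => L [].
- move=> L1 L2 m1 m2 [Fm me].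
  have [F1 F2] := Fext _ _ m1 m2 Fm.
  have := Fs _ F1; have := Fs _ F2; move: me; rewrite /midpoint => me h1 h2.
  by do 2 split => //; lra.
Qed.

(** Extremality in order form: an invariant positive functional below [L] is a multiple of [L]. For
    invariant probability measures this is ergodicity. *)
Definition ergodic (R : realType) (L : (int -> R) -> R) :=
  [/\ inv_pos L, L (fun=> 1) = 1 &
    forall T, inv_pos T -> (forall h, bdd h -> (forall x, 0 <= h x) -> T h <= L h) ->
      forall h, bdd h -> T h = T (fun=> 1) * L h].

Lemma ergodic_extreme (R : realType) (L : (int -> R) -> R) : means L ->
  (forall L1 L2, means L1 -> means L2 -> L = midpoint L1 L2 -> L1 = L2) -> ergodic L.
Proof.
move=> [mL L1 Lu] ext; split => // T mT TL.
pose c := T (fun=> 1).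
have c0 : 0 <= c by apply: (mean_ge0 mT); [exact: bdd_cst|move=> x; exact: ler01].
have c1 : c <= 1 by rewrite -L1; apply: TL; [exact: bdd_cst|move=> x; exact: ler01].
(* The functionals L + (T - c L) / 2 and L - (T - c L) / 2 have midpoint [L]; they are positive
   because 0 <= T <= L and 0 <= c <= 1. If they agree, then T = c L. *)
pose P (s : R) f := if `[< bdd f >] then L f + s * (T f - c * L f) else 0.
have PE s f : bdd f -> P s f = L f + s * (T f - c * L f).
  by move=> bf; rewrite /P; case: asboolP.
have meansP s : s = 2^-1 \/ s = - 2^-1 -> means (P s).
  move=> s2; split; first split.
  - move=> f g bf bg; rewrite !PE//; last exact: bddD.
    by rewrite (meanD mL)// (meanD mT)//; ring.
  - move=> a f bf; rewrite !PE//; last by bdd_tac.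
    by rewrite (meanZ mL)// (meanZ mT)//; ring.
  - move=> f bf f0; rewrite PE//.
    have l0 := mean_ge0 mL bf f0; have t0 := mean_ge0 mT bf f0; have tl := TL _ bf f0.
    have cl : c * L f <= L f by rewrite ler_piMl.
    have cl0 : 0 <= c * L f by rewrite mulr_ge0.
    by case: s2 => ->; lra.
  - move=> f k bf; rewrite !PE//; last exact: bdd_comp.
    by rewrite (mean_shift mL)// (mean_shift mT).
  - by rewrite PE; [rewrite L1 -/c; ring|exact: bdd_cst].
  - by move=> f nbf; rewrite /P; case: asboolP.
have E : P 2^-1 = P (- 2^-1).
  apply: ext; [by apply: meansP; left|by apply: meansP; right|].
  apply/funext => f; rewrite /midpoint; have [bf|nbf] := pselect (bdd f).
    by rewrite !PE//; field.
  by rewrite /P; case: asboolP => // _; rewrite Lu// addr0 mul0r.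
move=> h bh; have := congr1 (fun Q => Q h) E; rewrite /= !PE// -/c; lra.
Qed.

(** The Krein-Milman argument, started inside the face where [f] has its largest mean, so that the
    extreme point found there has at least the mean of [L0]. *)
Lemma exists_ergodic (R : realType) (L0 : (int -> R) -> R) (f : int -> R) :
  means L0 -> bdd f -> exists2 L, ergodic L & L0 f <= L f.
Proof.
move=> m0 bf.
have [s [Fs fF]] := face_max (face_means (ex_intro _ L0 m0)) bf.
set F0 := [set L | _] in fF.
(* [Zorn_bigcup] gives maximal sets, so a minimal face is sought through the set removed from
   [F0]. *)
pose P (A : set ((int -> R) -> R)) := face (F0 `\` A).
have [A [PA maxA]] : exists A, P A /\ forall B, A `<` B -> ~ P B.
  apply: Zorn_bigcup => C CP Ctot; rewrite /P.
  (* The empty set is added so that the intersection below runs over a nonempty family even for the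
     empty chain. *)
  set D := [set A | C A \/ A = set0].
  have DP A : D A -> P A by move=> [/CP//|->]; rewrite /P setD0.
  have D0 : D set0 by right.
  have IE : F0 `\` \bigcup_(X in C) X = \bigcap_(A in D) (F0 `\` A).
    apply/seteqP; split => L.
      by move=> [FL nL] A [CA|->]; split => // AL; apply: nL; exists A.
    move=> H; split; first by have [] := H _ D0.
    by move=> [A CA AL]; have [] := H A (or_introl CA).
  have cl (U : set_system ((int -> R) -> R)) : UltraFilter U ->
      U (\bigcap_(A in D) (F0 `\` A)) ->
      (\bigcap_(A in D) (F0 `\` A)) (fun f => ulim U (fun L => L f)).
    move=> UU UI A DA; have [_ _ cl _] := DP _ DA.
    by apply: cl; apply: filterS UI => L; exact.
  rewrite IE; split.
  - by move=> L /(_ _ D0); rewrite setD0 => -[[]].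
  - have pf : ProperFilter (filter_from D (fun A => F0 `\` A)).
      apply: filter_from_proper; last by move=> A /DP[].
      apply: filter_from_filter; first by exists set0.
      have tot A B : D A -> D B -> A `<=` B \/ B `<=` A.
        move=> [CA|->]; last by left; exact: sub0set.
        move=> [CB|->]; last by right; exact: sub0set.
        exact: Ctot.
      move=> A B DA DB; have [AB|BA] := tot _ _ DA DB.
        by exists B => // L [FL nB]; split; split => // /AB.
      by exists A => // L [FL nB]; split; split => // /BA.
    have [U [UU sU]] := ultraFilterLemma pf.
    exists (fun f => ulim U (fun L => L f)) => A DA.
    by have [_ _ + _] := DP _ DA; apply; apply: sU; exists A.
  - exact: cl.
  - move=> L1 L2 m1 m2 H; split=> A DA; have [_ _ _ ext] := DP _ DA;
      by have [] := ext _ _ m1 m2 (H A DA).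
have [FK [L FL] _ Fext] := PA.
(* A minimal face is a point: if some g separated two of its members, [face_max] would give a
   strictly smaller face, whose complement properly contains [A]. *)
have uniq L1 L2 : (F0 `\` A) L1 -> (F0 `\` A) L2 -> forall g, bdd g -> L1 g <= L2 g.
  move=> F1 F2 g bg; rewrite leNgt; apply/negP => lt12.
  have [s' [Fs' fF']] := face_max PA bg.
  set F' := [set L | _] in fF'.
  apply: (maxA (~` F')); last first.
    rewrite /P (_ : F0 `\` ~` F' = F')//; apply/seteqP; split => x.
      by move=> [_ /contrapT].
    by move=> F'x; split; [by case: F'x => -[]|exact].
  split=> [x Ax [[_ nAx] _]//|sub].
  have [_ nA2] := F2; apply: nA2; apply: sub => -[_ e2].
  by have := Fs' _ F1; rewrite -e2 leNgt lt12.
have eqF L1 L2 : (F0 `\` A) L1 -> (F0 `\` A) L2 -> L1 = L2.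
  move=> F1 F2; apply/funext => g; have [bg|nbg] := pselect (bdd g).
    by apply/eqP; rewrite eq_le !uniq.
  by have [_ _ ->//] := FK _ F1; have [_ _ ->] := FK _ F2.
exists L; last by have [[_ ->] _] := FL; exact: Fs.
apply: ergodic_extreme; first exact: FK.
move=> L1 L2 m1 m2 e; have [F1 F2] := Fext _ _ m1 m2 (eq_ind _ (F0 `\` A) FL _ e).
exact: eqF.
Qed.

(** * Fejer averages under an ergodic mean *)

(** The shifts i - j are those of [ker R Posz H], so the mean of u times its Fejer average is the
    normalised value of that kernel at the correlations of u. *)
Definition fejer_avg (R : realType) (H : nat) (u : int -> R) (x : int) : R :=
  (H%:R ^+ 2)^-1 * \sum_(i < H) \sum_(j < H) u (x + (i%:Z - j%:Z)).

Lemma bdd_fejer_avg (R : realType) (H : nat) (u : int -> R) : bdd u -> bdd (fejer_avg H u).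
Proof. by move=> bu; rewrite /fejer_avg; bdd_tac. Qed.

Lemma fejer_avg_cst (R : realType) (H : nat) (c : R) x : (0 < H)%N ->
  fejer_avg H (fun=> c) x = c.
Proof.
move=> H0; rewrite /fejer_avg !sum_const_ord mulrA -expr2 mulKf//.
by rewrite expf_eq0/= pnatr_eq0 -lt0n.
Qed.

Lemma fejer_avg_le (R : realType) (H : nat) (u v : int -> R) x :
  (forall y, u y <= v y) -> fejer_avg H u x <= fejer_avg H v x.
Proof.
move=> uv; rewrite ler_wpM2l ?invr_ge0 ?sqr_ge0//.
by apply: ler_sum => i _; apply: ler_sum => j _.
Qed.

Lemma fejer_avgD (R : realType) (H : nat) (u v : int -> R) x :
  fejer_avg H (fun y => u y + v y) x = fejer_avg H u x + fejer_avg H v x.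
Proof.
rewrite /fejer_avg -mulrDr -big_split/=; congr (_ * _); apply: eq_bigr => i _.
by rewrite -big_split.
Qed.

Lemma fejer_avgZ (R : realType) (H : nat) (c : R) (u : int -> R) x :
  fejer_avg H (fun y => c * u y) x = c * fejer_avg H u x.
Proof.
rewrite /fejer_avg mulrCA; congr (_ * _); rewrite mulr_sumr; apply: eq_bigr => i _.
by rewrite mulr_sumr.
Qed.

Lemma mean_fejer_avg (R : realType) (L : (int -> R) -> R) (H : nat) (u : int -> R) :
  inv_pos L -> bdd u -> (0 < H)%N -> L (fejer_avg H u) = L u.
Proof.
move=> mL bu H0; rewrite (meanZ mL); last by bdd_tac.
rewrite mean_sum//; last by move=> i; bdd_tac.
rewrite -[RHS](fejer_avg_cst (L u) 0 H0); congr (_ * _); apply: eq_bigr => i _.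
rewrite mean_sum//; last by move=> j; bdd_tac.
by apply: eq_bigr => j _; rewrite (mean_shift mL).
Qed.

Lemma fejer_avg_shift (R : realType) (H : nat) (u : int -> R) (C : R) (x k : int) :
  (0 < H)%N -> (forall y, `|u y| <= C) ->
  `|fejer_avg H u (x + k) - fejer_avg H u x| <= 2 * `|k|%:~R * C / H%:R.
Proof.
move=> H0 uC; have h0 : 0 < H%:R :> R by rewrite ltr0n.
wlog [n ->] : x k / exists n : nat, k = n%:Z.
  move=> hw; case: k => n; first by apply: hw; exists n.
  have := hw (x - n.+1%:Z) n.+1%:Z (ex_intro _ _ erefl).
  by rewrite subrK distrC NegzE normrN.
rewrite /fejer_avg -mulrBr normrM ger0_norm ?invr_ge0 ?sqr_ge0//.
rewrite exchange_big/= [X in _ - X]exchange_big/= -sumrB.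
rewrite ler_pdivrMl ?exprn_gt0//.
apply: (@le_trans _ _ (\sum_(j < H) 2 * n%:R * C)).
  apply: (le_trans (ler_norm_sum _ _ _)); apply: ler_sum => j _.
  have := @sum_shift_le R (fun i => u (x + (i%:Z - j%:Z))) C H n (fun=> uC _).
  rewrite (_ : \sum_(i < H) _ = \sum_(i < H) u (x + n%:Z + (i%:Z - j%:Z)))//.
  by apply: eq_bigr => i _; congr u; rewrite PoszD; ring.
rewrite sum_const_ord -abszE /= -pmulrn le_eqVlt; apply/orP; left; apply/eqP.
by field; rewrite gt_eqF.
Qed.

(* As a functional of h, the left-hand side is invariant and dominated by L. *)
Lemma ergodic_average01 (R : realType) (L : (int -> R) -> R) (U : set_system nat)
    (u h : int -> R) : ergodic L -> UltraFilter U -> \oo `<=` U ->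
  (forall x, 0 <= u x <= 1) -> bdd h ->
  ulim U (fun m => L (fun x => h x * fejer_avg (2 ^ m) u x)) = L u * L h.
Proof.
move=> [mL L1 ext] UU ooU u01 bh.
have bu : bdd u by exists 1 => x; have /andP[h1 h2] := u01 x; rewrite ger0_norm.
have H0 m : (0 < 2 ^ m)%N by rewrite expn_gt0.
have A01 m x : 0 <= fejer_avg (2 ^ m) u x <= 1.
  rewrite -[X in X <= _](fejer_avg_cst 0 x (H0 m)) -[X in _ <= _ <= X](fejer_avg_cst 1 x (H0 m)).
  by apply/andP; split; apply: fejer_avg_le => y; have /andP[] := u01 y.
have bA m : bdd (fejer_avg (2 ^ m) u) by exact: bdd_fejer_avg.
pose T h := ulim U (fun m => L (fun x => h x * fejer_avg (2 ^ m) u x)).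
have bT g : bdd g -> ubdd U (fun m => L (fun x => g x * fejer_avg (2 ^ m) u x)).
  move=> [M hM]; apply: (@ubdd_all _ _ _ _ M) => m.
  rewrite -[M]mulr1 -L1; apply: mean_norm_le => // x.
  rewrite normrM; have /andP[a0 a1] := A01 m x.
  by rewrite (ger0_norm a0) (le_trans _ (hM x))// ler_piMr.
have T1 : T (fun=> 1) = L u.
  apply: ulim_cst; apply: filterE => m /=; rewrite -[RHS](mean_fejer_avg mL bu (H0 m)).
  by congr L; apply/funext => x; rewrite mul1r.
suff mT : inv_pos T.
  rewrite -T1; apply: ext => // g bg g0; apply: (ulim_le UU); first exact: bT.
  apply: filterE => m /=; apply: mean_le => //; first by bdd_tac.
  by move=> x; have /andP[a0 a1] := A01 m x; rewrite ler_piMr.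
split.
- move=> f g bf bg; rewrite /T -(ulimD UU (bT _ bf) (bT _ bg)); congr ulim.
  apply/funext => m; rewrite -(meanD mL); [|by bdd_tac|by bdd_tac].
  by congr L; apply/funext => x; rewrite mulrDl.
- move=> c f bf; rewrite /T -(ulimZ c UU (bT _ bf)); congr ulim.
  apply/funext => m; rewrite -(meanZ mL); last by bdd_tac.
  by congr L; apply/funext => x; rewrite mulrA.
- move=> f bf f0; apply: (ulim_ge UU); first exact: bT.
  apply: filterE => m /=; apply: (mean_ge0 mL); first by bdd_tac.
  by move=> x; have /andP[a0 a1] := A01 m x; rewrite mulr_ge0.
- move=> f k bf; apply: (ulim_near UU); first exact: bT.
  move=> e e0; have [M hM] := bf.
  have M0 : 0 <= M := le_trans (normr_ge0 _) (hM 0).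
  apply: ooU; near=> m => /=.
  have m0 : 0 < (2 ^ m)%:R :> R by rewrite ltr0n.
  have big : M * (2 * `|- k|%:~R * 1) / e <= (2 ^ m)%:R.
    apply: (@le_trans _ _ m%:R); first by near: m; exact: nbhs_infty_ger.
    by rewrite ler_nat ltnW// ltn_expl.
  rewrite -(mean_shift mL (- k)); last by bdd_tac.
  rewrite -meanB//; [|by bdd_tac|by bdd_tac].
  rewrite -[e]mulr1 -L1; apply: mean_norm_le => // x.
  rewrite subrK -mulrBr normrM.
  have sh := @fejer_avg_shift R (2 ^ m) u 1 x (- k) (H0 m).
  apply: (@le_trans _ _ (M * (2 * `|- k|%:~R * 1 / (2 ^ m)%:R))).
    apply: ler_pM => //; apply: sh => y.
    by have /andP[a b] := u01 y; rewrite ger0_norm.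
  by rewrite mulrA ler_pdivrMr// [leRHS]mulrC -ler_pdivrMr.
Unshelve. all: by end_near.
Qed.

(** A weak mean ergodic theorem. Both sides are affine in [u], so [u] is rescaled into [0, 1]. *)
Lemma ergodic_average (R : realType) (L : (int -> R) -> R) (U : set_system nat)
    (u h : int -> R) : ergodic L -> UltraFilter U -> \oo `<=` U -> bdd u -> bdd h ->
  ulim U (fun m => L (fun x => h x * fejer_avg (2 ^ m) u x)) = L u * L h.
Proof.
move=> eL UU ooU [M hM] bh; have [mL L1 _] := eL.
have bu : bdd u by exists M.
pose N := M + 1; have N0 : 0 < N by rewrite /N ltr_wpDl// (le_trans _ (hM 0)).
pose v x := (u x + N) / (2 * N).
have v01 x : 0 <= v x <= 1.
  have := hM x; rewrite ler_norml => /andP[h1 h2].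
  rewrite /v divr_ge0 ?ler_pdivrMr//= ?mulr_gt0// ?mulr_ge0// ?(ltW N0)//; rewrite /N; lra.
have H0 m : (0 < 2 ^ m)%N by rewrite expn_gt0.
have vE : u = fun x => 2 * N * v x + - N.
  by apply/funext => x; rewrite /v; field; rewrite gt_eqF.
have bv : bdd v by exists 1 => x; have /andP[h1 h2] := v01 x; rewrite ger0_norm.
have main := ergodic_average01 eL UU ooU v01 bh.
have E m : L (fun x => h x * fejer_avg (2 ^ m) u x) =
    2 * N * L (fun x => h x * fejer_avg (2 ^ m) v x) + - N * L h.
  have bA : bdd (fejer_avg (2 ^ m) v) by exact: bdd_fejer_avg.
  rewrite -!(meanZ mL)//; last by bdd_tac.
  rewrite -(meanD mL); [|by bdd_tac|by bdd_tac].
  congr L; apply/funext => x; rewrite {1}vE fejer_avgD fejer_avgZ fejer_avg_cst//.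
  ring.
have bseq : ubdd U (fun m => L (fun x => h x * fejer_avg (2 ^ m) v x)).
  have [C hC] := bh; apply: (@ubdd_all _ _ _ _ C) => m.
  rewrite -[C]mulr1 -L1; apply: mean_norm_le => // x; rewrite normrM.
  have /andP[a0 a1] : 0 <= fejer_avg (2 ^ m) v x <= 1.
    rewrite -[X in X <= _](fejer_avg_cst 0 x (H0 m)) -[X in _ <= _ <= X](fejer_avg_cst 1 x (H0 m)).
    by apply/andP; split; apply: fejer_avg_le => y; have /andP[] := v01 y.
  by rewrite (ger0_norm a0) (le_trans _ (hC x))// ler_piMr.
rewrite (_ : (fun m => _) = fun m =>
    2 * N * L (fun x => h x * fejer_avg (2 ^ m) v x) + - N * L h); last first.
  by apply/funext => m; exact: E.
have bc (c : R) : ubdd U (fun=> c) by apply: (@ubdd_all _ _ _ _ `|c|).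
rewrite (ulimD UU); [|have [C hC] := bseq; exists (`|2 * N| * C)|exact: bc]; last first.
  by apply: filterS hC => m /= hm; rewrite normrM ler_wpM2l.
rewrite (ulimZ _ UU bseq) main (_ : ulim U (fun=> _) = - N * L h); last first.
  by apply: ulim_cst; exact: filterE.
have -> : L u = 2 * N * L v + - N.
  rewrite {1}vE (meanD mL); [|by bdd_tac|by bdd_tac].
  by rewrite (meanZ mL)// mean_cst// L1 mulr1.
ring.
Qed.

Lemma oo_ultra : exists2 U : set_system nat, UltraFilter U & \oo `<=` U.
Proof. by have [U [UU sU]] := @ultraFilterLemma nat \oo _; exists U. Qed.

(** The twisted correlations of r are the correlations of r cos (phi x) plus those of r sin (phi x).
    By ergodicity their Fejer averages tend to squared means, each at most d^2; with an error d^2 /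
    2 for each, the total is at most 3 d^2 < 4 d^2. *)
Lemma ergodic_spectrum (R : realType) (L : (int -> R) -> R) (r : int -> R) (d phi : R) :
  ergodic L -> bdd r -> 0 < d ->
  (forall psi, `|L (fun x => r x * cos (phi * x%:~R + psi))| <= d) ->
  exists m, ev (fun k => charcos phi k * corr L r k) (ker R Posz (2 ^ m)) <
    4 * d ^+ 2 * (2 ^ m)%:R ^+ 2.
Proof.
move=> eL br d0 small; have [mL L1 _] := eL.
have [U UU ooU] := oo_ultra.
pose u x := r x * cos (phi * x%:~R); pose v x := r x * sin (phi * x%:~R).
have bu : bdd u by rewrite /u; bdd_tac.
have bv : bdd v by rewrite /v; bdd_tac.
have e0 : 0 < d ^+ 2 / 2 by rewrite divr_gt0// exprn_gt0.
have lim w : bdd w -> U [set m |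
    `|L (fun x => w x * fejer_avg (2 ^ m) w x) - L w * L w| <= d ^+ 2 / 2].
  move=> bw; rewrite -(ergodic_average eL UU ooU bw bw).
  apply: (ulimP UU _ e0); have [C hC] := bw; apply: (@ubdd_all _ _ _ _ (C * C)) => m.
  have H0 : (0 < 2 ^ m)%N by rewrite expn_gt0.
  rewrite -[C * C]mulr1 -L1; apply: mean_norm_le => // x; rewrite normrM ler_pM//.
  rewrite ler_norml -[X in X <= _](fejer_avg_cst (- C) x H0).
  rewrite -[X in _ <= _ <= X](fejer_avg_cst C x H0).
  by apply/andP; split; apply: fejer_avg_le => y; have := hC y; rewrite ler_norml => /andP[].
have [m /= [mu mv]] := ultra_ex2 UU (lim _ bu) (lim _ bv).
have h0 : 0 < (2 ^ m)%:R ^+ 2 :> R by rewrite exprn_gt0// ltr0n expn_gt0.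
exists m; rewrite ev_ker.
have corrE k : charcos phi k * corr L r k = corr L u k + corr L v k.
  rewrite -(meanD mL); [|by bdd_tac|by bdd_tac].
  rewrite -(meanZ mL); last by bdd_tac.
  congr L; apply/funext => x; rewrite /u /v /charcos.
  have -> : cos (phi * k%:~R) = cos (phi * (x + k)%:~R - phi * x%:~R).
    by congr cos; rewrite intrD; ring.
  by rewrite cosB; ring.
have avgE w : bdd w -> \sum_(i < 2 ^ m) \sum_(j < 2 ^ m) corr L w (i%:Z - j%:Z) =
    (2 ^ m)%:R ^+ 2 * L (fun x => w x * fejer_avg (2 ^ m) w x).
  move=> bw; rewrite /fejer_avg.
  rewrite (_ : (fun x => _) = fun x => ((2 ^ m)%:R ^+ 2)^-1 *
      \sum_(i < 2 ^ m) \sum_(j < 2 ^ m) w x * w (x + (i%:Z - j%:Z))); last first.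
    apply/funext => x; rewrite mulrCA; congr (_ * _); rewrite mulr_sumr.
    by apply: eq_bigr => i _; rewrite mulr_sumr.
  rewrite (meanZ mL); last by bdd_tac.
  rewrite mulVKf ?gt_eqF// mean_sum//; last by move=> i; bdd_tac.
  by apply: eq_bigr => i _; rewrite mean_sum//; move=> j; bdd_tac.
under eq_bigr do under eq_bigr do rewrite corrE.
under eq_bigr do rewrite big_split/=.
rewrite big_split/= !avgE// -mulrDr mulrC ltr_pM2r//.
have sq w : `|L w| <= d -> L w * L w <= d ^+ 2.
  by move=> h; rewrite -expr2 -(real_normK (num_real (L w))) lerXn2r// nnegrE// ltW.
have Lu : `|L u| <= d.
  by have := small 0; rewrite (_ : (fun x => _) = u)//; apply/funext => x; rewrite addr0.
have Lv : `|L v| <= d.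
  have := small (- (pi / 2)); rewrite (_ : (fun x => _) = v)//.
  by apply/funext => x; rewrite cosBpihalf.
have d20 : 0 < d ^+ 2 by rewrite exprn_gt0.
have := sq _ Lu; have := sq _ Lv; move: mu mv; rewrite !ler_norml; lra.
Qed.

(** * Trigonometric approximation *)

(** Invariance under the shift by 1 makes the means of the cosine and the sine a vector fixed by the
    rotation by th, and for 0 < th <= pi only 0 is fixed. *)
Lemma mean_cos0 (R : realType) (L : (int -> R) -> R) (th phi : R) : inv_pos L ->
  0 < th <= pi -> L (fun x => cos (th * x%:~R + phi)) = 0.
Proof.
move=> mL /andP[t0 tpi].
pose A := L (fun x => cos (th * x%:~R)); pose B := L (fun x => sin (th * x%:~R)).
have E psi : L (fun x => cos (th * x%:~R + psi)) = cos psi * A - sin psi * B.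
  rewrite -!(meanZ mL); [|by bdd_tac|by bdd_tac].
  rewrite -meanB//; [|by bdd_tac|by bdd_tac].
  by congr L; apply/funext => x; rewrite cosD; ring.
have eA : A = cos th * A - sin th * B.
  rewrite -E /A -[LHS](mean_shift mL 1); last by bdd_tac.
  by congr L; apply/funext => x; rewrite intrD mulrDr mulr1.
have eB : B = sin th * A + cos th * B.
  rewrite /A /B -!(meanZ mL); [|by bdd_tac|by bdd_tac].
  rewrite -(meanD mL); [|by bdd_tac|by bdd_tac].
  rewrite -[LHS](mean_shift mL 1); last by bdd_tac.
  by congr L; apply/funext => x; rewrite intrD mulrDr mulr1 sinD; ring.
have c1 : 0 < 1 - cos th.
  have : 0 < sin (th / 2) by apply: sin_gt0_pi; lra.
  have := cos2Dsin2 (th / 2); rewrite [X in 1 - cos X](splitr th) cosD => h s0.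
  have : 0 < sin (th / 2) ^+ 2 by rewrite exprn_gt0.
  move: h; rewrite -!expr2; lra.
have AB : (2 * (1 - cos th)) * A = 0 /\ (2 * (1 - cos th)) * B = 0.
  have cs := cos2Dsin2 th.
  have -> : 2 * (1 - cos th) = (1 - cos th) ^+ 2 + sin th ^+ 2.
    lra.
  split.
    transitivity ((1 - cos th) * (A - (cos th * A - sin th * B)) -
      sin th * (B - (sin th * A + cos th * B))); first by ring.
    by rewrite -eA -eB; ring.
  transitivity (sin th * (A - (cos th * A - sin th * B)) +
      (1 - cos th) * (B - (sin th * A + cos th * B))); first by ring.
  by rewrite -eA -eB; ring.
rewrite E; case: AB => /eqP; rewrite mulf_eq0 => /orP[|/eqP ->]; first by move/eqP; lra.
move=> /eqP; rewrite mulf_eq0 => /orP[|/eqP ->]; first by move/eqP; lra.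
by rewrite !mulr0 subrr.
Qed.

(** Entries are ((coefficient, frequency), phase). The phase covers sines, and concatenation of
    lists is addition. *)
Definition trig (R : realType) (s : seq (R * R * R)) (x : int) : R :=
  \sum_(p <- s) p.1.1 * cos (p.1.2 * x%:~R + p.2).

Lemma bdd_trig (R : realType) (s : seq (R * R * R)) : bdd (trig s).
Proof. by rewrite /trig; bdd_tac. Qed.

Lemma trig_cat (R : realType) (s t : seq (R * R * R)) x : trig (s ++ t) x = trig s x + trig t x.
Proof. by rewrite /trig big_cat. Qed.

Lemma trig_cons (R : realType) p (s : seq (R * R * R)) x :
  trig (p :: s) x = p.1.1 * cos (p.1.2 * x%:~R + p.2) + trig s x.
Proof. by rewrite /trig big_cons. Qed.

Lemma trig_scale (R : realType) (c : R) (s : seq (R * R * R)) x :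
  trig [seq (c * p.1.1, p.1.2, p.2) | p <- s] x = c * trig s x.
Proof. by rewrite /trig big_map mulr_sumr; apply: eq_bigr => p _; rewrite mulrA. Qed.

Lemma trig_mul (R : realType) (s t : seq (R * R * R)) : exists u, forall x,
  trig u x = trig s x * trig t x.
Proof.
elim: s => [|[[c a] b] s [u IH]]; first by exists [::] => x; rewrite /trig !big_nil mul0r.
exists ([seq (c * p.1.1 / 2, a + p.1.2, b + p.2) | p <- t] ++
        [seq (c * p.1.1 / 2, a - p.1.2, b - p.2) | p <- t] ++ u) => x.
rewrite !trig_cat IH trig_cons mulrDl addrA; congr (_ + _).
rewrite /trig !big_map -big_split/= mulr_sumr; apply: eq_bigr => p _.
have -> : (a + p.1.2) * x%:~R + (b + p.2) = (a * x%:~R + b) + (p.1.2 * x%:~R + p.2) by ring.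
have -> : (a - p.1.2) * x%:~R + (b - p.2) = (a * x%:~R + b) - (p.1.2 * x%:~R + p.2) by ring.
by rewrite cosD cosB; field.
Qed.

(** A term of frequency 0 modulo 2 pi is constant, and any other has mean 0 and small sums along
    [a]. Uniformity in t comes from the arbitrary phase in [equi], which absorbs the shift by t. *)
Lemma trig_equi (R : realType) (L : (int -> R) -> R) (a : nat -> int) (s : seq (R * R * R))
    (e : R) : inv_pos L -> L (fun=> 1) = 1 -> equi R a -> 0 < e ->
  \forall N \near \oo, forall t,
    `|\sum_(n < N) trig s (t - a n) - N%:R * L (trig s)| <= e * N%:R.
Proof.
move=> mL L1 ea; elim: s e => [|[[c th] phi] s IH] e e0.
  apply: nearW => N t; rewrite (_ : trig [::] = fun=> 0); last first.
    by apply/funext => x; rewrite /trig big_nil.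
  by rewrite mean0// mulr0 big1// subrr normr0 mulr_ge0// ltW.
have e20 : 0 < e / 2 by rewrite divr_gt0.
have c0 : 0 < `|c| + 1 by rewrite ltr_wpDl.
have ec0 : 0 < e / 2 / (`|c| + 1) by rewrite divr_gt0.
pose g (x : int) := cos (th * x%:~R + phi).
have good : \forall N \near \oo, forall t,
    `|\sum_(n < N) g (t - a n) - N%:R * L g| <= e / 2 / (`|c| + 1) * N%:R.
  have [th' /andP[t0 tpi] [b H]] := cos_red th.
  have gE x : g x = cos (th' * x%:~R + (-1) ^+ b * phi) by exact: H.
  move: t0; rewrite le_eqVlt => /orP[/eqP t0|t0].
    have gc : g = fun=> cos ((-1) ^+ b * phi).
      by apply/funext => x; rewrite gE -t0 mul0r add0r.
    apply: nearW => N t; rewrite gc mean_cst// L1 sum_const_ord mulr1 subrr normr0.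
    by rewrite mulr_ge0// ltW.
  have ea' := ea _ _ t0 ec0.
  near=> N => t.
  have -> : L g = 0.
    rewrite -[RHS](@mean_cos0 R L th' ((-1) ^+ b * phi) mL) ?t0//.
    by congr L; apply/funext.
  rewrite mulr0 subr0.
  under eq_bigr do rewrite gE -cosN.
  have := near ea' N _ th' (- (th' * t%:~R + (-1) ^+ b * phi)).
  rewrite tpi lexx => /(_ _ isT) H'.
  rewrite (_ : \sum_(n < N) _ =
      \sum_(n < N) cos (th' * (a n)%:~R + - (th' * t%:~R + (-1) ^+ b * phi))).
    exact: H'.
  by apply: eq_bigr => n _; congr cos; rewrite intrB; ring.
have IH' := IH _ e20.
near=> N => t.
have -> : L (trig ((c, th, phi) :: s)) = c * L g + L (trig s).
  rewrite -(meanZ mL); last by rewrite /g; bdd_tac.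
  rewrite -(meanD mL); [|by rewrite /g; bdd_tac|exact: bdd_trig].
  by congr L; apply/funext => x; rewrite trig_cons.
have -> : \sum_(n < N) trig ((c, th, phi) :: s) (t - a n) - N%:R * (c * L g + L (trig s)) =
   c * (\sum_(n < N) g (t - a n) - N%:R * L g) +
   (\sum_(n < N) trig s (t - a n) - N%:R * L (trig s)).
  under eq_bigr do rewrite trig_cons/=.
  rewrite big_split/= -mulr_sumr; ring.
apply: (le_trans (ler_normD _ _)); rewrite (splitr e) mulrDl lerD//; last first.
  by move: t; near: N.
have h : `|\sum_(n < N) g (t - a n) - N%:R * L g| <= e / 2 / (`|c| + 1) * N%:R.
  by move: t; near: N.
rewrite normrM.
apply: (@le_trans _ _ ((`|c| + 1) * (e / 2 / (`|c| + 1) * N%:R))).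
  by rewrite ler_pM// lerDl.
by rewrite le_eqVlt; apply/orP; left; apply/eqP; field; rewrite gt_eqF.
Unshelve. all: by end_near.
Qed.

Definition dist2 (R : realType) (L : (int -> R) -> R) (f : int -> R) (s : seq (R * R * R)) : R :=
  L (fun x => (f x - trig s x) ^+ 2).

Definition best (R : realType) (L : (int -> R) -> R) (f : int -> R) : R :=
  inf [set dist2 L f s | s in setT].

Lemma best_le (R : realType) (L : (int -> R) -> R) (f : int -> R) s :
  inv_pos L -> bdd f -> best L f <= dist2 L f s.
Proof.
move=> mL bf; apply: ge_inf; last by exists s.
exists 0 => _ [u _ <-]; apply: (mean_ge0 mL) => [|x]; last exact: sqr_ge0.
by have := @bdd_trig R u => bu; bdd_tac.
Qed.

Lemma best_approx (R : realType) (L : (int -> R) -> R) (f : int -> R) (e : R) :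
  inv_pos L -> bdd f -> 0 < e -> exists s, dist2 L f s <= best L f + e ^+ 2.
Proof.
move=> mL bf e0.
have hi : has_inf [set dist2 L f s | s in setT].
  split; first by exists (dist2 L f [::]), [::].
  exists 0 => _ [u _ <-]; apply: (mean_ge0 mL) => [|x]; last exact: sqr_ge0.
  by have := @bdd_trig R u => bu; bdd_tac.
have e20 : 0 < e ^+ 2 by rewrite exprn_gt0.
by have [_ [s _ <-] h] := inf_adherent e20 hi; exists s; exact: ltW.
Qed.

(* Otherwise subtracting a multiple of the cosine would improve on the best
   approximation. *)
Lemma best_orth (R : realType) (L : (int -> R) -> R) (f : int -> R) (e th phi : R) s :
  inv_pos L -> L (fun=> 1) = 1 -> bdd f -> 0 < e -> dist2 L f s <= best L f + e ^+ 2 ->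
  `|L (fun x => (f x - trig s x) * cos (th * x%:~R + phi))| <= e.
Proof.
move=> mL L1 bf e0 hs; have bs := @bdd_trig R s.
set A := L _.
have step (c : R) : 2 * c * A <= e ^+ 2 + c ^+ 2.
  have := best_le (s ++ [:: (c, th, phi)]) mL bf.
  pose q x : R := cos (th * x%:~R + phi).
  have bq : bdd q by rewrite /q; bdd_tac.
  have -> : dist2 L f (s ++ [:: (c, th, phi)]) = dist2 L f s - 2 * c * A +
      c ^+ 2 * L (fun x => q x ^+ 2).
    rewrite /A /dist2 -(meanZ mL (2 * c)); last by bdd_tac.
    rewrite -(meanZ mL (c ^+ 2)); last by bdd_tac.
    rewrite -meanB//; [|by bdd_tac|by bdd_tac].
    rewrite -(meanD mL); [|by bdd_tac|by bdd_tac].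
    congr L; apply/funext => x; rewrite trig_cat /(trig [:: _]) big_seq1/= /q; ring.
  have q1 : L (fun x => q x ^+ 2) <= 1.
    rewrite -[X in _ <= X]L1; apply: mean_le => //; first by bdd_tac.
      exact: bdd_cst.
    by move=> x; rewrite -(real_normK (num_real _)) exprn_ile1// cos_max.
  have : c ^+ 2 * L (fun x => q x ^+ 2) <= c ^+ 2 * 1 by rewrite ler_wpM2l ?sqr_ge0.
  lra.
rewrite ler_norml; apply/andP; split.
  have := step (- e); rewrite sqrrN => h.
  have : e * (- A) <= e * e by lra.
  by rewrite ler_pM2l// lerNl.
have := step e => h; have : e * A <= e * e by lra.
by rewrite ler_pM2l.
Qed.

(** The parallelogram identity, with half the sum of the two polynomials as a competitor. *)
Lemma best_cauchy (R : realType) (L : (int -> R) -> R) (f : int -> R) (e e' : R) s s' :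
  inv_pos L -> bdd f ->
  dist2 L f s <= best L f + e ^+ 2 -> dist2 L f s' <= best L f + e' ^+ 2 ->
  L (fun x => (trig s x - trig s' x) ^+ 2) <= 2 * (e ^+ 2 + e' ^+ 2).
Proof.
move=> mL bf hs hs'; have bs := @bdd_trig R s; have bs' := @bdd_trig R s'.
pose m := [seq (2^-1 * p.1.1, p.1.2, p.2) | p <- s ++ s'].
have := best_le m mL bf.
have bm := @bdd_trig R m.
have : L (fun x => (trig s x - trig s' x) ^+ 2) =
    2 * dist2 L f s + 2 * dist2 L f s' - 4 * dist2 L f m.
  rewrite /dist2 -!(meanZ mL) ?/m; [|by bdd_tac|by bdd_tac|by bdd_tac].
  rewrite -(meanD mL); [|by bdd_tac|by bdd_tac].
  rewrite -meanB//; [|by bdd_tac|by bdd_tac].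
  by congr L; apply/funext => x; rewrite trig_scale trig_cat; field.
lra.
Qed.

(** The polynomial [s0] depends on kappa only, while a finer [s] is chosen after e. Chebyshev's
    inequality handles f - trig s outside a set of small mean, and replacing [s] by [s0] costs at
    most kappa N / 2 at every t. *)
Lemma trig_approx (R : realType) (L : (int -> R) -> R) (a : nat -> int) (f : int -> R)
    (kappa : R) : ergodic L -> equi R a -> (forall x, 0 <= f x <= 1) -> 0 < kappa ->
  exists s0, `|L (trig s0) - L f| <= kappa /\
    forall e, 0 < e -> \forall N \near \oo, forall w : nat -> R, (forall n, `|w n| <= 1) ->
      L (fun t => (kappa * N%:R <= `|\sum_(n < N) w n * f (t - a n) -
        \sum_(n < N) w n * trig s0 (t - a n)|)%R%:R) <= e.
Proof.
move=> eL ea f01 k0; have [mL L1 _] := eL.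
have bf : bdd f by exists 1 => x; have /andP[h1 h2] := f01 x; rewrite ger0_norm.
(* The average of the squared difference of the two polynomials will be at most 4 e0^2 + e0^2, and 5
   e0^2 <= (kappa / 2)^2. *)
pose e0 := kappa / 5; have e00 : 0 < e0 by rewrite divr_gt0.
have e0E : kappa = 5 * e0 by rewrite /e0; field.
have [s0 hs0] := best_approx mL bf e00.
have bs0 := @bdd_trig R s0.
exists s0; split.
  have := @best_orth R L f e0 0 0 s0 mL L1 bf e00 hs0.
  rewrite (_ : (fun x => _) = fun x => f x - trig s0 x); last first.
    by apply/funext => x; rewrite mul0r addr0 cos0 mulr1.
  by rewrite meanB// distrC => h; apply: (le_trans h); lra.
move=> e epos.
(* Chebyshev at height kappa N / 2 turns a second moment e' N^2 into e. *)
pose e' := e * kappa ^+ 2 / 4.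
have e'0 : 0 < e' by rewrite divr_gt0// mulr_gt0// exprn_gt0.
(* The bound e0 keeps [s] close to [s0], the bound 1 keeps the correlation of [r] at 0 below 2, and
   e' / 6 gives 4 d^2 <= e'^2 / 8. *)
pose d := Num.min (Num.min e0 1) (e' / 6).
have d0 : 0 < d by rewrite !lt_min e00 ltr01 divr_gt0.
have de0 : d <= e0 by rewrite !ge_min lexx.
have d1 : d <= 1 by rewrite !ge_min lexx orbT.
have de' : d <= e' / 6 by rewrite !ge_min lexx orbT.
have [s hs] := best_approx mL bf d0.
have bs := @bdd_trig R s.
pose r x := f x - trig s x.
have br : bdd r by rewrite /r; bdd_tac.
have r2 : corr L r 0 <= 2.
  rewrite /corr (_ : (fun x => _) = fun x => r x ^+ 2); last first.
    by apply/funext => x; rewrite addr0 expr2.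
  apply: (le_trans hs); have -> : (2 : R) = 1 + 1 by [].
  apply: lerD; last by rewrite exprn_ile1// ltW.
  apply: (le_trans (best_le [::] mL bf)).
  have b0 := @bdd_trig R [::]; apply: (mean_le_cst mL L1); first by bdd_tac.
  move=> x; rewrite /trig big_nil subr0; have /andP[h1 h2] := f01 x.
  by rewrite exprn_ile1.
have spec phi : exists m, ev (fun k => charcos phi k * corr L r k) (ker R Posz (2 ^ m)) <
    e' ^+ 2 / 8 * (2 ^ m)%:R ^+ 2.
  have [m hm] := @ergodic_spectrum R L r d phi eL br d0
    (fun psi => best_orth phi psi mL L1 bf d0 hs).
  exists m; apply: (lt_le_trans hm); rewrite ler_wpM2r ?sqr_ge0//.
  have : d ^+ 2 <= (e' / 6) ^+ 2 by rewrite lerXn2r ?nnegrE ?(ltW d0)// divr_ge0// ltW.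
  rewrite expr_div_n; have := sqr_ge0 e'; lra.
have [u hu] := trig_mul (s ++ [seq (- 1 * p.1.1, p.1.2, p.2) | p <- s0])
    (s ++ [seq (- 1 * p.1.1, p.1.2, p.2) | p <- s0]).
have uE x : trig u x = (trig s x - trig s0 x) ^+ 2.
  by rewrite hu trig_cat trig_scale mulN1r expr2.
have Lu : L (trig u) <= 4 * e0 ^+ 2.
  rewrite (_ : trig u = fun x => (trig s x - trig s0 x) ^+ 2); last exact/funext.
  have d2 : d ^+ 2 <= e0 ^+ 2 by rewrite lerXn2r ?nnegrE ?(ltW d0) ?(ltW e00).
  have := best_cauchy mL bf hs hs0; lra.
have nearr := mean_conv_sqr_le mL br ea e'0 r2 spec.
have e020 : 0 < e0 ^+ 2 by rewrite exprn_gt0.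
have nearu := trig_equi u mL L1 ea e020.
near=> N => w w1.
have N0 : 0 < N%:R :> R by rewrite ltr0n; near: N; exact: nbhs_infty_gt.
have kN : 0 < kappa * N%:R by rewrite mulr_gt0.
have hY t : `|\sum_(n < N) w n * (trig s (t - a n) - trig s0 (t - a n))| <= kappa * N%:R / 2.
  have := near nearu N _ t => /(_ _) hU.
  have {}hU : \sum_(n < N) trig u (t - a n) <= 5 * e0 ^+ 2 * N%:R.
    have /ler_normlP[_ h] : `|\sum_(n < N) trig u (t - a n) - N%:R * L (trig u)| <= e0 ^+ 2 * N%:R.
      exact: hU.
    have : N%:R * L (trig u) <= N%:R * (4 * e0 ^+ 2) by rewrite ler_pM2l.
    lra.
  set Y := \sum_(n < N) _.
  have Y2 : Y ^+ 2 <= N%:R * (5 * e0 ^+ 2 * N%:R).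
    apply: (le_trans (sqr_sum_le _)); rewrite ler_wpM2l ?(ltW N0)//; apply: le_trans hU.
    apply: ler_sum => n _; rewrite uE exprMn ler_piMl ?sqr_ge0//.
    by rewrite -(real_normK (num_real _)) exprn_ile1.
  rewrite -(ger0_norm (_ : 0 <= kappa * N%:R / 2)); last by rewrite divr_ge0// ltW.
  rewrite -ler_sqr ?nnegrE// !real_normK ?num_real//; apply: (le_trans Y2).
  have : 0 <= N%:R ^+ 2 * e0 ^+ 2 by rewrite mulr_ge0 ?sqr_ge0.
  rewrite e0E; lra.
have hr := near nearr N _ w w1.
have kN2 : 0 < (kappa * N%:R) ^+ 2 by rewrite exprn_gt0.
apply: (@le_trans _ _ (L (fun t => (4 / (kappa * N%:R) ^+ 2) *
    (\sum_(n < N) w n * r (t - a n)) ^+ 2))); last first.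
  rewrite (meanZ mL); last by bdd_tac.
  have {}hr : L (fun t => (\sum_(n < N) w n * r (t - a n)) ^+ 2) <= e' * N%:R ^+ 2.
    exact: hr.
  rewrite mulrAC ler_pdivrMr//; apply: (@le_trans _ _ (4 * (e' * N%:R ^+ 2))).
    by rewrite ler_pM2l.
  by rewrite le_eqVlt; apply/orP; left; apply/eqP; rewrite /e'; field.
apply: mean_le => //; last 1 first.
- move=> t; set X := _ - _; set Z := \sum_(n < N) w n * r (t - a n).
  have c0 : 0 <= 4 / (kappa * N%:R) ^+ 2 * Z ^+ 2 by rewrite mulr_ge0 ?sqr_ge0// divr_ge0 ?sqr_ge0.
  have [hX|_] := boolP (kappa * N%:R <= `|X|); last exact: c0.
  have XE : X = \sum_(n < N) w n * (trig s (t - a n) - trig s0 (t - a n)) + Z.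
    rewrite /X /Z /r -big_split/= -sumrB; apply: eq_bigr => n _; ring.
  have hZ : kappa * N%:R / 2 <= `|Z|.
    have := hY t.
    have : `|X| <= `|\sum_(n < N) w n * (trig s (t - a n) - trig s0 (t - a n))| + `|Z|.
      by rewrite XE; exact: ler_normD.
    lra.
  have : (kappa * N%:R / 2) ^+ 2 <= Z ^+ 2.
    by rewrite -(real_normK (num_real Z)) lerXn2r// nnegrE// divr_ge0// ltW.
  move=> hZ2; rewrite mulrAC ler_pdivlMr// mul1r; move: hZ2; rewrite expr_div_n; lra.
- by exists 1 => t; case: (kappa * N%:R <= _); rewrite ?normr1 ?normr0.
- by bdd_tac.
Unshelve. all: by end_near.
Qed.

(** * From means to thick and Bohr sets *)

Definition indic01 (R : realType) (S : set int) (x : int) : R := (`[< S x >])%:R.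

Lemma indic01_bounds (R : realType) (S : set int) x : 0 <= indic01 R S x <= 1.
Proof. by rewrite /indic01; case: `[< _ >]; rewrite ?lexx ?ler01. Qed.

Lemma bdd_indic01 (R : realType) (S : set int) : bdd (indic01 R S).
Proof. by exists 1 => x; have /andP[h1 h2] := indic01_bounds R S x; rewrite ger0_norm. Qed.

(** If every window of length k met the complement, the sum of k shifts of its indicator would be at
    least 1 everywhere, although its mean is at most 1/2. *)
Lemma thick_mean (R : realType) (L : (int -> R) -> R) (S : set int) :
  inv_pos L -> L (fun=> 1) = 1 -> (forall e, 0 < e -> L (indic01 R (~` S)) <= e) -> thick S.
Proof.
move=> mL L1 small k k0.
have k0' : 0 < k%:R :> R by rewrite ltr0n.
have bS := @bdd_indic01 R (~` S).
have LS : L (fun x => \sum_(i < k) indic01 R (~` S) (x + i%:Z)) <= 1 / 2.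
  rewrite mean_sum//; last by move=> i; bdd_tac.
  rewrite (_ : \sum_(i < k) _ = k%:R * L (indic01 R (~` S))); last first.
    by rewrite -sum_const_ord; apply: eq_bigr => i _; rewrite (mean_shift mL).
  have e0 : 0 < (2 * k%:R)^-1 :> R by rewrite invr_gt0 mulr_gt0.
  apply: (@le_trans _ _ (k%:R * (2 * k%:R)^-1)); first by rewrite ler_pM2l// small.
  by rewrite le_eqVlt; apply/orP; left; apply/eqP; field; rewrite gt_eqF.
have [[x hx]|none] := pselect (exists x : int, forall i : 'I_k, S (x + i%:Z)).
  exists x => y /=; rewrite in_itv/= => /andP[h1 h2].
  have ik : (absz (y - x)%R < k)%N by lia.
  have := hx (Ordinal ik); rewrite /= (_ : x + _ = y)//; lia.
have : 1 <= 1 / 2 :> R; last by lra.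
apply: le_trans LS; rewrite -[X in X <= _]L1; apply: mean_le => //.
- exact: bdd_cst.
- by bdd_tac.
move=> x; have [i hi] : exists i : 'I_k, ~ S (x + i%:Z).
  by apply/existsNP => H; apply: none; exists x.
rewrite (bigD1 i)//= {1}/indic01 asboolT//= lerDl.
by apply: sumr_ge0 => j _; have /andP[] := indic01_bounds R (~` S) (x + j%:Z).
Qed.

Lemma bohr_trig (R : realType) (s : seq (R * R * R)) :
  (exists x, 0 < trig s x) -> bohr R [set x | 0 < trig s x].
Proof.
move=> [x0 hx0].
pose p (j : 'I_(size s)) := tnth (in_tuple s) j.
exists (size s), (fun j => ((p j).1.1)%:C%C * cis (p j).2), (fun j => (p j).1.2).
have E n : complex.Re (trig_poly (fun j => ((p j).1.1)%:C%C * cis (p j).2)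
    (fun j => (p j).1.2) n) = trig s n.
  rewrite /trig_poly raddf_sum /trig [RHS]big_tnth; apply: eq_bigr => j _.
  by rewrite /cis/= cosD -/(p j); ring.
split; first by exists x0; rewrite /= E.
by move=> n /=; rewrite E.
Qed.

(** For t outside the sumset every term of the average of 1_B (t - a n) vanishes, while the average
    of the polynomial is at least 4 kappa - 2 kappa > kappa. So t belongs to the exceptional set. *)
Lemma thick_sumset (R : realType) (L : (int -> R) -> R) (a : nat -> int) (B : set int) :
  ergodic L -> equi R a -> 0 < L (indic01 R B) ->
  thick [set x | exists n, exists2 b, B b & x = a n + b].
Proof.
move=> eL ea LB; have [mL L1 _] := eL; set S := [set x | _].
pose kappa := L (indic01 R B) / 4; have k0 : 0 < kappa by rewrite divr_gt0.
have [s0 [hs0 approx]] := trig_approx eL ea (indic01_bounds R B) k0.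
apply: (thick_mean mL L1) => e e0.
have nearap := approx e e0.
have nears := trig_equi s0 mL L1 ea k0.
have [N [N0 hap hs]] : exists N, [/\ (0 < N)%N,
   L (fun t => (kappa * N%:R <= `|\sum_(n < N) 1 * indic01 R B (t - a n) -
        \sum_(n < N) 1 * trig s0 (t - a n)|)%R%:R) <= e &
    forall t, `|\sum_(n < N) trig s0 (t - a n) - N%:R * L (trig s0)| <= kappa * N%:R].
  near \oo => N; exists N; split.
  - by near: N; exact: nbhs_infty_gt.
  - by apply: (near nearap N _ (fun=> 1)) => // n; rewrite normr1.
  - exact: (near nears N).
apply: le_trans hap; apply: mean_le => //; first exact: bdd_indic01.
  by exists 1 => t; case: (kappa * N%:R <= _); rewrite ?normr1 ?normr0.
move=> t; rewrite {1}/indic01; case: asboolP => [/= nS|_]; last by rewrite ler0n.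
have N0' : 0 < N%:R :> R by rewrite ltr0n.
rewrite [X in `|X - _|]big1; last first.
  move=> n _; rewrite /indic01; case: asboolP => [Bt|_]; last by rewrite mulr0.
  by exfalso; apply: nS; exists n; exists (t - a n) => //; rewrite addrC subrK.
rewrite sub0r normrN.
suff -> : kappa * N%:R <= `|\sum_(n < N) 1 * trig s0 (t - a n)| by [].
under eq_bigr do rewrite mul1r.
have h := hs t; apply: le_trans (ler_norm _).
have : N%:R * (L (indic01 R B) - kappa) <= N%:R * L (trig s0).
  by rewrite ler_pM2l//; move: hs0; rewrite ler_norml; lra.
move: h; rewrite ler_norml; have : L (indic01 R B) = 4 * kappa by rewrite /kappa; field.
move=> -> /andP[h1 _] h2; have := mulr_gt0 k0 N0'; lra.
Unshelve. all: by end_near.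
Qed.

(** The addition formula separates t from a(n): the averages have the same frequencies as [s], and
    only finitely many coefficients free of t have to converge. Hence the convergence is uniform in
    t. *)
Lemma trig_ulim (R : realType) (U : set_system nat) (a : nat -> int) (w : nat -> R)
    (s : seq (R * R * R)) : UltraFilter U -> (forall n, `|w n| <= 1) ->
  exists s1, forall e, 0 < e -> U [set N | forall t,
    `|N%:R^-1 * \sum_(n < N) w n * trig s (t - a n) - trig s1 t| <= e].
Proof.
move=> UU w1; elim: s => [|[[c th] phi] s [s1 IH]].
  exists [::] => e e0; apply: filterE => N t; rewrite big1 => [|n _]; last first.
    by rewrite /trig big_nil mulr0.
  by rewrite mulr0 /trig big_nil subrr normr0 ltW.
pose avg (g : nat -> R) N := N%:R^-1 * \sum_(n < N) w n * g n.
have bavg g : (forall n, `|g n| <= 1) -> ubdd U (avg g).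
  move=> g1; apply: (@ubdd_all _ _ _ _ 1) => -[|N].
    by rewrite /avg big_ord0 mulr0 normr0.
  have N0 : 0 < N.+1%:R :> R by rewrite ltr0n.
  rewrite /avg normrM ger0_norm ?invr_ge0// ler_pdivrMl//.
  apply: (le_trans (ler_norm_sum _ _ _)); rewrite mulr1.
  apply: (@le_trans _ _ (\sum_(n < N.+1) (1 : R))); last by rewrite sum_const_ord mulr1.
  by apply: ler_sum => n _; rewrite normrM mulr_ile1.
pose C := avg (fun n => cos (th * (a n)%:~R)).
pose D := avg (fun n => sin (th * (a n)%:~R)).
exists ((c * ulim U C, th, phi) :: (c * ulim U D, th, phi - pi / 2) :: s1) => e e0.
have c0 : 0 < `|c| + 1 by rewrite ltr_wpDl.
have e1 : 0 < e / 4 / (`|c| + 1) by rewrite !divr_gt0.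
have e2 : 0 < e / 2 by rewrite divr_gt0.
have hC := ulimP UU (bavg _ (fun n => cos_max (th * (a n)%:~R))) e1.
have hD := ulimP UU (bavg _ (fun n => sin_max (th * (a n)%:~R))) e1.
apply: filterS (filterI (filterI hC hD) (IH _ e2)) => N [[/= h1 h2] h3] t.
rewrite !trig_cons/= (addrA (th * t%:~R) phi) cosBpihalf.
have -> : N%:R^-1 * \sum_(n < N) w n * trig ((c, th, phi) :: s) (t - a n) =
    c * cos (th * t%:~R + phi) * C N + c * sin (th * t%:~R + phi) * D N +
    N%:R^-1 * \sum_(n < N) w n * trig s (t - a n).
  rewrite /C /D /avg ![_ * (N%:R^-1 * _)]mulrCA -!mulrDr; congr (_ * _).
  rewrite !mulr_sumr -!big_split/=; apply: eq_bigr => n _; rewrite trig_cons/= intrB.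
  have -> : th * (t%:~R - (a n)%:~R) + phi = (th * t%:~R + phi) - th * (a n)%:~R by ring.
  by rewrite cosB; ring.
set X := cos _; set Y := sin _; set Z := N%:R^-1 * _ in h3 *.
rewrite (_ : _ - _ = c * X * (C N - ulim U C) + c * Y * (D N - ulim U D) +
  (Z - trig s1 t)); last by ring.
have term x y : `|x| <= 1 -> `|y| <= e / 4 / (`|c| + 1) -> `|c * x * y| <= e / 4.
  move=> hx hy; rewrite !normrM.
  apply: (@le_trans _ _ ((`|c| + 1) * (e / 4 / (`|c| + 1)))).
    by rewrite ler_pM ?mulr_ge0// (le_trans (ler_piMr _ hx))// lerDl.
  by rewrite le_eqVlt; apply/orP; left; apply/eqP; field; rewrite gt_eqF.
apply: (le_trans (ler_normD _ _)); apply: (le_trans (lerD (ler_normD _ _) (h3 t))).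
have := term X _ (cos_max _) h1; have := term Y _ (sin_max _) h2; lra.
Qed.

Lemma piecewise_bohr_sumset (R : realType) (L : (int -> R) -> R) (a : nat -> int)
    (B : set int) (w : nat -> R) (d : R) :
  ergodic L -> equi R a -> 0 < L (indic01 R B) -> (forall n, 0 <= w n <= 1) -> 0 < d ->
  (forall n0, exists2 N, (n0 <= N)%N & d * N%:R <= \sum_(n < N) w n) ->
  piecewise_bohr R [set x | exists2 n, 0 < w n & exists2 b, B b & x = a n + b].
Proof.
move=> eL ea LB w01 d0 dens; have [mL L1 _] := eL; set S := [set x | _].
have w1 n : `|w n| <= 1 by have /andP[h1 h2] := w01 n; rewrite ger0_norm.
have dle1 : d <= 1.
  have [N N0 hN] := dens 1%N; have N0' : 0 < N%:R :> R by rewrite ltr0n.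
  rewrite -(ler_pM2r N0') mul1r; apply: (le_trans hN).
  apply: (@le_trans _ _ (\sum_(n < N) (1 : R))); last by rewrite sum_const_ord mulr1.
  by apply: ler_sum => n _; have /andP[] := w01 n.
set l := L (indic01 R B) in LB.
(* Gives L (trig s1) >= d (l - kappa) - kappa >= 6 kappa, because d <= 1. *)
pose kappa := d * l / 8.
have k0 : 0 < kappa by rewrite divr_gt0// mulr_gt0.
have kl : kappa <= l / 8.
  by rewrite /kappa -mulrA ler_piMl// divr_ge0// ltW.
have [s0 [hs0 approx]] := trig_approx eL ea (indic01_bounds R B) k0.
(* The ultrafilter must live on lengths N at which the weights have density at least d, and also
   refine the cofinite filter so that eventual estimates apply. *)
pose base (n0 : nat) := [set N | (n0 < N)%N /\ d * N%:R <= \sum_(n < N) w n].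
have pf : ProperFilter (filter_from [set: nat] base).
  apply: filter_from_proper; last first.
    by move=> n0 _; have [N h1 h2] := dens n0.+1; exists N.
  apply: filter_from_filter; first by exists 0%N.
  move=> i j _ _; exists (maxn i j) => // N [].
  by rewrite gtn_max => /andP[h1 h2] h3; split; split.
have [U [UU sU]] := ultraFilterLemma pf.
have ooU : \oo `<=` U.
  move=> A [n0 _ hA]; apply: sU; exists n0 => // N [h _]; apply: hA; exact: ltnW.
have densU n0 : U (base n0) by apply: sU; exists n0.
have [s1 hs1] := trig_ulim a s0 UU w1.
have b0 := @bdd_trig R s0; have b1 := @bdd_trig R s1.
have Ls1 : 6 * kappa <= L (trig s1).
  have [N [[N0 hd] hN]] := ultra_ex2 UU (densU 0%N) (hs1 _ k0).
  have N0' : 0 < N%:R :> R by rewrite ltr0n.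
  have E : L (fun t => N%:R^-1 * \sum_(n < N) w n * trig s0 (t - a n)) =
      N%:R^-1 * (\sum_(n < N) w n) * L (trig s0).
    rewrite (meanZ mL); last by bdd_tac.
    rewrite mean_sum//; last by move=> n; bdd_tac.
    rewrite -mulrA; congr (_ * _); rewrite mulr_suml; apply: eq_bigr => n _.
    by rewrite (meanZ mL) ?(mean_shift mL)//; bdd_tac.
  have h1 : L (fun t => N%:R^-1 * \sum_(n < N) w n * trig s0 (t - a n)) - L (trig s1) <= kappa.
    rewrite -meanB//; last by bdd_tac.
    apply: (mean_le_cst mL L1); first by bdd_tac.
    by move=> t; apply: le_trans (hN t); exact: ler_norm.
  have h2 : d <= N%:R^-1 * (\sum_(n < N) w n) by rewrite ler_pdivlMl// mulrC.
  have h3 : l - kappa <= L (trig s0) by move: hs0; rewrite ler_norml -/l; lra.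
  have h4 : d * (l - kappa) <= N%:R^-1 * (\sum_(n < N) w n) * L (trig s0).
    by apply: ler_pM => //; [exact: ltW|lra].
  have h5 : d * kappa <= 1 * kappa by rewrite ler_pM2r.
  have h6 : d * l = 8 * kappa by rewrite /kappa; field.
  move: h1; rewrite E; lra.
(* Subtracts 3 kappa as a term of frequency 0. The set where [s2] is positive is nonempty as the
   mean of [s1] is at least 6 kappa, and there the weighted averages of [s0] are still at least 2
   kappa. *)
pose s2 := s1 ++ [:: (- (3 * kappa), 0, 0)].
have s2E x : trig s2 x = trig s1 x - 3 * kappa.
  by rewrite trig_cat /(trig [:: _]) big_seq1/= mul0r add0r cos0 mulr1.
set A := [set x | 0 < trig s2 x].
(* With this choice the inclusion is immediate, and thickness amounts to A outside S having mean
   0. *)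
exists A, (~` (A `\` S)); split.
- apply: bohr_trig; apply: contrapT => none.
  have : L (trig s1) <= 3 * kappa.
    apply: (mean_le_cst mL L1) => // x; rewrite leNgt; apply/negP => h; apply: none; exists x.
    by rewrite s2E subr_gt0.
  lra.
- apply: (thick_mean mL L1) => e e0; rewrite setCK.
  have nearap : U [set N | forall w : nat -> R, (forall n, `|w n| <= 1) ->
      L (fun t => (kappa * N%:R <= `|\sum_(n < N) w n * indic01 R B (t - a n) -
        \sum_(n < N) w n * trig s0 (t - a n)|)%R%:R) <= e].
    by apply: ooU; exact: approx.
  have [N [[N0 _] [hap hN]]] := ultra_ex2 UU (densU 0%N) (filterI nearap (hs1 _ k0)).
  have N0' : 0 < N%:R :> R by rewrite ltr0n.
  apply: le_trans (hap w w1); apply: mean_le => //; first exact: bdd_indic01.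
    by exists 1 => t; case: (kappa * N%:R <= _); rewrite ?normr1 ?normr0.
  move=> t; rewrite {1}/indic01; case: asboolP => [[At nS]|_]; last by rewrite ler0n.
  rewrite [X in `|X - _|]big1; last first.
    move=> n _; have /andP[wn0 _] := w01 n.
    move: wn0; rewrite le_eqVlt => /orP[/eqP <-|wn0]; first by rewrite mul0r.
    rewrite /indic01; case: asboolP => [Bt|_]; last by rewrite mulr0.
    by exfalso; apply: nS; exists n => //; exists (t - a n) => //; rewrite addrC subrK.
  rewrite sub0r normrN.
  suff -> : kappa * N%:R <= `|\sum_(n < N) w n * trig s0 (t - a n)| by [].
  apply: le_trans (ler_norm _); rewrite -ler_pdivlMr// mulrC.
  move: (hN t) At; rewrite /A/= s2E ler_norml; lra.
- by move=> x [Ax nAS]; apply: contrapT => nSx; apply: nAS.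
Qed.

(** * Densities *)

Lemma card_fset_set_inj (T : choiceType) (g : nat -> T) (A D : set T) (M : nat) :
  injective g -> D = [set g i | i in [set i | (i < M)%N]] ->
  #|` fset_set (A `&` D)|%fset = (\sum_(i < M) `[< A (g i) >])%N.
Proof.
move=> ginj ->.
have fin : finite_set (A `&` [set g i | i in [set i | (i < M)%N]]).
  by apply: (sub_finite_set (@subIsetr _ _ _)); apply: finite_image; exact: finite_II.
pose P := [fset i : 'I_M | `[< A (g i) >]]%fset.
rewrite (_ : fset_set _ = [fset g (val i) | i in P]%fset); last first.
  apply/fsetP => x; rewrite in_fset_set//; apply/idP/imfsetP => /=.
    rewrite inE /= => -[Ax [i /= iM gx]]; exists (Ordinal iM) => //=.
    by rewrite /P !inE/= gx.
  case=> i; rewrite /P !inE/= => Ai ->; split => //; exists i => //=.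
rewrite card_imfset/=; last by move=> i j /ginj/val_inj.
rewrite -sum1_size big_uniq ?fset_uniq//= big_mkcond/=.
by apply: eq_bigr => i _; rewrite /P !inE/=; case: asboolP.
Qed.

(** An ultralimit of averages over the chosen windows. A shift by k changes a window sum by a
    bounded amount, which disappears after division by M. *)
Lemma means_windows (R : realType) (f : int -> R) (d : R) : bdd f ->
  (\forall M \near \oo, exists N : int, d * M%:R <= \sum_(i < M) f (N + i%:Z)) ->
  exists2 L, means L & d <= L f.
Proof.
move=> bf near_win.
have [N hN] : exists N : nat -> int, \forall M \near \oo,
    d * M%:R <= \sum_(i < M) f (N M + i%:Z).
  have [n0 _ H] := near_win.
  have {}H M : exists N : int, (n0 <= M)%N -> d * M%:R <= \sum_(i < M) f (N + i%:Z).
    have [nM|nM] := leqP n0 M; first by have [x hx] := H M nM; exists x.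
    by exists 0.
  have [N hN] := choice H; exists N; exists n0 => // M; exact: hN.
have [U UU ooU] := oo_ultra.
pose avg (g : int -> R) (M : nat) := M%:R^-1 * \sum_(i < M) g (N M + i%:Z).
have avg_le (g : int -> R) C M : 0 <= C -> (forall x, `|g x| <= C) -> `|avg g M| <= C.
  move=> C0 gC; case: M => [|M]; first by rewrite /avg big_ord0 mulr0 normr0.
  have M0 : 0 < M.+1%:R :> R by rewrite ltr0n.
  rewrite /avg normrM ger0_norm ?invr_ge0// ler_pdivrMl// -sum_const_ord.
  by apply: (le_trans (ler_norm_sum _ _ _)); apply: ler_sum.
have bavg g : bdd g -> ubdd U (avg g).
  move=> [C gC]; apply: (@ubdd_all _ _ _ _ C) => M; apply: avg_le => //.
  exact: le_trans (gC 0).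
pose L g := if `[< bdd g >] then ulim U (avg g) else 0.
have LE g : bdd g -> L g = ulim U (avg g) by move=> bg; rewrite /L; case: asboolP.
exists L; last first.
  rewrite LE//; apply: (ulim_ge UU); first exact: bavg.
  apply: ooU; near=> M => /=.
  have M0 : 0 < M%:R :> R by rewrite ltr0n; near: M; exact: nbhs_infty_gt.
  by rewrite /avg ler_pdivlMl// mulrC; near: M.
split; first split.
- move=> g h bg bh; rewrite !LE//; last exact: bddD.
  rewrite -(ulimD UU (bavg _ bg) (bavg _ bh)); congr ulim; apply/funext => M.
  by rewrite /avg -mulrDr -big_split.
- move=> c g bg; rewrite !LE//; last by bdd_tac.
  rewrite -(ulimZ c UU (bavg _ bg)); congr ulim; apply/funext => M.
  by rewrite /avg mulrCA; congr (_ * _); rewrite mulr_sumr.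
- move=> g bg g0; rewrite LE//; apply: (ulim_ge UU); first exact: bavg.
  by apply: filterE => M /=; rewrite /avg mulr_ge0 ?invr_ge0//; apply: sumr_ge0.
- suff shift_nat g (k : nat) : bdd g -> L (fun x => g (x + k%:Z)) = L g.
    move=> g [] k bg; first exact: shift_nat.
    rewrite -[LHS](shift_nat _ k.+1); last exact: bdd_comp.
    by congr L; apply/funext => x; rewrite NegzE addrK.
  move=> bg; have [C gC] := bg; have C0 : 0 <= C := le_trans (normr_ge0 _) (gC 0).
  rewrite !LE//; last exact: bdd_comp.
  apply: (ulim_near UU); first exact: bavg.
  move=> e e0; apply: ooU; near=> M => /=.
  have M0 : 0 < M%:R :> R by rewrite ltr0n; near: M; exact: nbhs_infty_gt.
  rewrite /avg -mulrBr normrM ger0_norm ?invr_ge0// ler_pdivrMl//.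
  have := @sum_shift_le R (fun i => g (N M + i%:Z)) C M k (fun=> gC _).
  rewrite (_ : \sum_(n < M) _ = \sum_(i < M) g (N M + i%:Z + k%:Z)); last first.
    by apply: eq_bigr => i _; rewrite PoszD addrA.
  move=> h; apply: (le_trans h); rewrite -ler_pdivrMr//.
  by near: M; exact: nbhs_infty_ger.
- rewrite LE; last exact: bdd_cst.
  apply: ulim_cst; apply: ooU; near=> M => /=.
  have M0 : 0 < M%:R :> R by rewrite ltr0n; near: M; exact: nbhs_infty_gt.
  by rewrite /avg sum_const_ord mulr1 mulVf// gt_eqF.
- by move=> g nbg; rewrite /L; case: asboolP.
Unshelve. all: by end_near.
Qed.

Lemma banach_windows (R : realType) (B : set int) : 0 < upper_banach_density R B ->
  exists2 d : R, 0 < d & \forall M \near \oo, exists N : int,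
    d * M%:R <= \sum_(i < M) indic01 R B (N + i%:Z).
Proof.
rewrite /upper_banach_density; set F := fun M : nat => sup _ => l0.
(* A divergent [F] would have the default limit 0, which positivity of the density excludes. *)
have cF : cvg (F @ \oo).
  by apply: contrapT => /dvgP e; move: l0; rewrite e ltxx.
exists (lim (F @ \oo) / 2); first by rewrite divr_gt0.
near=> M.
have M0 : (0 < M)%N by near: M; exact: nbhs_infty_gt.
have FM : lim (F @ \oo) / 2 < F M.
  near: M; apply: (cvgr_gt _ cF); rewrite ltr_pdivrMr//; lra.
have [|_ [N _ <-] h] := sup_gt _ FM.
  by exists (#|` fset_set (B `&` `[0, 0 + M%:Z - 1])|%fset%:R / M%:R), 0.
exists N; move: h; rewrite ltr_pdivlMr ?ltr0n// => /ltW/le_trans; apply.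
rewrite (@card_fset_set_inj _ (fun i : nat => N + i%:Z) B _ M).
- by rewrite natr_sum.
- by move=> i j /addrI [].
apply/seteqP; split => x /=.
  by rewrite in_itv/= => /andP[h1 h2]; exists (absz (x - N)); lia.
by move=> [i /= iM <-]; rewrite in_itv/=; lia.
Unshelve. all: by end_near.
Qed.

Lemma upper_density_often (R : realType) (C : set nat) : 0 < upper_density R C ->
  exists2 d : R, 0 < d & forall n0, exists2 N, (n0 <= N)%N &
    d * N%:R <= \sum_(n < N) (`[< C n.+1 >])%:R.
Proof.
rewrite /upper_density; set u := (X in limn_sup X) => l0.
have uE N : u N = (\sum_(n < N) (`[< C n.+1 >])%:R) / N%:R.
  rewrite /u (@card_fset_set_inj _ S C _ N) ?natr_sum//; first exact: succn_inj.
  apply/seteqP; split => x /=.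
    by rewrite in_itv/= => /andP[h1 h2]; exists x.-1; case: x h1 h2.
  by move=> [i /= iM <-]; rewrite in_itv/=; exact: iM.
have u01 N : 0 <= u N <= 1.
  rewrite uE; case: N => [|N]; first by rewrite big_ord0 mul0r lexx ler01.
  rewrite divr_ge0 ?sumr_ge0//= ler_pdivrMr ?ltr0n// mul1r.
  apply: (@le_trans _ _ (\sum_(n < N.+1) (1 : R))); last by rewrite sum_const_ord mulr1.
  by apply: ler_sum => n _; case: asboolP => _; rewrite ?ler01.
have bu : bounded_fun u.
  exists 1; split; first exact: num_real.
  move=> M M1 x _ /=; have /andP[h1 h2] := u01 x; rewrite ger0_norm//.
  by apply: (le_trans h2); exact: ltW.
rewrite limn_supE// in l0.
exists (inf (range (sups u)) / 2); first by rewrite divr_gt0.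
move=> n0.
have ub n : has_ubound (sdrop u n) by exists 1 => _ [k _ <-]; have /andP[] := u01 k.
have le1 : inf (range (sups u)) <= sups u n0.
  apply: ge_inf; last by exists n0.
  exists 0 => _ [n _ <-]; apply: (@le_trans _ _ (u n)); first by have /andP[] := u01 n.
  by apply: ub_le_sup => //; exists n => /=.
have lt2 : inf (range (sups u)) / 2 < sups u n0.
  by apply: lt_le_trans le1; rewrite ltr_pdivrMr//; lra.
have [|_ [N /= nN <-] h] := sup_gt _ lt2; first by exists (u n0), n0 => /=.
(* For N = 0 both sides are 0, which keeps the quotient by 0 out of the computation. *)
exists N => //; case: N nN h => [_|N _]; first by rewrite mulr0 big_ord0.
by rewrite uE ltr_pdivlMr ?ltr0n// => /ltW.
Qed.

Theorem corollary1p5 (R : realType) (alpha : R) (B : set int)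
  (alpha_gt0 : 0 < alpha) (alpha_nint : alpha \isn't a Num.int)
  (dB : 0 < upper_banach_density R B) :
  thick [set Num.floor (n%:R `^ alpha) + b | n in [set n : nat | (0 < n)%N] & b in B]
  /\
  forall C : set nat, C `<=` [set n : nat | (0 < n)%N] ->
    0 < upper_density R C ->
    piecewise_bohr R
      [set Num.floor (c%:R `^ alpha) + b | c in C & b in B].
Proof.
(* Indexed from 0: [a n] belongs to the positive integer n+1. *)
pose a (n : nat) := Num.floor (n.+1%:R `^ alpha : R).
have ea : equi R a by move=> c e; exact: weyl_floor (weyl_powR alpha_gt0 alpha_nint).
have [d d0 win] := banach_windows dB.
have [L0 mL0 L0B] := means_windows (bdd_indic01 R B) win.
have [L eL L0L] := exists_ergodic mL0 (bdd_indic01 R B).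
have LB : 0 < L (indic01 R B) by apply: lt_le_trans L0L; exact: lt_le_trans L0B.
split.
  rewrite (_ : [set _ | _ in _ & _ in _] = [set x | exists n, exists2 b, B b & x = a n + b]).
    exact: thick_sumset eL ea LB.
  apply/seteqP; split => x /=.
    by move=> [[|n]// _ [b Bb <-]]; exists n, b.
  by move=> [n [b Bb ->]]; exists n.+1 => //; exists b.
move=> C C0 dC; have [d' d'0 often] := upper_density_often dC.
(* The indicator of [C], shifted by one, becomes the weight, so a positive weight at n means that
   n+1 lies in [C]. *)
rewrite (_ : [set _ | _ in _ & _ in _] =
    [set x | exists2 n, 0 < (`[< C n.+1 >])%:R :> R & exists2 b, B b & x = a n + b]).
  apply: (@piecewise_bohr_sumset R L a B (fun n => (`[< C n.+1 >])%:R) d') => //.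
  by move=> n; case: asboolP => _; rewrite ?lexx ?ler01.
apply/seteqP; split => x /=.
  move=> [[|n] Cn [b Bb <-]]; first by have := C0 _ Cn.
  by exists n; [rewrite asboolT// ltr01|exists b].
move=> [n]; case: asboolP => [Cn _ [b Bb ->]|_]; last by rewrite ltxx.
by exists n.+1 => //; exists b.
Qed.
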